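(* Let $\{B^H(t), t\in[0,1]\}$ be a $d$-dimensional fractional Brownian motion of Hurst index $H\in(0,1)$, let $f:[0,1]\to\mathbb{R}^d$ be Hölder continuous of order $H$ with constant $K$, and let $F\subseteq\mathbb{R}^d$ be compact. Let $I=[\varepsilon_0,1]$ with $\varepsilon_0\in(0,1)$ fixed, and let $E$ be a Borel subset of $I$ which is $\beta$-regular for some $\beta\in(0,1]$, i.e. there exist a finite positive Borel measure $\nu$ supported on $E$ and a positive constant $\mathfrak{c}_9$ such that $$\mathfrak{c}_9^{-1}\delta^\beta\le\nu([a-\delta,a+\delta])\le\mathfrak{c}_9\,\delta^\beta\quad\text{for all }a\in E,\ 0<\delta\le1.$$ Then there is a positive and finite constant $\mathfrak{c}_{10}$, which depends on $E$, $F$, $H$, $K$ and $\beta$, such that $$\mathfrak{c}_{10}^{-1}\,\mathcal{C}_{d-\beta/H}(F)\le\mathbb{P}\{(B^H+f)(E)\cap F\neq\emptyset\}\le\mathfrak{c}_{10}\,\mathcal{H}^{d-\beta/H}(F).$$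
   Context: A $d$-dimensional fractional Brownian motion of Hurst index $H\in(0,1)$ is $B^H=(B^H_1,\dots,B^H_d)$ with independent components, each a real-valued centered Gaussian process with stationary increments and covariance $\mathbb{E}(B^H_i(s)B^H_i(t))=\frac12(|t|^{2H}+|s|^{2H}-|t-s|^{2H})$, defined on a complete probability space $(\Omega,\mathcal{F},\mathbb{P})$. $f$ Hölder continuous of order $H$ with constant $K$ means $\|f(t)-f(s)\|\le K|t-s|^H$ for all $s,t\in[0,1]$, with $\|\cdot\|$ the Euclidean norm. For $\gamma>0$, $\mathcal{H}^\gamma$ is the usual $\gamma$-dimensional Hausdorff measure on $\mathbb{R}^d$: $\mathcal{H}^\gamma(A)=\lim_{\delta\to0}\inf\{\sum_n(2r_n)^\gamma: A\subseteq\bigcup_n B(r_n),\ r_n\le\delta\}$, with $B(r)$ denoting an open Euclidean ball of radius $r$; by convention $\mathcal{H}^\gamma(\cdot)=1$ whenever $\gamma\le0$. The Bessel–Riesz capacity of order $\alpha$ is $$\mathcal{C}_\alpha(A)=\Big[\inf_{\mu\in\mathcal{P}(A)}\iint\varphi_\alpha(\|x-y\|)\,\mu(dx)\mu(dy)\Big]^{-1},$$ where $\mathcal{P}(A)$ is the family of probability measures carried by $A$ and, for $r>0$, $\varphi_\alpha(r)=r^{-\alpha}$ if $\alpha>0$, $\varphi_\alpha(r)=\log\big(\frac{e}{r\wedge1}\big)$ if $\alpha=0$, $\varphi_\alpha(r)=1$ if $\alpha<0$.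
   Formalization: The constant c10 may depend also on f(0): with only E, F, H, K, β the lower bound fails, since adding a large constant vector to f keeps K but sends the hitting probability to 0. Paths of B^H are assumed almost surely continuous. *)

(* Defs.v *)
From HB Require Import structures.
From mathcomp Require Import all_boot all_order all_algebra.
From mathcomp Require Import all_classical all_reals all_analysis.

Set Implicit Arguments.
Unset Strict Implicit.
Unset Printing Implicit Defensive.

Import Order.TTheory GRing.Theory Num.Theory.
Import numFieldNormedType.Exports.

Local Open Scope classical_set_scope.
Local Open Scope ring_scope.

(* The library's norm on ['rV[R]_d] is the sup norm; it induces the same
   topology as [enorm], so that the library's [compact] and [open] apply. *)
Definition enorm (R : realType) (d : nat) (x : 'rV[R]_d) : R :=
  Num.sqrt (\sum_i x 0 i ^+ 2).

Definition eball (R : realType) (d : nat) (x : 'rV[R]_d) (r : R) :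
    set 'rV[R]_d :=
  [set y | enorm (y - x) < r].

Definition borel_rV (R : realType) (d : nat) :=
  g_sigma_algebraType (@open 'rV[R]_d).

Section gaussian_processes.
Context {R : realType} {disp : measure_display} {T : measurableType disp}
  (P : probability T R).

(* Degenerate laws are allowed (e.g. at time 0). They are treated apart since
   the library's [normal_prob m 0] is the uniform law on [0, 1]. *)
Definition gaussian_law (m s : R) (A : set R) : \bar R :=
  if s == 0 then \d_m A else normal_prob m s A.

Definition gaussian_variable (X : T -> R) :=
  exists m s : R, forall A : set (measurableTypeR R), measurable A ->
    P (X @^-1` A) = gaussian_law m s A.

(* Processes are functions of a real time of which only the values on [0, 1]
   matter. *)
Definition gaussian_process (X : R -> {RV P >-> R}) :=
  forall (n : nat) (t a : 'I_n -> R), (forall j, t j \in `[0, 1]) ->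
    gaussian_variable (fun w => \sum_j a j * X (t j) w).

Definition centered (X : R -> {RV P >-> R}) :=
  forall t, t \in `[0, 1] -> ('E_P[X t] = 0)%E.

(* [(X (h + t) - X h)_t] and [(X t - X 0)_t] have the same finite-dimensional
   laws. *)
Definition stationary_increments (X : R -> {RV P >-> R}) :=
  forall (h : R) (n : nat) (t : 'I_n -> R), h \in `[0, 1] ->
    (forall j, t j \in `[0, 1]) -> (forall j, h + t j \in `[0, 1]) ->
    forall A : set (borel_rV R n), measurable A ->
      P [set w | A (\row_j (X (h + t j) w - X h w))] =
      P [set w | A (\row_j (X (t j) w - X 0 w))].

Definition process_sigma_algebra (X : R -> {RV P >-> R}) : set (set T) :=
  <<s [set C | exists (t : R) (A : set (measurableTypeR R)),
         [/\ t \in `[0, 1], measurable A & C = X t @^-1` A] ]>>.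

(* Taking some of the [A i] equal to [setT] gives the product rule for the
   subfamilies. *)
Definition independent_processes (d : nat) (X : 'I_d -> R -> {RV P >-> R}) :=
  forall A : 'I_d -> set T, (forall i, process_sigma_algebra (X i) (A i)) ->
    (P (\bigcap_i A i) = \prod_(i < d) P (A i))%E.

Definition fbm_covariance (H : R) (X : R -> {RV P >-> R}) :=
  forall s t : R, s \in `[0, 1] -> t \in `[0, 1] ->
    ('E_P[fun w => (X s w * X t w)%R] =
     (2^-1 * (`|t| `^ (2 * H) + `|s| `^ (2 * H) - `|t - s| `^ (2 * H)))%R%:E)%E.

(* The almost sure continuity of the paths is part of the definition: the
   finite-dimensional laws alone do not determine hitting probabilities. *)
Definition fractional_brownian_motion (H : R) (d : nat)
    (B : 'I_d -> R -> {RV P >-> R}) :=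
  [/\ independent_processes B,
      forall i, [/\ gaussian_process (B i), centered (B i),
                    stationary_increments (B i) & fbm_covariance H (B i)] &
      {ae P, forall w, forall i,
        {within `[0, 1], continuous (fun t : R => B i t w)}}].

End gaussian_processes.

Definition holder_continuous (R : realType) (d : nat) (H K : R)
    (f : R -> 'rV[R]_d) :=
  forall s t : R, s \in `[0, 1] -> t \in `[0, 1] ->
    enorm (f t - f s) <= K * `|t - s| `^ H.

(* "Positive" means nonzero, hence [E] is nonempty. *)
Definition regular_set (R : realType) (beta : R) (E : set R) :=
  exists (nu : {finite_measure set (measurableTypeR R) -> \bar R}) (c : R),
    [/\ (0 < nu setT)%E, nu (~` E) = 0%E, 0 < c &
        forall a delta : R, E a -> 0 < delta <= 1 ->
          ((c^-1 * delta `^ beta)%R%:E <= nu `[(a - delta)%R, (a + delta)%R]%classic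
             <= (c * delta `^ beta)%R%:E)%E].

(* Radius 0 (the empty ball) is allowed, so that finite covers count as
   sequences. *)
Definition hausdorff_content (R : realType) (d : nat) (gamma delta : R)
    (A : set 'rV[R]_d) : \bar R :=
  ereal_inf [set s | exists (x : nat -> 'rV[R]_d) (r : nat -> R),
    [/\ forall n, 0 <= r n <= delta,
        A `<=` \bigcup_n eball (x n) (r n) &
        s = (\sum_(0 <= n <oo) ((2 * r n) `^ gamma)%R%:E)%E] ].

Definition hausdorff_measure (R : realType) (d : nat) (gamma : R)
    (A : set 'rV[R]_d) : \bar R :=
  if gamma <= 0 then 1%E
  else lim (hausdorff_content gamma delta A @[delta --> 0^'+]).

(* The kernel is extended to [r = 0] by its limit there; note that the
   library has [0 `^ (- alpha) = 0] and [ln 0 = 0]. *)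
Definition riesz_kernel (R : realType) (alpha r : R) : \bar R :=
  if alpha < 0 then 1%E
  else if r == 0 then +oo%E
  else if alpha == 0 then (ln (expR 1 / Num.min r 1))%:E
  else (r `^ (- alpha))%:E.

Definition carried_by (R : realType) (d : nat) (A : set 'rV[R]_d) :
    set (probability (borel_rV R d) R) :=
  [set mu : probability (borel_rV R d) R | mu.-negligible (~` A)].

Definition riesz_energy (R : realType) (d : nat) (alpha : R)
    (mu : probability (borel_rV R d) R) : \bar R :=
  (\int[mu]_x \int[mu]_y riesz_kernel alpha (enorm (x - y)%R))%E.

(* The inverse in [\bar R] satisfies [+oo^-1 = 0]; the infimum over the empty
   set is [+oo]. *)
Definition riesz_capacity (R : realType) (d : nat) (alpha : R)
    (A : set 'rV[R]_d) : \bar R :=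
  ((ereal_inf [set riesz_energy alpha mu | mu in carried_by A])^-1)%E.

(* Main.v *)
Require Import Defs.
From HB Require Import structures.
From mathcomp Require Import all_boot all_order all_algebra.
From mathcomp Require Import all_classical all_reals all_analysis.
From mathcomp Require Import measurable_realfun.
From mathcomp Require Import ring lra.

Set Implicit Arguments.
Unset Strict Implicit.
Unset Printing Implicit Defensive.

Import Order.TTheory GRing.Theory Num.Theory.
Import numFieldNormedType.Exports.

Local Open Scope classical_set_scope.
Local Open Scope ring_scope.

(** Write [gamma = d - beta / H]. The estimates at two times rest on local
    nondeterminism: for times [s], [t] bounded away from 0, the conditional standard
    deviation of [B_i t] given [B_i s] is comparable to [|t - s| `^ H]
    ([residual_var_ge]). It enters through rectangles [|X - x| <= e, |W - y| <= d] for
    uncorrelated linear combinations [X], [W] of the values of a coordinate: their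
    indicator is at most a constant times a product of Gaussian bumps, and the
    expectation of that product is computed from the characteristic function of the pair
    ([probability_rectangle_le]).

    Upper bound. A ball of radius [r] is hit during a given time interval of length
    [delta = r `^ H^-1] with probability [O(r `^ d)]: the drift moves by [O(r)] there,
    the coordinates are independent, and a coordinate that comes within [O(r)] of a
    point during the interval does so with probability [O(r)], by a chaining argument on
    the residual of its regression on the value at the end of the interval
    ([dyadic_small_ball]). By regularity [O(delta `^ (- beta))] such intervals cover
    [E], so that the ball is hit with probability [O(r `^ gamma)] ([ball_hitting_le]).
    Summing over a cover of [F] gives the Hausdorff measure; if [gamma <= 0] the bound
    is that a probability is at most 1.

    Lower bound. Let [nu] be the measure of the regular set and [mu] a probability
    measure carried by [F]. Cutting [E] and [F] into small cells turns [nu] and [mu]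
    into finitely many weighted points, and one considers the weighted number of pairs
    (time, point) such that the path at that time is within [e] of that point. Its mean
    is of order [e ^+ d] by the lower bound on one-dimensional Gaussian densities
    ([near_event_ge]). Its second moment is at most of order [e ^+ (2 * d)] times the
    energy of [mu]: two pairs are simultaneously good with probability [O(e ^+ (2 * d) *
    (|t - s| `^ H + |y - x|) ^- d)] ([near_event_pair_le]), and summing over [t] in the
    regular set, shell by shell, turns this power into the Riesz kernel of order [gamma]
    at [|y - x|] ([regular_kernel_sum], [dyadic_shell_sum]). The second moment method
    then bounds from below, uniformly in [e], the probability of approximate hitting
    ([approximate_hitting]). As [e] goes to 0, compactness of the time set and of [F]
    and continuity of the paths turn approximate hitting into hitting
    ([contact_of_approximate]).

    Both compactness of the time set and measurability of the hitting event come from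
    Choquet's capacitability theorem ([hitting_capacitability]): a Borel set of times is
    a Suslin set, hence the outer measure of the event that it contains a hitting time
    is approached along compact subsets of the time set. Applied to the random set
    reduced to the sample point, it yields a compact subset of [E] of positive mass;
    applied to the hitting times it shows, the probability space being complete, that
    the hitting event is measurable. *)

(** * Stein's identity, moments and characteristic function of the normal law *)

Section normal_integral.
Context {R : realType}.
Local Notation mu := (@lebesgue_measure R).
Variables (m s : R).
Hypothesis s0 : s != 0.

Lemma ge0_integral_normal_prob (f : R -> \bar R) :
  measurable_fun [set: R] f -> (forall x, 0 <= f x)%E ->
  (\int[normal_prob m s]_x f x = \int[mu]_x (f x * (normal_pdf m s x)%:E))%E.
Proof.
move=> mf f0.
have dom := @normal_prob_dominates R m s.
rewrite -(Radon_Nikodym_SigmaFinite.change_of_variables dom)//.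
apply: ae_eq_integral => //.
- apply: emeasurable_funM => //; apply: (measurable_int mu).
  exact: Radon_Nikodym_SigmaFinite.f_integrable.
- apply: emeasurable_funM => //=; apply/measurableT_comp => //=.
  exact: measurable_normal_pdf.
- apply: ae_eqe_mul2l => /=.
  apply: integral_ae_eq => //=.
  + exact: Radon_Nikodym_SigmaFinite.f_integrable.
  + by apply/measurableT_comp => //; exact: measurable_normal_pdf.
  + by move=> A _ mA; rewrite -Radon_Nikodym_SigmaFinite.f_integral.
Qed.

Lemma integrable_normal_prob (f : R -> R) :
  measurable_fun [set: R] f ->
  mu.-integrable [set: R] (fun x => (f x * normal_pdf m s x)%:E) ->
  (normal_prob m s).-integrable [set: R] (EFin \o f).
Proof.
move=> mf /integrableP[_ fi]; apply/integrableP; split.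
  exact/measurable_EFinP.
rewrite ge0_integral_normal_prob//; last first.
  by apply/measurableT_comp => //; exact/measurable_EFinP.
rewrite (_ : (\int[mu]__ _ = \int[mu]_x `|(f x * normal_pdf m s x)%:E|)%E)//.
apply: eq_integral => x _ /=; by rewrite -EFinM normrM (ger0_norm (normal_pdf_ge0 _ _ _)).
Qed.

Lemma integral_normal_prob (f : R -> R) :
  measurable_fun [set: R] f ->
  mu.-integrable [set: R] (fun x => (f x * normal_pdf m s x)%:E) ->
  (\int[normal_prob m s]_x (f x)%:E = \int[mu]_x (f x * normal_pdf m s x)%:E)%E.
Proof.
move=> mf fi; rewrite integralE [RHS]integralE; congr (_ - _)%E.
- rewrite ge0_integral_normal_prob//; last first.
    by apply: measurable_funepos; exact/measurable_EFinP.
  apply: eq_integral => x _; rewrite !funeposE EFinM.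
  rewrite -!EFin_max -!EFinM; congr EFin.
  by rewrite maxr_pMl ?normal_pdf_ge0// mul0r.
- rewrite ge0_integral_normal_prob//; last first.
    by apply: measurable_funeneg; exact/measurable_EFinP.
  apply: eq_integral => x _; rewrite !funenegE -!EFinN -!EFin_max -EFinM.
  congr EFin; by rewrite maxr_pMl ?normal_pdf_ge0// mul0r mulNr.
Qed.

End normal_integral.

Section integral_derivative.
Context {R : realType}.
Local Notation mu := (@lebesgue_measure R).

(** The integral over [-n, n] is a difference of boundary values. *)
Lemma integral_derivative_eq0 (F f : R -> R) :
  (forall x, is_derive x (1:R) F (f x)) -> continuous f ->
  mu.-integrable [set: R] (EFin \o f) ->
  F n%:R @[n --> \oo] --> (0:R) -> F (- n%:R) @[n --> \oo] --> (0:R) ->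
  (\int[mu]_x (f x)%:E = 0)%E.
Proof.
move=> dF cf fi Fp Fn.
pose I_ n := `[- (n.+1)%:R, (n.+1)%:R]%classic : set R.
pose g n x := (EFin (f x * \1_(I_ n) x)).
have gI n : (\int[mu]_x g n x = (F n.+1%:R - F (- n.+1%:R))%:E)%E.
  have -> : (\int[mu]_x g n x = \int[mu]_(x in I_ n) (f x)%:E)%E.
    rewrite [RHS]integral_mkcond; apply: eq_integral => x _.
    rewrite /g patchE indicE; case: ifPn => _; rewrite ?mulr1// mulr0//.
  rewrite (@continuous_FTC2 _ f F)//.
  - by rewrite ltrNl (lt_le_trans _ (ler0n _ n.+1))// oppr_lt0 ltr0n.
  - exact: continuous_subspaceT.
  - split.
    + by move=> x _; have [] := dF x.
    + apply: cvg_at_right_filter; apply: differentiable_continuous.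
      by apply/derivable1_diffP; have [] := dF (- n.+1%:R).
    + apply: cvg_at_left_filter; apply: differentiable_continuous.
      by apply/derivable1_diffP; have [] := dF (n.+1%:R).
  - by move=> x _; rewrite derive1E; have [_ ->] := dF x.
have c1 : (\int[mu]_x g n x)%E @[n --> \oo] --> (\int[mu]_x (f x)%:E)%E.
  apply: (@dominated_cvg _ _ _ mu [set: R] _ g _ (fun x => `|(f x)%:E|%E)) => //.
  - move=> n; apply/measurable_EFinP; apply: measurable_funM => //.
      by apply/measurable_EFinP; exact: (measurable_int mu).
    by apply: measurable_indic; exact: measurable_itv.
  - move=> x _; apply: cvg_near_cst.
    near=> n; rewrite /g indicE mem_set ?mulr1//=.
    rewrite /I_ /= in_itv/= -ler_norml.
    have : `|x| <= n%:R by near: n; exact: nbhs_infty_ger.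
    by move=> /le_trans; apply; rewrite ler_nat leqnSn.
  - exact: integrable_abse.
  - move=> n x _; rewrite /g /= lee_fin normrM ler_piMr//.
    by rewrite indicE; case: (_ \in _); rewrite ?normr1 ?normr0.
have c2 : (\int[mu]_x g n x)%E @[n --> \oo] --> (0:R)%:E.
  under eq_fun do rewrite gI.
  apply: cvg_EFin; first exact: nearW.
  rewrite -[X in _ --> X](subrr (0:R)); apply: cvgB.
  - by rewrite (cvg_shiftS (fun n => F n%:R)).
  - by rewrite (cvg_shiftS (fun n => F (- n%:R))).
exact: (cvg_unique _ c1 c2).
Unshelve. all: end_near. Qed.

End integral_derivative.

Section normal_moments.
Context {R : realType}.
Local Notation mu := (@lebesgue_measure R).
Variables (m s : R).
Hypothesis s0 : s != 0.
Local Notation q := (normal_fun m s).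
Local Notation N := (normal_prob m s).

Lemma is_derive_normal_fun (x : R) :
  is_derive x (1:R) q (- ((x - m) / s ^+ 2) * q x).
Proof.
have h : is_derive x (1:R) (fun x => - (x - m) ^+ 2 / (s ^+ 2 *+ 2))
   (- ((x - m) / s ^+ 2)).
  apply: is_derive_eq.
  rewrite /GRing.scale /=; field.
  by rewrite s0.
rewrite mulrC; exact: (@is_derive1_comp _ expR _ x _ _ (is_derive_expR _) h).
Qed.

(** Half of the exponent absorbs the quadratic factor. *)
Lemma normal_fun_decay x : (1 + ((x - m) / s) ^+ 2) * q x <= 4 * normal_fun m (Num.sqrt 2 * s) x.
Proof.
set y := (x - m) / s.
have -> : q x = expR (- (y ^+ 2 / 4)) * expR (- (y ^+ 2 / 4)).
  by rewrite -expRD /normal_fun /y; congr expR; field.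
have -> : normal_fun m (Num.sqrt 2 * s) x = expR (- (y ^+ 2 / 4)).
  rewrite /normal_fun /y exprMn sqr_sqrtr//; congr expR; field.
  by rewrite s0.
rewrite mulrA ler_wpM2r ?expR_ge0// expRN ler_pdivrMr ?expR_gt0//.
have := expR_ge1Dx (y ^+ 2 / 4). lra.
Qed.

Lemma integrable_normal_fun_bound (g : R -> R) (C : R) :
  measurable_fun [set: R] g ->
  (forall x, `|g x| <= C * (1 + ((x - m) / s) ^+ 2)) ->
  mu.-integrable [set: R] (fun x => (g x * q x)%:E).
Proof.
move=> mg gC.
have C0 : 0 <= C.
  have := gC m; rewrite subrr mul0r expr0n addr0 mulr1.
  by apply: le_trans.
have s20 : Num.sqrt 2 * s != 0 by rewrite mulf_neq0// gt_eqF// sqrtr_gt0.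
apply: (@le_integrable _ _ _ mu _ measurableT _
   (fun x => ((C * 4) / normal_peak (Num.sqrt 2 * s))%:E *
             (normal_pdf m (Num.sqrt 2 * s) x)%:E)%E).
- apply/measurable_EFinP; apply: measurable_funM => //.
  exact: measurable_normal_fun.
- move=> x _ /=; rewrite lee_fin normal_pdfE// mulrA divfK; last first.
    by rewrite gt_eqF// normal_peak_gt0.
  rewrite normrM (ger0_norm (normal_fun_ge0 _ _ _)) [leRHS]ger0_norm; last first.
    by rewrite !mulr_ge0// normal_fun_ge0.
  apply: (@le_trans _ _ (C * (1 + ((x - m) / s) ^+ 2) * q x)).
    by rewrite ler_wpM2r// normal_fun_ge0.
  by rewrite -!mulrA ler_wpM2l// normal_fun_decay.
- apply: integrableZl => //; exact: integrable_normal_pdf.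
Qed.

Lemma integrable_normal_prob_bound (g : R -> R) (C : R) :
  measurable_fun [set: R] g ->
  (forall x, `|g x| <= C * (1 + ((x - m) / s) ^+ 2)) ->
  mu.-integrable [set: R] (fun x => (g x * normal_pdf m s x)%:E).
Proof.
move=> mg gC; rewrite normal_pdfE//.
rewrite (_ : (fun x => _) = (fun x => (normal_peak s)%:E * (g x * q x)%:E)%E).
  by apply: integrableZl => //; exact: integrable_normal_fun_bound gC.
by apply/funext => x; rewrite -EFinM; congr EFin; rewrite mulrCA.
Qed.

(** Integration by parts: the integrand multiplied by the density is the derivative of
    [g] multiplied by the density. *)
Lemma stein (g g' : R -> R) (C : R) :
  (forall x, is_derive x (1:R) g (g' x)) -> continuous g -> continuous g' ->
  (forall x, `|g x| <= C * (1 + `|(x - m) / s|)) -> (forall x, `|g' x| <= C) ->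
  (\int[N]_x (g' x - (x - m) / s ^+ 2 * g x)%:E = 0)%E.
Proof.
move=> dg cg cg' gC g'C.
have C0 : 0 <= C by apply: le_trans (g'C 0).
have cxm : continuous (fun x : R => (x - m) / s ^+ 2).
  move=> x; apply: cvgM; last exact: cvg_cst.
  by apply: cvgB; [exact: cvg_id|exact: cvg_cst].
have ch : continuous (fun x => g' x - (x - m) / s ^+ 2 * g x).
  move=> x; apply: cvgB; first exact: cg'.
  by apply: cvgM; [exact: cxm|exact: cg].
pose D := C + C * `|s|^-1 * 3.
have D0 : 0 <= `|s|^-1 by rewrite invr_ge0.
have hD x : `|g' x - (x - m) / s ^+ 2 * g x| <= D * (1 + ((x - m) / s) ^+ 2).
  set y := (x - m) / s.
  have -> : (x - m) / s ^+ 2 = y * s^-1 by rewrite /y -mulrA -invfM expr2.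
  have := gC x; rewrite -/y; clearbody y => gx.
  apply: (le_trans (ler_normB _ _)).
  rewrite !normrM normfV mulrDl lerD//.
    apply: (le_trans (g'C x)); rewrite ler_peMr// lerDl; exact: sqr_ge0.
  apply: (@le_trans _ _ (`|y| * `|s|^-1 * (C * (1 + `|y|)))).
    by rewrite ler_wpM2l ?mulr_ge0.
  rewrite -(normr1 R) -[y ^+ 2]ger0_norm ?sqr_ge0// normrX.
  have y0 : 0 <= `|y| by [].
  rewrite normr1.
  have -> : `|y| * `|s|^-1 * (C * (1 + `|y|)) = C * `|s|^-1 * (`|y| * (1 + `|y|)) by ring.
  rewrite -[leRHS]mulrA ler_wpM2l ?mulr_ge0//.
  nra.
have mh : measurable_fun [set: R] (fun x => g' x - (x - m) / s ^+ 2 * g x).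
  exact: continuous_measurable_fun.
rewrite integral_normal_prob//; last exact: integrable_normal_prob_bound hD.
rewrite normal_pdfE//.
under eq_integral do rewrite mulrCA EFinM.
rewrite integralZl//; last exact: integrable_normal_fun_bound hD.
suff -> : (\int[mu]_x ((g' x - (x - m) / s ^+ 2 * g x) * q x)%:E = 0)%E.
  by rewrite mule0.
have decay (u : R^nat) : (`|(u n - m) / s| @[n --> \oo] --> +oo) ->
    g (u n) * q (u n) @[n --> \oo] --> (0:R).
  move=> uoo; apply/cvgr0Pnorm_le => e e0.
  have : \forall n \near \oo, (C * 4 / e) <= `|(u n - m) / s|.
    by move/cvgryPge : uoo; exact.
  apply: filterS => n; set y := (u n - m) / s => hn.
  have Hq : q (u n) * (1 + y ^+ 2 / 2) <= 1.
    have -> : q (u n) = expR (- (y ^+ 2 / 2)).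
      by rewrite /normal_fun /y; congr expR; field.
    rewrite expRN mulrC ler_pdivrMr ?expR_gt0// mul1r.
    exact: expR_ge1Dx.
  have q0 := normal_fun_ge0 m s (u n).
  rewrite normrM (ger0_norm q0).
  apply: (@le_trans _ _ (C * (1 + `|y|) * q (u n))).
    by rewrite ler_wpM2r.
  have y2 : y ^+ 2 = `|y| ^+ 2 by rewrite -normrX ger0_norm// sqr_ge0.
  have y0 : 0 <= `|y| by [].
  move: Hq; rewrite y2.
  have hn' : C * 4 <= e * `|y| by rewrite [e * _]mulrC -ler_pdivrMr.
  move: (`|y|) (q (u n)) y0 q0 hn' => Y Q Y0 Q0 hn' Hq.
  have h1 : (1 + Y) ^+ 2 <= 4 * (1 + Y ^+ 2 / 2) by nra.
  have h2 : Q * (1 + Y) ^+ 2 <= 4 by apply: (le_trans (ler_wpM2l Q0 h1)); lra.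
  have Y1 : 0 < 1 + Y by lra.
  rewrite -(ler_pM2r Y1).
  apply: (@le_trans _ _ (C * 4)).
    rewrite -[leLHS]mulrA -[leLHS]mulrA.
    rewrite ler_wpM2l//; apply: le_trans h2; lra.
  by apply: (le_trans hn'); rewrite ler_pM2l// lerDr.
have lin (c : R) : c != 0 -> `|(c * n%:R - m) / s| @[n --> \oo] --> +oo.
  move=> c0; apply/cvgryPge => A; near=> n.
  rewrite normrM normfV ler_pdivlMr ?normr_gt0//.
  have h : (A * `|s| + `|m|) / `|c| <= n%:R by near: n; exact: nbhs_infty_ger.
  have := lerB_normD (c * n%:R) (- m); rewrite normrM normrN normr_nat.
  rewrite ler_pdivrMr ?normr_gt0// in h; lra.
apply: (@integral_derivative_eq0 _ (fun x => g x * q x)).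
- move=> x; have := @is_deriveM _ _ _ _ x 1 _ _ (dg x) (is_derive_normal_fun x).
  rewrite (_ : g x *: _ + _ = (g' x - (x - m) / s ^+ 2 * g x) * q x)//.
  rewrite /GRing.scale /=; ring.
- move=> x; apply: cvgM; first exact: ch.
  apply: differentiable_continuous; apply/derivable1_diffP.
  by have [] := is_derive_normal_fun x.
- exact: integrable_normal_fun_bound hD.
- apply: decay; have := lin 1 (oner_neq0 _).
  by under eq_fun do rewrite mul1r.
- apply: decay; have := lin (-1); rewrite oppr_eq0 oner_neq0 => /(_ isT).
  by under eq_fun do rewrite mulN1r.
Unshelve. all: end_near. Qed.

End normal_moments.

Section normal_characteristic.
Context {R : realType}.
Variable s : R.
Hypothesis s0 : s != 0.

Lemma bounded_normal_ub (m x : R) : 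
  `|x - m| <= `|s| * (1 + `|(x - m) / s|).
Proof.
rewrite normrM normfV mulrDr mulr1 mulrCA divff ?normr_eq0// mulr1.
by rewrite lerDr.
Qed.

Lemma integrable_normal_prob_affine m :
  (normal_prob m s).-integrable [set: R] (fun x => (x - m)%:E).
Proof.
apply: (@integrable_normal_prob _ m s (fun x => x - m)).
  exact: measurable_funB.
apply: (@integrable_normal_prob_bound _ m s s0 _ (2 * `|s|)).
  exact: measurable_funB.
move=> x; apply: (le_trans (bounded_normal_ub m x)).
have : 0 <= `|s| by []. 
rewrite -[_ ^+ 2]ger0_norm ?sqr_ge0// normrX.
move: (`|s|) (`|(x - m) / s|) => S Y S0.
rewrite [2 * S]mulrC -mulrA ler_wpM2l//; nra.
Qed.

Lemma integrable_normal_prob_sqr m :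
  (normal_prob m s).-integrable [set: R] (fun x => ((x - m) ^+ 2)%:E).
Proof.
have mf : measurable_fun [set: R] (fun x : R => (x - m) ^+ 2).
  by apply: measurable_funX; exact: measurable_funB.
apply: (@integrable_normal_prob _ m s (fun x => (x - m) ^+ 2)) => //.
apply: (@integrable_normal_prob_bound _ m s s0 _ (s ^+ 2)) => // x.
rewrite ger0_norm ?sqr_ge0// mulrDr mulr1 exprMn exprVn mulrCA divff ?sqrf_eq0//.
by rewrite mulr1 lerDr sqr_ge0.
Qed.

Lemma integral_normal_prob_affine m :
  (\int[normal_prob m s]_x (x - m)%:E = 0)%E.
Proof.
have : (\int[normal_prob m s]_x (0 - (x - m) / s ^+ 2 * 1)%:E = 0)%E.
  apply: (@stein _ m s s0 (fun=> 1) (fun=> 0) 1).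
- by move=> x; exact: cvg_cst.
- by move=> x; exact: cvg_cst.
- by move=> x; rewrite normr1 mul1r lerDl.
- by move=> x; rewrite normr0.
under eq_integral do rewrite mulr1 sub0r mulrC -mulNr EFinM.
rewrite integralZl//; last exact: integrable_normal_prob_affine.
move=> /eqP; rewrite mule_eq0 eqe oppr_eq0 invr_eq0 sqrf_eq0 (negbTE s0)/=.
by move/eqP.
Qed.

Lemma integral_normal_prob_sqr m :
  (\int[normal_prob m s]_x ((x - m) ^+ 2)%:E = (s ^+ 2)%:E)%E.
Proof.
have : (\int[normal_prob m s]_x (1 - (x - m) / s ^+ 2 * (x - m))%:E = 0)%E.
  apply: (@stein _ m s s0 (fun x => x - m) (fun=> 1) (1 + `|s|)).
- by move=> x; apply: is_derive_eq; rewrite subr0.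
- by move=> x; apply: cvgB; [exact: cvg_id|exact: cvg_cst].
- by move=> x; exact: cvg_cst.
- move=> x; apply: (le_trans (bounded_normal_ub m x)).
  by rewrite ler_wpM2r// lerDr.
- by move=> x; rewrite normr1 lerDl.
under eq_integral do rewrite -mulrA mulrC -mulrA -expr2 EFinB.
under eq_integral do rewrite EFinM.
have is2 : (normal_prob m s).-integrable [set: R]
    (fun x => ((s ^+ 2)^-1)%:E * ((x - m) ^+ 2)%:E)%E.
  by apply: integrableZl => //; exact: integrable_normal_prob_sqr.
rewrite integralB//; last first.
  exact: finite_measure_integrable_cst.
rewrite integralZl//; last exact: integrable_normal_prob_sqr.
rewrite integral_cst//= probability_setT mule1.
move: (integrable_fin_num measurableT (integrable_normal_prob_sqr m)).
move/fineK => <-.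
rewrite -EFinM -EFinB => -[] h; congr EFin.
move/eqP : h; rewrite subr_eq0 => /eqP h.
apply: (mulfI (x := (s ^+ 2)^-1)); first by rewrite invr_eq0 sqrf_eq0.
by rewrite -h mulVf// sqrf_eq0.
Qed.
End normal_characteristic.

Section trigonometric.
Context {R : realType}.
Implicit Types x y : R.

Lemma normr_cos_le1 x : `|cos x| <= 1.
Proof. by rewrite ler_norml cos_geN1 cos_le1. Qed.

Lemma normr_sin_le1 x : `|sin x| <= 1.
Proof. by rewrite ler_norml sin_geN1 sin_le1. Qed.

Lemma is_derive_affine (a c x : R) : is_derive x (1:R) (fun x => a * x + c) a.
Proof.
apply: is_derive_eq.
by rewrite /GRing.scale /= mulr1 addr0.
Qed.

Lemma measurable_cos_comp d (T : measurableType d) (f : T -> R) :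
  measurable_fun [set: T] f -> measurable_fun [set: T] (fun w => cos (f w)).
Proof.
move=> mf; apply: (measurableT_comp _ mf).
by apply: continuous_measurable_fun; exact: continuous_cos.
Qed.

Lemma measurable_sin_comp d (T : measurableType d) (f : T -> R) :
  measurable_fun [set: T] f -> measurable_fun [set: T] (fun w => sin (f w)).
Proof.
move=> mf; apply: (measurableT_comp _ mf).
by apply: continuous_measurable_fun; exact: continuous_sin.
Qed.

Lemma integrable_le_cst d (T : measurableType d) (mu : {finite_measure set T -> \bar R})
  (f : T -> R) (M : R) : measurable_fun [set: T] f -> (forall w, `|f w| <= M) ->
  mu.-integrable [set: T] (EFin \o f).
Proof.
move=> mf fM; apply: (@le_integrable _ _ _ mu _ measurableT _ (cst M%:E)).
- exact/measurable_EFinP.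
- by move=> x _; rewrite /= lee_fin (le_trans (fM x))// ler_norm.
- exact: finite_measure_integrable_cst.
Qed.

End trigonometric.

Section normal_characteristic_function.
Context {R : realType}.
Variables s c : R.
Hypothesis s0 : s != 0.
Local Notation N := (normal_prob 0 s).

Let chf (a : R) := (\int[N]_x cos (a * x + c))%R.

Let mcos a : measurable_fun [set: R] (fun x : R => cos (a * x + c)).
Proof. by apply: measurable_cos_comp; apply: measurable_funD => //; exact: measurable_funM. Qed.

Let icos a : N.-integrable [set: R] (EFin \o (fun x => cos (a * x + c))).
Proof.
apply: (@integrable_le_cst _ _ _ N _ 1); first exact: mcos.
by move=> x; exact: normr_cos_le1.
Qed.

Let msin a : measurable_fun [set: R] (fun x : R => x * sin (a * x + c)).
Proof.
by apply: measurable_funM => //; apply: measurable_sin_comp; apply: measurable_funD => //; exact: measurable_funM.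
Qed.

Let iabs : N.-integrable [set: R] (EFin \o (fun x => `|x|)).
Proof.
have := integrable_abse (integrable_normal_prob_affine s0 0).
by apply: eq_integrable => // x _ /=; rewrite subr0.
Qed.

Let isin a : N.-integrable [set: R] (EFin \o (fun x => x * sin (a * x + c))).
Proof.
apply: (le_integrable measurableT _ _ iabs); first by apply/measurable_EFinP; exact: msin.
move=> x _ /=; rewrite lee_fin normrM normr_id ler_piMr//; exact: normr_sin_le1.
Qed.

(** Stein's identity for the sine. *)
Let chf_sin a : (\int[N]_x (x * sin (a * x + c)))%R = s ^+ 2 * a * chf a.
Proof.
have : (\int[N]_x (a * cos (a * x + c) - (x - 0) / s ^+ 2 * sin (a * x + c))%:E = 0)%E.
  apply: (@stein _ 0 s s0 (fun x => sin (a * x + c)) (fun x => a * cos (a * x + c)) (1 + `|a|)).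
  - move=> x; rewrite mulrC.
    exact: (@is_derive1_comp _ sin (fun x => a * x + c) x _ _ (is_derive_sin _) (is_derive_affine a c x)).
  - move=> x; apply: continuous_comp; last exact: continuous_sin.
    apply: cvgD; last exact: cvg_cst.
    by apply: cvgM; [exact: cvg_cst|exact: cvg_id].
  - move=> x; apply: cvgM; first exact: cvg_cst.
    apply: continuous_comp; last exact: continuous_cos.
    apply: cvgD; last exact: cvg_cst.
    by apply: cvgM; [exact: cvg_cst|exact: cvg_id].
  - move=> x; apply: (le_trans (normr_sin_le1 _)).
    have : 0 <= `|a| by []. have : 0 <= `|(x - 0) / s| by []. nra.
  - move=> x; rewrite normrM (@le_trans _ _ (`|a| * 1))//.
      by rewrite ler_wpM2l// normr_cos_le1.
    by rewrite mulr1 lerDr.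
move=> /(congr1 fine) /=.
have -> : fine (\int[N]_x (a * cos (a * x + c) - (x - 0) / s ^+ 2 * sin (a * x + c))%:E) =
  (\int[N]_x (a * cos (a * x + c) - (s ^+ 2)^-1 * (x * sin (a * x + c))))%R.
  by apply: eq_Rintegral => x _; rewrite subr0; ring.
rewrite RintegralB//; last 2 first.
- exact: (integrableZl measurableT _ (icos a)).
- exact: (integrableZl measurableT _ (isin a)).
rewrite !RintegralZl//.
move=> /eqP; rewrite subr_eq0 => /eqP h.
by rewrite -mulrA h mulrA divff ?mul1r// sqrf_eq0.
Qed.

Let is_derive_chf a : is_derive a (1:R) chf (- (s ^+ 2 * a * chf a)).
Proof.
pose f (a x : R) := cos (a * x + c).
have df (b x : R) : is_derive b (1:R) (f ^~ x) (- (x * sin (b * x + c))).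
  have h := @is_derive1_comp _ cos (fun b => b * x + c) b (- sin (b * x + c)) x.
  rewrite mulrC -mulNr; apply: h.
  rewrite (_ : (fun b => b * x + c) = (fun b => x * b + c)); first exact: is_derive_affine.
  by apply/funext => b'; rewrite mulrC.
have d1 b x : partial1of2 f b x = - (x * sin (b * x + c)).
  by rewrite partial1of2E; have [] := df b x.
have Ia : [set` `]a - 1, a + 1[] a by rewrite /= in_itv/=; lra.
have Gub (b x : R) : [set` `]a - 1, a + 1[] b -> [set: R] x -> `|partial1of2 f b x| <= `|x|.
  by move=> _ _; rewrite d1 normrN normrM ler_piMr// normr_sin_le1.
have int (b : R) : [set` `]a - 1, a + 1[] b -> N.-integrable [set: R] (EFin \o f b).
  by move=> _; exact: icos.
have der (b x : R) : [set` `]a - 1, a + 1[] b -> [set: R] x -> derivable (f^~ x) b 1.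
  by move=> _ _; have [] := df b x.
have G0 (x : R) : 0 <= `|x| by [].
apply: DeriveDef.
  exact: (@derivable_under_integral _ _ _ N f setT measurableT a (a - 1) (a + 1) Ia int der _ G0 iabs Gub).
rewrite -derive1E.
have := @differentiation_under_integral _ _ _ N f setT measurableT a (a - 1) (a + 1) Ia int der _ G0 iabs Gub.
rewrite -/chf => ->.
under eq_Rintegral do rewrite d1 -mulN1r.
by rewrite RintegralZl// ?chf_sin ?mulN1r.
Qed.

(** By [is_derive_chf] the characteristic function solves a linear differential equation,
    which is integrated explicitly. *)
Lemma normal_characteristic_function a :
  (\int[N]_x cos (a * x + c))%R = cos c * expR (- (s ^+ 2 * a ^+ 2 / 2)).
Proof.
pose E a : R := expR (s ^+ 2 * a ^+ 2 / 2).
have dE (b : R) : is_derive b (1:R) E (s ^+ 2 * b * E b).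
  rewrite mulrC.
  apply: (@is_derive1_comp _ expR (fun a => s ^+ 2 * a ^+ 2 / 2) b _ _ (is_derive_expR _)).
  by apply: is_derive_eq; rewrite /GRing.scale /=; field.
have h : forall x : R, is_derive x (1:R) (chf * E) 0.
  move=> x; have := @is_deriveM _ _ _ _ x 1 _ _ (is_derive_chf x) (dE x).
  rewrite (_ : _ *: _ + _ = 0)// /GRing.scale /=; ring.
have h1 : chf a * E a = chf 0 * E 0 := is_derive_0_is_cst a 0 h.
have h2 : chf 0 * E 0 = cos c.
  rewrite /E expr0n mulr0 mul0r expR0 mulr1 /chf.
  under eq_Rintegral do rewrite mul0r add0r.
  by rewrite Rintegral_cst//= probability_setT mulr1.
have E0 : E a != 0 by rewrite gt_eqF// expR_gt0.
rewrite expRN -/(E a) -/(chf a); apply: (mulIf E0).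
by rewrite h1 h2 mulfVK.
Qed.

End normal_characteristic_function.

(** * Gaussian pairs smoothed by bumps *)

Section centered_gaussian.
Context {R : realType} {disp : measure_display} {T : measurableType disp}.
Variable P : probability T R.

Lemma ge0_integral_law (Q : {measure set (measurableTypeR R) -> \bar R}) (X : T -> R) :
  measurable_fun [set: T] X ->
  (forall A : set (measurableTypeR R), measurable A -> P (X @^-1` A) = Q A) ->
  forall f : R -> \bar R, measurable_fun [set: R] f -> (forall x, 0 <= f x)%E ->
  (\int[P]_w f (X w) = \int[Q]_x f x)%E.
Proof.
move=> mX lawX f mf f0.
pose mX_mixin := isMeasurableFun.Build _ _ T (measurableTypeR R) X mX.
pose Xm : {mfun T >-> measurableTypeR R} := HB.pack X mX_mixin.
have := @ge0_integral_pushforward _ _ _ (measurableTypeR R) R X mX P setT f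
  measurableT mf (fun x _ => f0 x).
rewrite preimage_setT => <-.
by apply: (eq_measure_integral Q (m1 := pushforward P Xm)) => A mA _; exact: lawX.
Qed.

Lemma integral_law (Q : {measure set (measurableTypeR R) -> \bar R}) (X : T -> R) :
  measurable_fun [set: T] X ->
  (forall A : set (measurableTypeR R), measurable A -> P (X @^-1` A) = Q A) ->
  forall f : R -> R, measurable_fun [set: R] f ->
  (\int[P]_w (f (X w))%:E = \int[Q]_x (f x)%:E)%E.
Proof.
move=> mX lawX f mf.
rewrite integralE [RHS]integralE.
have mf' : measurable_fun [set: R] (EFin \o f) by exact/measurable_EFinP.
congr (_ - _)%E.
- transitivity (\int[P]_w (EFin \o f)^\+ (X w))%E; first by apply: eq_integral => w _; rewrite ?funeposE ?funenegE.
  apply: (ge0_integral_law mX lawX) => [|x]; last exact: funepos_ge0.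
  by apply: measurable_funepos.
- transitivity (\int[P]_w (EFin \o f)^\- (X w))%E; first by apply: eq_integral => w _; rewrite ?funeposE ?funenegE.
  apply: (ge0_integral_law mX lawX) => [|x]; last exact: funeneg_ge0.
  by apply: measurable_funeneg.
Qed.

Lemma gaussian_lawP (m s : R) (X : T -> R) : measurable_fun [set: T] X ->
  (forall A : set (measurableTypeR R), measurable A -> P (X @^-1` A) = gaussian_law m s A) ->
  forall f : R -> R, measurable_fun [set: R] f ->
  (\int[P]_w (f (X w))%:E = if (s == 0)%R then (f m)%:E else \int[normal_prob m s]_x (f x)%:E)%E.
Proof.
move=> mX lawX f mf; rewrite /gaussian_law in lawX; case: ifPn lawX => s0 lawX.
- rewrite (@integral_law (@dirac _ (measurableTypeR R) m R) X mX lawX f mf) integral_dirac//.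
  + by rewrite diracE in_setT mul1e.
  + exact/measurable_EFinP.
- exact: (@integral_law (normal_prob m s) X mX lawX f mf).
Qed.

(** The first two moments identify the parameters of the law, also when it is degenerate. *)
Lemma gaussian_variable_centered (X : T -> R) (v : R) :
  measurable_fun [set: T] X -> gaussian_variable P X ->
  (\int[P]_w (X w)%:E = 0)%E -> (\int[P]_w (X w ^+ 2)%:E = v%:E)%E ->
  exists s, s ^+ 2 = v /\ forall A : set (measurableTypeR R), measurable A ->
    P (X @^-1` A) = gaussian_law 0 s A.
Proof.
move=> mX [m [s lawX]] EX EX2; exists s.
have := gaussian_lawP mX lawX (@measurable_id _ _ setT).
have mx2 : measurable_fun [set: R] (fun x : R => x ^+ 2) by exact: measurable_funX.
have := gaussian_lawP mX lawX mx2.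
rewrite EX EX2; case: eqVneq => [s0|s0] e2 e1.
  case: e1 => m0; move: lawX; rewrite -m0 => lawX; split => //.
  by case: e2; rewrite -m0 s0 => ->.
have im := integrable_normal_prob_affine s0 m.
have m0 : m = 0.
  have : (\int[normal_prob m s]_x ((x - m)%:E + m%:E) = 0)%E.
    rewrite [RHS]e1; apply: eq_integral => x _; by rewrite -EFinD subrK.
  rewrite integralD//; last exact: finite_measure_integrable_cst.
  rewrite integral_normal_prob_affine// add0e integral_cst//= probability_setT mule1.
  by case.
rewrite m0 in e2 lawX; split => //.
have := integral_normal_prob_sqr s0 0; under eq_integral do rewrite subr0.
by rewrite -e2 => -[].
Qed.

Lemma cos_gaussian_variable (X : T -> R) (v a c : R) :
  measurable_fun [set: T] X -> gaussian_variable P X ->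
  (\int[P]_w (X w)%:E = 0)%E -> (\int[P]_w (X w ^+ 2)%:E = v%:E)%E ->
  (\int[P]_w cos (a * X w + c))%R = cos c * expR (- (v * a ^+ 2 / 2)).
Proof.
move=> mX gX EX EX2.
have [s [<- lawX]] := gaussian_variable_centered mX gX EX EX2.
have mc : measurable_fun [set: R] (fun x : R => cos (a * x + c)).
  by apply: measurable_cos_comp; apply: measurable_funD => //; exact: measurable_funM.
rewrite /Rintegral (gaussian_lawP mX lawX mc).
case: eqVneq => [->|s0].
  by rewrite expr0n /= mulr0 add0r mul0r mul0r oppr0 expR0 mulr1.
exact: normal_characteristic_function.
Qed.

End centered_gaussian.

(** Up to a constant, the bump of width [e] is at least the indicator of [[- e, e]]; unlike
    the indicator it is a mixture of cosines, see [integral_cos_bump]. *)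
Definition gauss_bump {R : realType} (e z : R) : R := expR (- (z ^+ 2 / (2 * e ^+ 2))).

Section bump_theory.
Context {R : realType}.
Implicit Types e z v x : R.

Lemma gauss_bump_ge0 e z : 0 <= gauss_bump e z. Proof. exact: expR_ge0. Qed.

Lemma gauss_bump_le1 e z : gauss_bump e z <= 1.
Proof.
by rewrite /gauss_bump -[leRHS]expR0 ler_expR oppr_le0 divr_ge0 ?sqr_ge0// mulr_ge0 ?sqr_ge0.
Qed.

Lemma normr_bump_le1 e z : `|gauss_bump e z| <= 1.
Proof. by rewrite ger0_norm ?gauss_bump_ge0// gauss_bump_le1. Qed.

Lemma continuous_bump e : continuous (gauss_bump e).
Proof.
move=> x; apply: continuous_comp; last exact: continuous_expR.
apply: cvgN; apply: cvgM; last exact: cvg_cst.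
exact: exprn_continuous.
Qed.

Lemma measurable_bump_comp d (T : measurableType d) e (f : T -> R) :
  measurable_fun [set: T] f -> measurable_fun [set: T] (fun w => gauss_bump e (f w)).
Proof.
move=> mf; apply: (measurableT_comp _ mf).
by apply: continuous_measurable_fun; exact: continuous_bump.
Qed.

Lemma gauss_bump_ge e z : `|z| <= e -> expR (- 2^-1) <= gauss_bump e z.
Proof.
move=> ze; rewrite /gauss_bump ler_expR lerN2.
have e0 : 0 <= e by apply: le_trans ze.
have [->|en0] := eqVneq e 0; first by rewrite expr0n mulr0 invr0 mulr0 invr_ge0.
have e2 : 0 < e ^+ 2 by rewrite exprn_gt0// lt_neqAle eq_sym en0.
have e22 : 0 < 2 * e ^+ 2 by lra.
rewrite ler_pdivrMr//.
have : z ^+ 2 <= e ^+ 2.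
  by rewrite -real_normK ?num_real// lerXn2r// nnegrE.
lra.
Qed.

Lemma integral_cos_bump e z c : 0 < e ->
  (\int[normal_prob 0 e^-1]_x cos (z * x + c))%R = cos c * gauss_bump e z.
Proof.
move=> e0; have e10 : e^-1 != 0 by rewrite invr_eq0 gt_eqF.
rewrite (normal_characteristic_function c e10 z) /gauss_bump; congr (_ * expR (- _)).
by field; rewrite gt_eqF.
Qed.

(** The expectation of the bump of width [e] centered at [x] under N(0, v). *)
Definition smoothed_density e v x :=
  e / Num.sqrt (v + e ^+ 2) * gauss_bump (Num.sqrt (v + e ^+ 2)) x.

(** Multiplying the density of [N(0, e^-2)] by a Gaussian function gives a multiple of the
    density of [N(0, (v + e^2)^-1)]. *)
Lemma integral_cos_expR e v x : 0 < e -> 0 <= v ->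
  (\int[normal_prob 0 e^-1]_y (cos (x * y) * expR (- (v * y ^+ 2 / 2))))%R =
  smoothed_density e v x.
Proof.
move=> e0 v0; have ve0 : 0 < v + e ^+ 2 by rewrite ltr_wpDl// exprn_gt0.
set E := Num.sqrt (v + e ^+ 2).
have E0 : 0 < E by rewrite sqrtr_gt0.
have E2 : E ^+ 2 = v + e ^+ 2 by rewrite sqr_sqrtr// ltW.
have e10 : e^-1 != 0 by rewrite invr_eq0 gt_eqF.
have E10 : E^-1 != 0 by rewrite invr_eq0 gt_eqF.
have pdfE y : expR (- (v * y ^+ 2 / 2)) * normal_pdf 0 e^-1 y = e / E * normal_pdf 0 E^-1 y.
  rewrite !normal_pdfE// mulrCA mulrA.
  have -> : normal_peak e^-1 = e / E * normal_peak E^-1.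
    rewrite /normal_peak.
    have peakE t : 0 < t -> Num.sqrt (t^-1 ^+ 2 * pi *+ 2) = t^-1 * Num.sqrt (pi *+ 2).
      move=> t0; rewrite -mulrnAr sqrtrM ?sqr_ge0// sqrtr_sqr ger0_norm//.
      by rewrite invr_ge0 ltW.
    rewrite !peakE// !invfM !invrK.
    by rewrite mulrA divfK// gt_eqF.
  rewrite -!mulrA; congr (_ * (_ * (_ * _))).
  rewrite /normal_fun -expRD !subr0; congr expR.
  have -> : v = E ^+ 2 - e ^+ 2 by rewrite E2 addrK.
  by field; rewrite !gt_eqF.
have mc : measurable_fun [set: R] (fun y : R => cos (x * y)).
  by apply: measurable_cos_comp; exact: measurable_funM.
have mE : measurable_fun [set: R] (fun y : R => expR (- (v * y ^+ 2 / 2))).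
  apply: measurableT_comp => //=; apply: measurableT_comp => //=.
  by apply: measurable_funM => //; apply: measurable_funM => //; exact: measurable_funX.
have iE : lebesgue_measure.-integrable [set: R] (fun y : R => (cos (x * y) * normal_pdf 0 E^-1 y)%:E).
  apply: (@integrable_normal_prob_bound _ 0 E^-1 E10 _ 1) => // y.
  by rewrite mul1r (le_trans (normr_cos_le1 _))// lerDl sqr_ge0.
have ccE : (fun y : R => (cos (x * y) * expR (- (v * y ^+ 2 / 2)) * normal_pdf 0 e^-1 y)%:E) =
    (fun y => (e / E)%:E * (cos (x * y) * normal_pdf 0 E^-1 y)%:E)%E.
  by apply/funext => y; rewrite -mulrA pdfE -EFinM; congr EFin; rewrite mulrCA.
rewrite /Rintegral integral_normal_prob//; last 2 first.
- exact: measurable_funM.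
- by rewrite ccE; exact: integrableZl.
rewrite ccE integralZl//.
rewrite -(@integral_normal_prob _ 0 E^-1 (fun y => cos (x * y)))//.
have := integral_cos_bump x 0 E0.
rewrite cos0 mul1r /smoothed_density -/E => <-.
rewrite fineM//; last first.
  apply: integrable_fin_num => //.
  by apply: (@integrable_le_cst _ _ _ (normal_prob 0 E^-1) _ 1) => // y; exact: normr_cos_le1.
by congr (_ * _); apply: eq_Rintegral => y _; rewrite addr0.
Qed.

End bump_theory.

Section Rintegral_Fubini.
Context {R : realType} {d1 d2 : measure_display} {T1 : measurableType d1} {T2 : measurableType d2}.
Variables (P1 : probability T1 R) (P2 : probability T2 R).

Lemma Rintegral_Fubini (f : T1 -> T2 -> R) (M : R) :
  measurable_fun [set: T1 * T2] (fun z => f z.1 z.2) ->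
  (forall x y, `|f x y| <= M) ->
  (\int[P1]_x (\int[P2]_y f x y) = \int[P2]_y (\int[P1]_x f x y))%R.
Proof.
move=> mf fM.
have m1 x : measurable_fun [set: T2] (f x).
  exact: (measurableT_comp mf (measurable_pair1 x)).
have m2 y : measurable_fun [set: T1] (f ^~ y).
  exact: (measurableT_comp mf (measurable_pair2 y)).
have i1 x : P2.-integrable [set: T2] (EFin \o f x).
  exact: (@integrable_le_cst _ _ _ P2 _ M).
have i2 y : P1.-integrable [set: T1] (EFin \o f ^~ y).
  by apply: (@integrable_le_cst _ _ _ P1 _ M) => // x; exact: fM.
have f1 x := integrable_fin_num measurableT (i1 x).
have f2 y := integrable_fin_num measurableT (i2 y).
rewrite /Rintegral; congr fine.
under eq_integral => x _ do rewrite (fineK (f1 x)).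
under [RHS]eq_integral => y _ do rewrite (fineK (f2 y)).
apply: (@Fubini _ _ _ _ _ P1 P2 (fun z => (f z.1 z.2)%:E)).
apply: (@measurable_bounded_integrable _ _ _ (P1 \x P2)%E (fun z => f z.1 z.2) setT) => //.
  have h : ((P1 \x P2) [set: T1 * T2] = P1 setT * P2 setT)%E.
    by rewrite -product_measure1E// setXTT.
  by rewrite [X in (X < _)%E]h; rewrite !probability_setT mule1 ltry.
exists M; split; first exact: num_real.
by move=> y My z _ /=; apply: (le_trans (fM _ _)); exact: ltW.
Qed.

End Rintegral_Fubini.

Section bump_independence.
Context {R : realType} {disp : measure_display} {T : measurableType disp}.
Variables (P : probability T R) (X W : T -> R) (v u : R).
Hypotheses (mX : measurable_fun [set: T] X) (mW : measurable_fun [set: T] W).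
Hypotheses (v0 : 0 <= v) (u0 : 0 <= u).
(** [X] and [W] form a centered Gaussian pair, uncorrelated, of variances [v] and [u];
    this is stated on the real and imaginary parts of the characteristic function. *)
Hypothesis cosXW : forall a b c,
  (\int[P]_w cos (a * X w + b * W w + c))%R = cos c * expR (- ((v * a ^+ 2 + u * b ^+ 2) / 2)).

Let mlin a b c : measurable_fun [set: T] (fun w => a * X w + b * W w + c).
Proof.
apply: measurable_funD => //; apply: measurable_funD; exact: measurable_funM.
Qed.

Let icos a b c : P.-integrable [set: T] (EFin \o (fun w => cos (a * X w + b * W w + c))).
Proof.
apply: (@integrable_le_cst _ _ _ P _ 1); first by apply: measurable_cos_comp; exact: mlin.
by move=> x; exact: normr_cos_le1.
Qed.

Let cos_cos a b c c' :
  (\int[P]_w (cos (a * X w + c) * cos (b * W w + c')))%R =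
  cos c * cos c' * expR (- ((v * a ^+ 2 + u * b ^+ 2) / 2)).
Proof.
have prodE (x y : R) : cos x * cos y = 2^-1 * cos (x + y) + 2^-1 * cos (x - y).
  by rewrite cosD cosB; field.
under eq_Rintegral => w _.
  rewrite prodE.
  rewrite (_ : a * X w + c + (b * W w + c') = a * X w + b * W w + (c + c')); last by ring.
  rewrite (_ : a * X w + c - (b * W w + c') = a * X w + (- b) * W w + (c - c')); last by ring.
  over.
rewrite RintegralD//; last 2 first.
- exact: (integrableZl measurableT _ (icos _ _ _)).
- exact: (integrableZl measurableT _ (icos _ _ _)).
rewrite !RintegralZl//.
by rewrite !cosXW sqrrN prodE; ring.
Qed.

(** The bump being a mixture of cosines, Fubini reduces the expectation to those of
    products of cosines. *)
Lemma integral_bump_cos e x b c : 0 < e ->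
  (\int[P]_w (gauss_bump e (X w - x) * cos (b * W w + c)))%R =
  cos c * expR (- (u * b ^+ 2 / 2)) * smoothed_density e v x.
Proof.
move=> e0.
have mF : measurable_fun [set: T * (measurableTypeR R)]
    (fun z : T * (measurableTypeR R) => cos (z.2 * X z.1 + (- (z.2 * x))) * cos (b * W z.1 + c)).
  apply: measurable_funM; apply: measurable_cos_comp.
    apply: measurable_funD.
      by apply: measurable_funM => //; exact: measurableT_comp.
    by apply: measurableT_comp => //; exact: measurable_funM.
  apply: measurable_funD => //; apply: measurable_funM => //.
  exact: measurableT_comp.
transitivity (\int[P]_w (\int[normal_prob 0 e^-1]_y
    (cos (y * X w + (- (y * x))) * cos (b * W w + c))))%R.
  apply: eq_Rintegral => w _.
  rewrite RintegralZr//; last first.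
    apply: (@integrable_le_cst _ _ _ (normal_prob 0 e^-1) _ 1).
      apply: measurable_cos_comp; apply: measurable_funD; first exact: measurable_funM.
      by apply: measurableT_comp => //; exact: measurable_funM.
    by move=> y; exact: normr_cos_le1.
  rewrite -[gauss_bump _ _]mul1r -(@cos0 R) -integral_cos_bump//; congr (_ * _).
  by apply: eq_Rintegral => y _; rewrite addr0 mulrBl mulrC [x * y]mulrC.
rewrite (@Rintegral_Fubini _ _ _ _ _ _ _ _ 1 mF); last first.
  by move=> w y; rewrite normrM -[leRHS]mulr1 ler_pM// normr_cos_le1.
transitivity (\int[normal_prob 0 e^-1]_y ((cos c * expR (- (u * b ^+ 2 / 2))) *
   (cos (x * y) * expR (- (v * y ^+ 2 / 2)))))%R.
  apply: eq_Rintegral => y _; rewrite cos_cos cosN mulrC.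
  rewrite mulrDl opprD expRD [y * x]mulrC; ring.
rewrite RintegralZl//.
  by rewrite integral_cos_expR.
apply: (@integrable_le_cst _ _ _ (normal_prob 0 e^-1) _ 1).
  apply: measurable_funM.
    by apply: measurable_cos_comp; exact: measurable_funM.
  apply: measurableT_comp => //=; apply: measurableT_comp => //=.
  by apply: measurable_funM => //; apply: measurable_funM => //; exact: measurable_funX.
move=> y; rewrite normrM -[leRHS]mulr1 ler_pM// ?normr_cos_le1//.
rewrite ger0_norm ?expR_ge0// -[leRHS]expR0 ler_expR oppr_le0.
by rewrite divr_ge0// mulr_ge0// sqr_ge0.
Qed.

Lemma integral_bump_bump e x d w0 : 0 < e -> 0 < d ->
  (\int[P]_w (gauss_bump e (X w - x) * gauss_bump d (W w - w0)))%R =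
  smoothed_density e v x * smoothed_density d u w0.
Proof.
move=> e0 d0.
have mF : measurable_fun [set: T * (measurableTypeR R)]
    (fun z : T * (measurableTypeR R) => gauss_bump e (X z.1 - x) * cos (z.2 * W z.1 + (- (z.2 * w0)))).
  apply: measurable_funM.
    apply: measurable_bump_comp; apply: measurable_funB => //.
    exact: measurableT_comp.
  apply: measurable_cos_comp; apply: measurable_funD.
    by apply: measurable_funM => //; exact: measurableT_comp.
  by apply: measurableT_comp => //; exact: measurable_funM.
transitivity (\int[P]_w (\int[normal_prob 0 d^-1]_y
    (gauss_bump e (X w - x) * cos (y * W w + (- (y * w0))))))%R.
  apply: eq_Rintegral => w _.
  rewrite RintegralZl//; last first.
    apply: (@integrable_le_cst _ _ _ (normal_prob 0 d^-1) _ 1).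
      apply: measurable_cos_comp; apply: measurable_funD; first exact: measurable_funM.
      by apply: measurableT_comp => //; exact: measurable_funM.
    by move=> y; exact: normr_cos_le1.
  congr (_ * _); rewrite -[LHS]mul1r -(@cos0 R) -integral_cos_bump//.
  by apply: eq_Rintegral => y _; rewrite addr0 mulrBl mulrC [w0 * y]mulrC.
rewrite (@Rintegral_Fubini _ _ _ _ _ _ _ _ 1 mF); last first.
  by move=> w y; rewrite normrM -[leRHS]mulr1 ler_pM// ?normr_cos_le1// normr_bump_le1.
transitivity (\int[normal_prob 0 d^-1]_y (smoothed_density e v x *
   (cos (w0 * y) * expR (- (u * y ^+ 2 / 2)))))%R.
  apply: eq_Rintegral => y _; rewrite integral_bump_cos// cosN.
  rewrite [y * w0]mulrC; ring.
rewrite RintegralZl//.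
  by rewrite integral_cos_expR.
apply: (@integrable_le_cst _ _ _ (normal_prob 0 d^-1) _ 1).
  apply: measurable_funM.
    by apply: measurable_cos_comp; exact: measurable_funM.
  apply: measurableT_comp => //=; apply: measurableT_comp => //=.
  by apply: measurable_funM => //; apply: measurable_funM => //; exact: measurable_funX.
move=> y; rewrite normrM -[leRHS]mulr1 ler_pM// ?normr_cos_le1//.
rewrite ger0_norm ?expR_ge0// -[leRHS]expR0 ler_expR oppr_le0.
by rewrite divr_ge0// mulr_ge0// sqr_ge0.
Qed.

(** The product of the two bumps is at least [expR (- 1)] on the rectangle. *)
Lemma probability_rectangle_le (e x d w0 : R) : 0 < e -> 0 < d ->
  (P [set w | (`|X w - x| <= e)%R /\ (`|W w - w0| <= d)%R] <=
   (expR 1 * (smoothed_density e v x * smoothed_density d u w0))%:E)%E.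
Proof.
move=> e0 d0.
set A := [set w | _].
have mA : measurable A.
  have -> : A = ((fun w => `|X w - x|) @^-1` `]-oo, e]) `&` ((fun w => `|W w - w0|) @^-1` `]-oo, d]).
    by apply/seteqP; split=> w /=; rewrite !in_itv.
  apply: measurableI; rewrite -[X in measurable X]setTI.
    by apply: (measurableT_comp (@normr_measurable _ setT)) => //; exact: measurable_funB.
  by apply: (measurableT_comp (@normr_measurable _ setT)) => //; exact: measurable_funB.
have ib : P.-integrable [set: T] (EFin \o (fun w => gauss_bump e (X w - x) * gauss_bump d (W w - w0))).
  apply: (@integrable_le_cst _ _ _ P _ 1).
    by apply: measurable_funM; apply: measurable_bump_comp; exact: measurable_funB.
  by move=> w; rewrite normrM -[leRHS]mulr1 ler_pM// normr_bump_le1.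
have -> : P A = (\int[P]_w (\1_A w)%:E)%E by rewrite integral_indic// setIT.
rewrite -integral_bump_bump// -RintegralZl//.
rewrite /Rintegral fineK; last first.
  by apply: integrable_fin_num => //; exact: (integrableZl measurableT _ ib).
apply: ge0_le_integral => //.
- by apply/measurable_EFinP; exact: measurable_indic.
- by apply: (measurable_int P); exact: (integrableZl measurableT _ ib).
- move=> w _; rewrite lee_fin indicE.
  case: (boolP (w \in A)) => [|_] /=; last by rewrite !mulr_ge0 ?expR_ge0.
  rewrite inE => -[/gauss_bump_ge h1 /gauss_bump_ge h2].
  apply: (@le_trans _ _ (expR 1 * (expR (- 2^-1) * expR (- 2^-1)))).
    rewrite -!expRD -[leLHS]expR0 ler_expR; lra.
  by rewrite ler_wpM2l ?expR_ge0// ler_pM ?expR_ge0.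
Qed.

End bump_independence.

(** * Linear combinations of the values of the process *)

Section fbm_cov.
Context {R : realType}.
Implicit Types (H s t : R).

Definition fbm_cov H s t : R :=
  2^-1 * (`|t| `^ (2 * H) + `|s| `^ (2 * H) - `|t - s| `^ (2 * H)).

Lemma fbm_covC H s t : fbm_cov H s t = fbm_cov H t s.
Proof. by rewrite /fbm_cov distrC [`|t| `^ _ + _]addrC. Qed.

End fbm_cov.

Section linear_combinations.
Context {R : realType} {disp : measure_display} {T : measurableType disp}.
Variables (P : probability T R) (H : R) (X : R -> {RV P >-> R}).
Hypotheses (gX : gaussian_process X) (cX : centered X) (covX : fbm_covariance H X).
Variables (n : nat) (t : 'I_n -> R).
Hypothesis t01 : forall j, t j \in `[0, 1].
Implicit Types a b : 'I_n -> R.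

Definition lincomb a (w : T) : R := \sum_j a j * X (t j) w.
Definition lincov a b : R := \sum_i \sum_j a i * b j * fbm_cov H (t i) (t j).

Lemma measurable_lincomb a : measurable_fun [set: T] (lincomb a).
Proof.
apply: measurable_sum => i; apply: measurable_funM => //.
Qed.

Let int_sqr i : P.-integrable [set: T] (EFin \o (fun w => X (t i) w ^+ 2)).
Proof.
apply/integrableP; split.
  by apply/measurable_EFinP; apply: measurable_funX.
have := covX (t01 i) (t01 i); rewrite unlock => h.
apply: (@le_lt_trans _ _ (\int[P]_w (X (t i) w * X (t i) w)%:E)%E); last by rewrite h ltry.
rewrite le_eqVlt; apply/orP; left; apply/eqP.
by apply: eq_integral => w _; rewrite /= ger0_norm ?sqr_ge0// expr2.
Qed.

Let int_mul i j : P.-integrable [set: T] (EFin \o (fun w => X (t i) w * X (t j) w)).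
Proof.
apply: (le_integrable measurableT _ _ (integrableD measurableT (int_sqr i) (int_sqr j))).
  by apply/measurable_EFinP; apply: measurable_funM.
move=> w _ /=; rewrite lee_fin [leRHS]ger0_norm ?addr_ge0 ?sqr_ge0//.
rewrite normrM -(real_normK (num_real (X (t i) w))) -(real_normK (num_real (X (t j) w))).
nra.
Qed.

Let int_X i : P.-integrable [set: T] (EFin \o X (t i)).
Proof.
have i1 : P.-integrable [set: T] (EFin \o (fun _ : T => (1:R))).
  exact: finite_measure_integrable_cst.
apply: (le_integrable measurableT _ _ (integrableD measurableT i1 (int_sqr i))).
  exact/measurable_EFinP.
move=> w _ /=; rewrite lee_fin [leRHS]ger0_norm ?addr_ge0 ?sqr_ge0//.
rewrite -(real_normK (num_real (X (t i) w))); have : 0 <= `|X (t i) w| by [].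
nra.
Qed.

Lemma integral_lincomb a : (\int[P]_w (lincomb a w)%:E = 0)%E.
Proof.
under eq_integral do rewrite /lincomb -sumEFin.
rewrite integral_sum//; last first.
  move=> i; under eq_fun do rewrite EFinM.
  by apply: integrableZl => //; exact: int_X.
rewrite big1// => i _.
under eq_integral do rewrite EFinM.
rewrite integralZl//; last exact: int_X.
by have := cX (t01 i); rewrite unlock => ->; rewrite mule0.
Qed.

Lemma integral_lincomb_sqr a : (\int[P]_w (lincomb a w ^+ 2)%:E = (lincov a a)%:E)%E.
Proof.
have E w : lincomb a w ^+ 2 = \sum_i \sum_j a i * a j * (X (t i) w * X (t j) w).
  rewrite expr2 /lincomb mulr_suml; apply: eq_bigr => i _.
  by rewrite mulr_sumr; apply: eq_bigr => j _; rewrite mulrACA.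
under eq_integral do rewrite E -sumEFin.
have intij i j : P.-integrable [set: T] (fun w => (a i * a j * (X (t i) w * X (t j) w))%:E).
  under eq_fun do rewrite EFinM.
  by apply: integrableZl => //; exact: int_mul.
have inti i : P.-integrable [set: T] (fun w => (\sum_j a i * a j * (X (t i) w * X (t j) w))%:E).
  by under eq_fun do rewrite -sumEFin; apply: integrable_sum.
rewrite integral_sum//.
rewrite /lincov -sumEFin; apply: eq_bigr => i _.
under eq_integral do rewrite -sumEFin.
rewrite integral_sum// -sumEFin; apply: eq_bigr => j _.
under eq_integral do rewrite EFinM.
rewrite integralZl//; last exact: int_mul.
by have := covX (t01 i) (t01 j); rewrite unlock => ->; rewrite -EFinM.
Qed.

Lemma lincov_ge0 a : 0 <= lincov a a.
Proof.
by rewrite -lee_fin -integral_lincomb_sqr integral_ge0// => w _; rewrite lee_fin sqr_ge0.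
Qed.

Lemma cos_lincomb a c :
  (\int[P]_w cos (lincomb a w + c))%R = cos c * expR (- (lincov a a / 2)).
Proof.
have := @cos_gaussian_variable _ _ _ P (lincomb a) (lincov a a) 1 c
  (measurable_lincomb a) (gX a t01) (integral_lincomb a) (integral_lincomb_sqr a).
rewrite expr1n mulr1 => <-.
by apply: eq_Rintegral => w _; rewrite mul1r.
Qed.

Lemma lincovC a b : lincov a b = lincov b a.
Proof.
rewrite /lincov exchange_big; apply: eq_bigr => i _; apply: eq_bigr => j _.
by rewrite fbm_covC [a j * _]mulrC.
Qed.

(** Uncorrelated linear combinations have a joint characteristic function that is a
    product. *)
Lemma rectangle_lincomb_le a b (e x d y : R) : 0 < e -> 0 < d -> lincov a b = 0 ->
  (P [set w | (`|lincomb a w - x| <= e)%R /\ (`|lincomb b w - y| <= d)%R] <=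
   (expR 1 * (smoothed_density e (lincov a a) x * smoothed_density d (lincov b b) y))%:E)%E.
Proof.
move=> e0 d0 ab0.
apply: probability_rectangle_le => //; try exact: measurable_lincomb; try exact: lincov_ge0.
move=> p q c.
have -> : lincov a a * p ^+ 2 + lincov b b * q ^+ 2 =
   lincov (fun j => p * a j + q * b j) (fun j => p * a j + q * b j).
  have ba0 : lincov b a = 0 by rewrite lincovC.
  transitivity (p ^+ 2 * lincov a a + p * q * lincov a b + p * q * lincov b a + q ^+ 2 * lincov b b).
    by rewrite ab0 ba0; ring.
  rewrite /lincov !mulr_sumr -!big_split; apply: eq_bigr => i _ /=.
  rewrite !mulr_sumr -!big_split; apply: eq_bigr => j _ /=; ring.
rewrite -cos_lincomb; apply: eq_Rintegral => w _; congr (cos (_ + _)).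
rewrite /lincomb !mulr_sumr -big_split; apply: eq_bigr => j _ /=; ring.
Qed.

End linear_combinations.

(** * Covariance estimates and local nondeterminism *)

Section powR_subadditivity.
Context {R : realType}.
Variable H : R.
Hypothesis H01 : 0 < H < 1.
Implicit Types s t : R.

Let H0 : 0 < H. Proof. by case/andP: H01. Qed.
Let H1 : H <= 1. Proof. by case/andP: H01 => _ /ltW. Qed.

Lemma powR_sqr t : 0 <= t -> t `^ (2 * H) = (t `^ H) ^+ 2.
Proof. by move=> t0; rewrite mulrC powRrM powR_mulrn// powR_ge0. Qed.

Lemma powR_le1 t : 0 <= t <= 1 -> t `^ H <= 1.
Proof.
move=> /andP[t0 t1]; apply: (@le_trans _ _ (1 `^ H)); last by rewrite powR1.
by apply: ge0_ler_powR; rewrite ?nnegrE ?(ltW H0).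
Qed.

Lemma le_powR_unit t : 0 <= t <= 1 -> t <= t `^ H.
Proof.
move=> /andP[]; rewrite le_eqVlt => /predU1P[<- _|t0 t1]; first exact: powR_ge0.
by rewrite ger1_powR// t0.
Qed.

(** With [r = s / t], the bound is [1 - r `^ H <= 1 - r <= (1 - eps0) `^ (1 - H) * (1 - r) `^ H]. *)
Lemma powR_increment_le (eps0 s t : R) : 0 <= eps0 < 1 -> eps0 <= s -> s <= t -> 0 < t <= 1 ->
  t `^ H - s `^ H <= (1 - eps0) `^ (1 - H) * (t - s) `^ H.
Proof.
move=> /andP[e0 e1] es st /andP[t0 t1].
have s0 : 0 <= s by apply: le_trans es.
pose r := s / t.
have r0 : 0 <= r by rewrite divr_ge0// ltW.
have r1 : r <= 1 by rewrite ler_pdivrMr// mul1r.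
have er : eps0 <= r by rewrite ler_pdivlMr// (le_trans _ es)// ler_piMr.
have -> : s = r * t by rewrite /r divfK// gt_eqF.
rewrite powRM// ?(ltW t0)// -[X in X - _]mul1r -mulrBl.
have -> : t - r * t = (1 - r) * t by ring.
rewrite (@powRM _ (1 - r) t) ?subr_ge0 ?(ltW t0)//.
rewrite [leRHS]mulrA ler_wpM2r ?powR_ge0//.
apply: (@le_trans _ _ (1 - r)).
  by rewrite lerD2l lerN2 le_powR_unit// r0.
have [->|r1'] := eqVneq r 1; first by rewrite subrr mulr_ge0 ?powR_ge0.
have r1lt : 0 < 1 - r by rewrite subr_gt0 lt_neqAle r1'.
have {1}-> : 1 - r = (1 - r) `^ (1 - H) * (1 - r) `^ H.
  rewrite -powRD ?subrK ?powRr1 ?(ltW r1lt)//.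
  by rewrite gt_eqF ?implybT.
rewrite ler_wpM2r ?powR_ge0//; apply: ge0_ler_powR; rewrite ?nnegrE ?subr_ge0//.
- exact: ltW.
- by rewrite lerD2l lerN2.
Qed.

Lemma powR_dist_le (s t : R) : 0 <= s <= 1 -> 0 <= t <= 1 ->
  `|t `^ H - s `^ H| <= `|t - s| `^ H.
Proof.
wlog st : s t / s <= t => [wl|].
  have [st|/ltW ts] := leP s t; first exact: wl.
  by move=> s01 t01; rewrite distrC [`|t - s|]distrC wl.
move=> /andP[s0 s1] /andP[t0 t1].
have [t00|tn0] := eqVneq t 0.
  have -> : s = 0 by apply/le_anti; rewrite s0 -t00 st.
  by rewrite t00 !subrr normr0 powR_ge0.
rewrite ger0_norm; last first.
  by rewrite subr_ge0; apply: ge0_ler_powR; rewrite ?nnegrE ?(ltW H0).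
rewrite [`|t - s|]ger0_norm ?subr_ge0//.
have := @powR_increment_le 0 s t; rewrite lexx ltr01 subr0 powR1 mul1r; apply => //.
by rewrite lt_neqAle eq_sym tn0 t0.
Qed.

End powR_subadditivity.

Section covariance_estimates.
Context {R : realType}.
Variables (H : R).
Hypothesis H01 : 0 < H < 1.
Implicit Types s t : R.
Let H0 : 0 < H. Proof. by case/andP: H01. Qed.

Lemma fbm_covE s t : 0 <= s -> 0 <= t ->
  fbm_cov H s t = 2^-1 * ((t `^ H) ^+ 2 + (s `^ H) ^+ 2 - (`|t - s| `^ H) ^+ 2).
Proof. by move=> s0 t0; rewrite /fbm_cov (ger0_norm s0) (ger0_norm t0) !powR_sqr. Qed.

Lemma fbm_cov_diag t : 0 <= t -> fbm_cov H t t = (t `^ H) ^+ 2.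
Proof.
move=> t0; rewrite fbm_covE// subrr normr0 powR0 ?gt_eqF// expr0n /= subr0.
by field.
Qed.

Lemma fbm_cov_increment s t : 0 <= s -> 0 <= t ->
  fbm_cov H s s + fbm_cov H t t - 2 * fbm_cov H s t = (`|t - s| `^ H) ^+ 2.
Proof. by move=> s0 t0; rewrite !fbm_cov_diag// fbm_covE//; field. Qed.

Variable eps0 : R.
Hypothesis eps01 : 0 < eps0 < 1.
Let e0 : 0 < eps0. Proof. by case/andP: eps01. Qed.
Let e1 : eps0 < 1. Proof. by case/andP: eps01. Qed.

Definition min_sd : R := eps0 `^ H.

Lemma min_sd_gt0 : 0 < min_sd. Proof. exact: powR_gt0. Qed.

Lemma min_sd_le t : eps0 <= t -> min_sd <= t `^ H.
Proof.
move=> et; apply: ge0_ler_powR; rewrite ?nnegrE ?(ltW H0)// ?(ltW e0)//.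
by rewrite (le_trans _ et)// ltW.
Qed.

Lemma min_sd_le1 : min_sd <= 1.
Proof. by apply: powR_le1 => //; rewrite !ltW. Qed.

(** Lower bound for the ratio of [residual_var s t] to the variance of the increment; it
    tends to 0 with [eps0]. *)
Definition nondeterminism : R :=
  (1 - ((1 - eps0) `^ (1 - H)) ^+ 2) * min_sd ^+ 2 / 2.

Lemma nondeterminism_gt0 : 0 < nondeterminism.
Proof.
rewrite divr_gt0// mulr_gt0 ?exprn_gt0 ?min_sd_gt0// subr_gt0.
rewrite expr_lt1 ?powR_ge0//.
apply: (@lt_le_trans _ _ (1 `^ (1 - H))); last by rewrite powR1.
apply: gt0_ltr_powR.
- by rewrite subr_gt0; case/andP: H01.
- by rewrite nnegrE subr_ge0 ltW.
- by rewrite nnegrE.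
- by rewrite ltrBlDr ltrDl.
Qed.

Lemma nondeterminism_le1 : nondeterminism <= 1.
Proof.
rewrite /nondeterminism; have := sqr_ge0 ((1 - eps0) `^ (1 - H)).
have : min_sd ^+ 2 <= 1 by rewrite expr_le1 ?min_sd_le1// ltW// min_sd_gt0.
have := sqr_ge0 min_sd.
move: (_ ^+ 2) (_ ^+ 2) => x y x0 x1 y0; nra.
Qed.

(** Regression coefficient of the value at [t] on the value at [s]. *)
Definition regression s t : R := fbm_cov H s t / fbm_cov H s s.

(** Conditional variance of the value at [t] given the value at [s]. *)
Definition residual_var s t : R := fbm_cov H t t - regression s t * fbm_cov H s t.

Lemma cov_diag_gt0 s : eps0 <= s -> 0 < fbm_cov H s s.
Proof.
move=> es; have s0 : 0 < s by apply: lt_le_trans es.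
by rewrite fbm_cov_diag ?ltW// exprn_gt0// powR_gt0.
Qed.

(** Heron's formula: four times the Gram determinant of two vectors of lengths
    [p], [q] at distance [u] is [(u^2 - (q - p)^2) ((p + q)^2 - u^2)]. The second factor
    is bounded below, and [powR_increment_le] bounds the first one. *)
Lemma residual_var_ge s t : eps0 <= s <= 1 -> eps0 <= t <= 1 ->
  nondeterminism * (`|t - s| `^ H) ^+ 2 <= residual_var s t.
Proof.
move=> /andP[es s1] /andP[et t1].
have s0 : 0 < s by apply: lt_le_trans es.
have t0 : 0 < t by apply: lt_le_trans et.
have c0 := cov_diag_gt0 es.
rewrite /residual_var /regression.
have -> : fbm_cov H t t - fbm_cov H s t / fbm_cov H s s * fbm_cov H s t =
  (fbm_cov H t t * fbm_cov H s s - fbm_cov H s t ^+ 2) / fbm_cov H s s.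
  by field; rewrite gt_eqF.
rewrite ler_pdivlMr// !fbm_cov_diag ?(ltW s0) ?(ltW t0)// fbm_covE ?(ltW s0) ?(ltW t0)//.
set p := s `^ H; set q := t `^ H; set u := `|t - s| `^ H.
have -> : q ^+ 2 * p ^+ 2 - (2^-1 * (q ^+ 2 + p ^+ 2 - u ^+ 2)) ^+ 2 =
   (u ^+ 2 - (q - p) ^+ 2) * ((p + q - u) * (p + q + u)) / 4 by field.
have pm : min_sd <= p by exact: min_sd_le.
have qm : min_sd <= q by exact: min_sd_le.
have p1 : p <= 1 by apply: powR_le1 => //; rewrite (ltW s0).
have m0 := min_sd_gt0.
have u0 : 0 <= u by exact: powR_ge0.
have pqu : min_sd <= p + q - u.
  have [st|/ltW ts] := leP s t.
  - suff : u <= q by lra.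
    apply: ge0_ler_powR; rewrite ?nnegrE ?(ltW H0)// ?(ltW t0)//.
    by rewrite ger0_norm ?subr_ge0// lerBlDr lerDl ltW.
  - suff : u <= p by lra.
    apply: ge0_ler_powR; rewrite ?nnegrE ?(ltW H0)// ?(ltW s0)//.
    by rewrite distrC ger0_norm ?subr_ge0// lerBlDr lerDl ltW.
have h2 : 2 * min_sd ^+ 2 <= (p + q - u) * (p + q + u) by nra.
set th := (1 - eps0) `^ (1 - H).
have qp : (q - p) ^+ 2 <= th ^+ 2 * u ^+ 2.
  rewrite -exprMn -real_normK ?num_real// lerXn2r ?nnegrE ?mulr_ge0 ?powR_ge0//.
  have [st|/ltW ts] := leP s t.
  - rewrite ger0_norm; last first.
      by rewrite subr_ge0; apply: ge0_ler_powR; rewrite ?nnegrE ?(ltW H0) ?(ltW s0) ?(ltW t0).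
    rewrite /u ger0_norm ?subr_ge0//; apply: powR_increment_le => //.
      by rewrite (ltW e0).
    by rewrite t0.
  - rewrite distrC ger0_norm; last first.
      by rewrite subr_ge0; apply: ge0_ler_powR; rewrite ?nnegrE ?(ltW H0) ?(ltW s0) ?(ltW t0).
    rewrite /u distrC ger0_norm ?subr_ge0//; apply: powR_increment_le => //.
      by rewrite (ltW e0).
    by rewrite s0.
have p2 : p ^+ 2 <= 1 by rewrite expr_le1// ltW// (lt_le_trans m0).
have n0 := nondeterminism_gt0.
apply: (@le_trans _ _ (nondeterminism * u ^+ 2)).
  by rewrite ler_piMr// mulr_ge0 ?sqr_ge0// ltW.
rewrite /nondeterminism -/th.
have h1 : (1 - th ^+ 2) * u ^+ 2 <= u ^+ 2 - (q - p) ^+ 2 by lra.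
have h0 : 0 <= (1 - th ^+ 2) * u ^+ 2.
  move: n0; rewrite /nondeterminism -/th pmulr_lgt0 ?invr_gt0// pmulr_lgt0 ?exprn_gt0//.
  by move=> /ltW ?; rewrite mulr_ge0// sqr_ge0.
have := ler_pM h0 _ h1 h2; rewrite mulr_ge0 ?sqr_ge0// => /(_ isT).
lra.
Qed.

(** The increment is the sum of the residual and of a multiple of the value at [s], and
    these are orthogonal. *)
Lemma residual_var_le s t : eps0 <= s <= 1 -> eps0 <= t <= 1 ->
  residual_var s t <= (`|t - s| `^ H) ^+ 2.
Proof.
move=> /andP[es s1] /andP[et t1].
have s0 : 0 < s by apply: lt_le_trans es.
have t0 : 0 < t by apply: lt_le_trans et.
have c0 := cov_diag_gt0 es.
rewrite -fbm_cov_increment ?(ltW s0) ?(ltW t0)// /residual_var.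
have : 0 <= (1 - regression s t) ^+ 2 * fbm_cov H s s by rewrite mulr_ge0 ?sqr_ge0// ltW.
have : fbm_cov H s t = regression s t * fbm_cov H s s by rewrite divfK// gt_eqF.
move=> ->; lra.
Qed.

(** Replacing the regression coefficient by 1 costs no more than the increment itself. *)
Lemma regression_dist a t : eps0 <= a <= 1 -> 0 <= t <= 1 ->
  `|1 - regression a t| <= 3 / 2 / min_sd ^+ 2 * `|t - a| `^ H.
Proof.
move=> /andP[ea a1] /andP[t0 t1].
have a0 : 0 < a by apply: lt_le_trans ea.
have c0 := cov_diag_gt0 ea.
have -> : 1 - regression a t = (fbm_cov H a a - fbm_cov H a t) / fbm_cov H a a.
  by rewrite mulrBl divff// gt_eqF.
rewrite normrM [`|_^-1|]ger0_norm ?invr_ge0 ?(ltW c0)//.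
rewrite fbm_cov_diag ?(ltW a0)// fbm_covE ?(ltW a0)//.
have pm : min_sd <= a `^ H by exact: min_sd_le.
have m0 := min_sd_gt0.
have := @powR_dist_le _ H H01 a t; rewrite (ltW a0) a1 t0 t1 => /(_ isT isT).
have p1 : a `^ H <= 1 by apply: powR_le1 => //; rewrite (ltW a0).
have q1 : t `^ H <= 1 by apply: powR_le1 => //; rewrite t0.
have u1 : `|t - a| `^ H <= 1.
  apply: powR_le1 => //; rewrite normr_ge0 ler_norml; lra.
have q0 := powR_ge0 t H; have u0 := powR_ge0 `|t - a| H.
move: (a `^ H) (t `^ H) (`|t - a| `^ H) pm p1 q1 u1 q0 u0 => p q u pm p1 q1 u1 q0 u0 hd.
have p0 : 0 < p by apply: lt_le_trans pm.
apply: (@le_trans _ _ ((3 / 2 * u) / p ^+ 2)).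
  rewrite ler_wpM2r ?invr_ge0 ?sqr_ge0//.
  move: hd; rewrite !ler_norml => /andP[h1 h2]; apply/andP; split; nra.
rewrite [leRHS]mulrAC ler_wpM2l ?mulr_ge0//.
by rewrite lef_pV2 ?posrE ?exprn_gt0// lerXn2r ?nnegrE ?(ltW p0) ?(ltW m0).
Qed.

End covariance_estimates.

(** * Small balls at two times *)

Section expR_growth.
Context {R : realType}.
Implicit Types x z : R.

Lemma expR_ge_pow n x : 0 <= x -> (1 + x / n.+1%:R) ^+ n.+1 <= expR x.
Proof.
move=> x0; rewrite -{2}(divfK (x := n.+1%:R) _ x) ?pnatr_eq0// expRM_natr.
by rewrite lerXn2r ?nnegrE ?expR_ge0 ?addr_ge0 ?divr_ge0// expR_ge1Dx.
Qed.

(** With [z = |w| / U], the product of [expR (- z^2 / (2 L^2))] and [(1 + z) ^+ n.+1] is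
    bounded. *)
Lemma gauss_decay (L : R) n : 0 < L -> exists2 A : R, 0 < A &
  forall (w U : R), 0 < U ->
    expR (- (w ^+ 2 / (2 * (L * U) ^+ 2))) * (U + `|w|) ^+ n.+1 <= A * U ^+ n.+1.
Proof.
move=> L0; pose B : R := 2 + 2 * L ^+ 2 * n.+1%:R.
have L2 : 0 < L ^+ 2 by rewrite exprn_gt0.
have n0 : (0 : R) < n.+1%:R by rewrite ltr0n.
have B0 : 0 < B by rewrite ltr_wpDr// !mulr_ge0// ltW.
exists (B ^+ n.+1); first by rewrite exprn_gt0.
move=> w U U0.
pose z : R := `|w| / U.
have z0 : 0 <= z by rewrite divr_ge0// ltW.
have Uw : U + `|w| = U * (1 + z) by rewrite /z; field; rewrite gt_eqF.
have -> : w ^+ 2 / (2 * (L * U) ^+ 2) = z ^+ 2 / (2 * L ^+ 2).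
  rewrite /z -(real_normK (num_real w)); field.
  by rewrite !gt_eqF.
clearbody z; rewrite Uw (exprMn _ U) expRN [leLHS]mulrCA [leRHS]mulrC ler_wpM2l ?exprn_ge0 ?(ltW U0)//.
rewrite mulrC ler_pdivrMr ?expR_gt0//.
have h0 : 0 <= z ^+ 2 / (2 * L ^+ 2) by rewrite divr_ge0 ?sqr_ge0// mulr_ge0// ltW.
apply: (@le_trans _ _ (B ^+ n.+1 * (1 + z ^+ 2 / (2 * L ^+ 2) / n.+1%:R) ^+ n.+1)); last first.
  by rewrite ler_wpM2l ?exprn_ge0 ?(ltW B0)// expR_ge_pow.
have hn : 0 <= 1 + z ^+ 2 / (2 * L ^+ 2) / n.+1%:R.
  by apply: addr_ge0 => //; apply: divr_ge0.
rewrite -exprMn; apply: lerXn2r; rewrite ?nnegrE.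
- exact: addr_ge0.
- by rewrite mulr_ge0// ltW.
have -> : B * (1 + z ^+ 2 / (2 * L ^+ 2) / n.+1%:R) =
   B + z ^+ 2 + 2 * (z ^+ 2 / (2 * L ^+ 2 * n.+1%:R)).
  rewrite /B; field; rewrite !gt_eqF//.
have : 0 <= z ^+ 2 / (2 * L ^+ 2 * n.+1%:R).
  by rewrite divr_ge0 ?sqr_ge0// !mulr_ge0// ltW.
have : 0 <= 2 * L ^+ 2 * n.+1%:R by rewrite !mulr_ge0// ltW.
rewrite /B; move: (2 * L ^+ 2 * n.+1%:R) => r r0; move: (z ^+ 2 / r) => q q0.
have := sqr_ge0 (z - 2^-1); rewrite expr2; lra.
Qed.

(** The Gaussian factor absorbs the power and leaves weights to which
    [measure_bigcup_le] applies. *)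
Lemma gauss_tail n : exists2 G : R, 0 < G &
  forall i : nat, expR (- (i%:R ^+ 2 / 4)) * i.+1%:R ^+ n.+1 <= G / (2 ^ i.+1)%:R.
Proof.
pose N : R := n.+1%:R ^+ n.+1.
have N0 : 0 < N by rewrite exprn_gt0// ltr0n.
exists (N * expR 6); first by rewrite mulr_gt0// expR_gt0.
move=> i; rewrite ler_pdivlMr ?ltr0n ?expn_gt0//.
set x : R := i.+1%:R.
have x0 : 0 <= x by [].
have h1 : x ^+ n.+1 <= N * expR x.
  apply: (@le_trans _ _ (N * (1 + x / n.+1%:R) ^+ n.+1)); last first.
    by rewrite ler_wpM2l ?(ltW N0)// expR_ge_pow.
  rewrite /N -exprMn lerXn2r ?nnegrE ?mulr_ge0 ?addr_ge0 ?divr_ge0//.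
  by rewrite mulrDr mulr1 mulrCA divff ?pnatr_eq0// mulr1 lerDr.
have h2 : (2 ^ i.+1)%:R <= expR x :> R.
  rewrite natrX /x -[i.+1%:R]mulr1 mulrC expRM_natr lerXn2r ?nnegrE ?expR_ge0//.
  by have := expR_ge1Dx (1 : R); rewrite -natr1.
apply: (@le_trans _ _ (expR (- (i%:R ^+ 2 / 4)) * (N * expR x) * expR x)).
  rewrite -!mulrA ler_wpM2l ?expR_ge0// mulrA.
  by rewrite ler_pM// ?exprn_ge0.
have -> : expR (- (i%:R ^+ 2 / 4)) * (N * expR x) * expR x =
   N * expR (- (i%:R ^+ 2 / 4) + x + x) by rewrite !expRD; ring.
rewrite ler_wpM2l ?(ltW N0)// ler_expR /x -(natr1 i).
have := sqr_ge0 ((i%:R : R) / 2 - 2); lra.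
Qed.

End expR_growth.

Section union_bounds.
Context {R : realType} {d : measure_display} {T : measurableType d}.
Variable mu : {measure set T -> \bar R}.

Lemma measure_bigcup_le (A : set T) (F : (set T)^nat) (M : R) :
  measurable A -> (forall i, measurable (F i)) -> A `<=` \bigcup_i F i -> 0 <= M ->
  (forall i, (mu (F i) <= (M / (2 ^ i.+1)%:R)%:E)%E) -> (mu A <= M%:E)%E.
Proof.
move=> mA mF AF M0 FM.
apply: (le_trans (measure_sigma_subadditive mu mF mA AF)).
apply: (le_trans _ (epsilon_trick0 xpredT M0)).
exact: lee_nneseries.
Qed.

Lemma measurable_le_set (f g : T -> R) : measurable_fun [set: T] f -> measurable_fun [set: T] g ->
  measurable [set w | f w <= g w].
Proof. by move=> mf mg; rewrite -[X in measurable X]setTI; exact: measurable_fun_le. Qed.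

Lemma measurable_lt_set (f g : T -> R) : measurable_fun [set: T] f -> measurable_fun [set: T] g ->
  measurable [set w | f w < g w].
Proof.
move=> mf mg; have -> : [set w | f w < g w] = ~` [set w | g w <= f w].
  by apply/seteqP; split => w /=; rewrite ltNge => /negP.
by apply: measurableC; exact: measurable_le_set.
Qed.

End union_bounds.

Section smoothed_density_bounds.
Context {R : realType}.

Lemma smoothed_density_le (e v x s : R) : 0 < e -> 0 < s -> s ^+ 2 <= v ->
  smoothed_density e v x <= e / s.
Proof.
move=> e0 s0 sv; rewrite /smoothed_density -[leRHS]mulr1.
have v0 : 0 < v by apply: lt_le_trans sv; rewrite exprn_gt0.
rewrite ler_pM ?gauss_bump_ge0 ?gauss_bump_le1 ?divr_ge0 ?sqrtr_ge0 ?(ltW e0)//.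
rewrite ler_wpM2l ?(ltW e0)// lef_pV2 ?posrE ?sqrtr_gt0 ?ltr_wpDr ?sqr_ge0//.
rewrite -[leLHS](ger0_norm (ltW s0)) -sqrtr_sqr ler_wsqrtr// (le_trans sv)// lerDl sqr_ge0//.
Qed.

Lemma smoothed_density_le1 (e v x : R) : 0 < e -> 0 <= v -> v <= e ^+ 2 ->
  smoothed_density e v x <= expR (- (x ^+ 2 / (4 * e ^+ 2))).
Proof.
move=> e0 v0 ve; rewrite /smoothed_density /gauss_bump -[leRHS]mul1r.
have e2 : 0 < e ^+ 2 by rewrite exprn_gt0.
have S0 : 0 < v + e ^+ 2 by rewrite ltr_wpDl.
rewrite sqr_sqrtr ?(ltW S0)//.
rewrite ler_pM ?expR_ge0 ?divr_ge0 ?sqrtr_ge0 ?(ltW e0)//.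
  rewrite ler_pdivrMr ?sqrtr_gt0// mul1r -[leLHS](ger0_norm (ltW e0)) -sqrtr_sqr.
  by rewrite ler_wsqrtr// lerDr.
rewrite ler_expR lerN2 ler_wpM2l ?sqr_ge0// lef_pV2 ?posrE ?mulr_gt0//.
lra.
Qed.

End smoothed_density_bounds.

Section fbm_estimates.
Context {R : realType}.
Variables (H eps0 : R).
Hypothesis H01 : 0 < H < 1.
Hypothesis eps01 : 0 < eps0 < 1.
Let m : R := min_sd H eps0.
Let m0 : 0 < m. Proof. exact: min_sd_gt0. Qed.
Let m1 : m <= 1. Proof. exact: min_sd_le1. Qed.

Definition pts (s : seq R) n : 'I_n -> R := fun j => nth 0 s j.

Definition gaussian_fbm {disp} {T : measurableType disp} (P : probability T R)
  (X : R -> {RV P >-> R}) :=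
  [/\ gaussian_process X, centered X & fbm_covariance H X].

(** Sharp small-ball estimate for the values at two times: with [u] the standard
    deviation of the increment, [|X_s - x| <= e] costs [e], and then
    [|X_t - y| <= e] costs [e / (u + e)], times a factor decaying like any power
    of [|y - x| / (u + e)]. *)
Lemma two_point_probability (M : R) (n : nat) : exists2 C : R, 0 < C &
  forall (disp : measure_display) (T : measurableType disp) (P : probability T R)
    (X : R -> {RV P >-> R}), gaussian_fbm X ->
  forall s t e x y U : R, eps0 <= s <= 1 -> eps0 <= t <= 1 -> 0 < e -> `|x| <= M ->
    U = `|t - s| `^ H + e ->
    (P [set w | (`|X s w - x| <= e)%R /\ (`|X t w - y| <= e)%R] <=
      (C * e ^+ 2 * U ^+ n / (U + `|y - x|) ^+ n.+1)%:E)%E.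
Proof.
pose k := nondeterminism H eps0.
have k0 : 0 < k by exact: nondeterminism_gt0.
have k1 : k <= 1 by exact: nondeterminism_le1.
pose L : R := 1 + m ^- 2.
have im0 : 0 < m ^- 2 by rewrite invr_gt0 exprn_gt0.
have L1 : 1 <= L by rewrite lerDl ltW.
have L0 : 0 < L by apply: lt_le_trans L1.
have [A A0 hA] := gauss_decay n L0.
pose sk := Num.sqrt (k / 2).
have sk0 : 0 < sk by rewrite sqrtr_gt0 divr_gt0.
have skE : sk ^+ 2 = k / 2 by apply: sqr_sqrtr; apply: divr_ge0 => //; exact: ltW.
pose N := 3 / 2 / m ^+ 2 * `|M|.
have N0 : 0 <= N by rewrite !mulr_ge0// ltW.
exists (expR 1 * (1 / m) * (L / sk) * A * (1 + N) ^+ n.+1).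
  rewrite !mulr_gt0 ?expR_gt0 ?invr_gt0 ?exprn_gt0//; lra.
move=> disp T P X [gX cX covX] s t e x y _ /andP[es s1] /andP[et t1] e0 xM ->.
have s0 : 0 < s by apply: lt_le_trans es; case/andP: eps01.
have t0 : 0 < t by apply: lt_le_trans et; case/andP: eps01.
have s01 : eps0 <= s <= 1 by rewrite es s1.
have t01 : eps0 <= t <= 1 by rewrite et t1.
set u := `|t - s| `^ H; set U := u + e.
have u0 : 0 <= u by exact: powR_ge0.
have U0 : 0 < U by rewrite ltr_wpDl.
pose c := regression H s t.
pose p : 'I_2 -> R := @pts [:: s; t] 2.
have p01 j : p j \in `[0, 1].
  by case: j => -[|[|//]] i; rewrite /p /pts in_itv /= ?s1 ?t1 ?(ltW s0) ?(ltW t0).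
pose a : 'I_2 -> R := @pts [:: 1; 0] 2.
pose b : 'I_2 -> R := @pts [:: - c; 1] 2.
have css := cov_diag_gt0 H01 eps01 es.
have aa : lincov H p a a = fbm_cov H s s.
  rewrite /lincov !big_ord_recl !big_ord0 /= /a /b /p /pts /=; ring.
have ab : lincov H p a b = 0.
  rewrite /lincov !big_ord_recl !big_ord0 /= /a /b /p /pts /=.
  have -> : fbm_cov H s t = c * fbm_cov H s s by rewrite /c divfK// gt_eqF.
  ring.
have bb : lincov H p b b = residual_var H s t.
  rewrite /lincov !big_ord_recl !big_ord0 /= /a /b /p /pts /=.
  rewrite /residual_var -/c (fbm_covC H t s).
  have -> : fbm_cov H s t = c * fbm_cov H s s by rewrite /c divfK// gt_eqF.
  ring.
have c1 : `|c| <= m ^- 2.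
  rewrite /c /regression normrM [`|_^-1|]ger0_norm ?invr_ge0 ?(ltW css)//.
  have cst1 : `|fbm_cov H s t| <= 1.
    rewrite fbm_covE ?(ltW s0) ?(ltW t0)// -/u.
    have p1 : (t `^ H) ^+ 2 <= 1 by rewrite expr_le1 ?powR_ge0// powR_le1// (ltW t0).
    have q1 : (s `^ H) ^+ 2 <= 1 by rewrite expr_le1 ?powR_ge0// powR_le1// (ltW s0).
    have r1 : u ^+ 2 <= 1.
      rewrite expr_le1// powR_le1// normr_ge0 ler_norml; lra.
    move: p1 q1 r1 (sqr_ge0 (t `^ H)) (sqr_ge0 (s `^ H)) (sqr_ge0 u).
    rewrite ler_norml; lra.
  rewrite -[leRHS]mul1r ler_pM ?invr_ge0 ?(ltW css)//.
  rewrite lef_pV2 ?posrE ?exprn_gt0// fbm_cov_diag ?(ltW s0)//.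
  by rewrite lerXn2r ?nnegrE ?powR_ge0 ?(ltW m0)// min_sd_le.
have Le0 : 0 < L * e by rewrite mulr_gt0.
have lX w : lincomb X p a w = X s w.
  by rewrite /lincomb !big_ord_recl big_ord0 /= /a /p /pts /= mul1r mul0r !addr0.
have lW w : lincomb X p b w = X t w - c * X s w.
  by rewrite /lincomb !big_ord_recl big_ord0 /= /b /p /pts /=; ring.
(* the value at [t] is [c * X s] plus a residual, which is uncorrelated with [X s] and
   has to be within [L * e] of [y'] *)
pose y' := y - c * x.
have := @rectangle_lincomb_le _ _ _ P H X gX cX covX _ p p01 a b e x (L * e) y' e0 Le0 ab.
move=> rect.
apply: (le_trans _ (le_trans rect _)).
  apply: le_measure; rewrite ?inE.
  - have -> : [set w | `|X s w - x| <= e /\ `|X t w - y| <= e] =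
       [set w | `|X s w - x| <= e] `&` [set w | `|X t w - y| <= e] by [].
    apply: measurableI; apply: measurable_le_set => //; apply: measurableT_comp => //;
      exact: measurable_funB.
  - have -> : [set w | `|lincomb X p a w - x| <= e /\ `|lincomb X p b w - y'| <= L * e] =
       [set w | `|lincomb X p a w - x| <= e] `&` [set w | `|lincomb X p b w - y'| <= L * e] by [].
    by apply: measurableI; apply: measurable_le_set => //; apply: measurableT_comp => //;
      apply: measurable_funB => //; exact: measurable_lincomb.
  - move=> w /= [h1 h2]; rewrite lX lW; split => //.
    have -> : X t w - c * X s w - y' = (X t w - y) - c * (X s w - x) by rewrite /y'; ring.
    apply: (le_trans (ler_normB _ _)); rewrite normrM /L mulrDl mul1r lerD//.
    by rewrite ler_pM.
rewrite aa bb lee_fin.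
have sd1 : smoothed_density e (fbm_cov H s s) x <= e / m.
  apply: smoothed_density_le => //; rewrite fbm_cov_diag ?(ltW s0)//.
  by rewrite lerXn2r ?nnegrE ?powR_ge0 ?(ltW m0)// min_sd_le.
have rv1 := residual_var_ge H01 eps01 s01 t01.
have rv2 := residual_var_le H01 eps01 s01 t01.
rewrite -/u -/k in rv1 rv2.
set V := residual_var H s t in rv1 rv2 *.
(* smoothing at scale [L * e] makes the standard deviation of order [U = u + e] even
   when the residual is small *)
have VL0 : (sk * U) ^+ 2 <= V + (L * e) ^+ 2.
  rewrite !exprMn skE.
  have : 1 <= L ^+ 2 by rewrite exprn_ege1.
  have := sqr_ge0 (u - e); have := sqr_ge0 e; have := sqr_ge0 u; rewrite /U.
  move: (L ^+ 2) => LL; nra.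
have VL1 : V + (L * e) ^+ 2 <= (L * U) ^+ 2.
  rewrite !exprMn; have : 1 <= L ^+ 2 by rewrite exprn_ege1.
  have := sqr_ge0 e; have := sqr_ge0 u; have : 0 <= u * e by rewrite mulr_ge0// ltW.
  rewrite /U; move: (L ^+ 2) => LL; nra.
have V0 : 0 < V + (L * e) ^+ 2 by apply: lt_le_trans VL0; rewrite exprn_gt0// mulr_gt0.
have sd2 : smoothed_density (L * e) V y' * (U + `|y'|) ^+ n.+1 <=
    (L * e / (sk * U)) * (A * U ^+ n.+1).
  rewrite /smoothed_density -mulrA; apply: ler_pM.
  - by apply: divr_ge0; [exact: ltW|exact: sqrtr_ge0].
  - apply: mulr_ge0; first exact: gauss_bump_ge0.
    by apply: exprn_ge0; apply: addr_ge0 => //; exact: ltW.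
  - apply: ler_wpM2l; first exact: ltW.
    rewrite lef_pV2 ?posrE ?sqrtr_gt0//; last exact: mulr_gt0.
    rewrite -[leLHS]ger0_norm; last by apply: mulr_ge0; exact: ltW.
    by rewrite -sqrtr_sqr ler_wsqrtr.
  apply: le_trans (hA y' U U0).
  apply: ler_wpM2r; first by apply: exprn_ge0; apply: addr_ge0 => //; exact: ltW.
  rewrite /gauss_bump ler_expR lerN2; apply: ler_wpM2l; first exact: sqr_ge0.
  have LU0 : 0 < L * U by exact: mulr_gt0.
  rewrite sqr_sqrtr ?(ltW V0)// lef_pV2 ?posrE ?ler_pM2l//.
  - by apply: mulr_gt0 => //; exact: exprn_gt0.
  - exact: mulr_gt0.
(* the regression coefficient is within [O(U)] of 1, hence [y'] is within [O(U)] of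
   [y - x] *)
have Uy : U + `|y - x| <= (1 + N) * (U + `|y'|).
  have h : `|y - x| <= `|y'| + N * U.
    have -> : y - x = y' - (1 - c) * x by rewrite /y'; ring.
    apply: (le_trans (ler_normB _ _)); rewrite lerD2l normrM /N [leRHS]mulrAC; apply: ler_pM => //.
    + apply: (le_trans (regression_dist H01 eps01 s01 _)); first by rewrite (ltW t0).
      apply: ler_wpM2l; last by rewrite /U lerDl ltW.
      by apply: mulr_ge0 => //; exact: ltW.
    + by rewrite (le_trans xM)// ler_norm.
  rewrite mulrDl mul1r mulrDr.
  have : 0 <= N * `|y'| by rewrite mulr_ge0.
  lra.
have Uyx0 : 0 < U + `|y - x| by rewrite ltr_wpDr.
have Uy'0 : 0 < U + `|y'| by rewrite ltr_wpDr.
have N10 : 0 < 1 + N by rewrite ltr_wpDr.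
rewrite ler_pdivlMr ?exprn_gt0//.
have hpow : (U + `|y - x|) ^+ n.+1 <= (1 + N) ^+ n.+1 * (U + `|y'|) ^+ n.+1.
  by rewrite -exprMn lerXn2r ?nnegrE ?mulr_ge0 ?(ltW Uyx0) ?(ltW Uy'0) ?(ltW N10).
have sd1_0 : 0 <= smoothed_density e (fbm_cov H s s) x.
  by rewrite /smoothed_density mulr_ge0 ?gauss_bump_ge0 ?divr_ge0 ?sqrtr_ge0 ?(ltW e0).
have sd2_0 : 0 <= smoothed_density (L * e) V y'.
  by rewrite /smoothed_density mulr_ge0 ?gauss_bump_ge0 ?divr_ge0 ?sqrtr_ge0 ?(ltW Le0).
apply: (@le_trans _ _ (expR 1 * (e / m * ((1 + N) ^+ n.+1 * (L * e / (sk * U) * (A * U ^+ n.+1)))))).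
  rewrite -[leLHS]mulrA; apply: ler_wpM2l; first exact: expR_ge0.
  rewrite -[leLHS]mulrA; apply: ler_pM => //.
    by apply: mulr_ge0 => //; apply: exprn_ge0; exact: ltW.
  apply: (@le_trans _ _ (smoothed_density (L * e) V y' * ((1 + N) ^+ n.+1 * (U + `|y'|) ^+ n.+1))).
    by rewrite ler_wpM2l.
  by rewrite mulrCA ler_wpM2l ?exprn_ge0 ?(ltW N10).
rewrite le_eqVlt; apply/orP; left; apply/eqP.
rewrite [U ^+ n.+1]exprS; field.
by rewrite !gt_eqF.
Qed.

End fbm_estimates.

(** * Small balls over a short time interval *)

Section finite_unions.
Context {R : realType} {d : measure_display} {T : measurableType d}.
Variable mu : {measure set T -> \bar R}.

Lemma measurable_exists_lt (F : nat -> set T) k : (forall j, measurable (F j)) ->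
  measurable [set w | exists2 j, (j < k)%N & F j w].
Proof.
move=> mF.
have -> : [set w | exists2 j, (j < k)%N & F j w] = \bigcup_(j in [set j | (j < k)%N]) F j.
  by apply/seteqP; split => w /=; [move=> [j jk Fj]; exists j|move=> [j jk Fj]; exists j].
by apply: bigcup_measurable.
Qed.

Lemma measure_exists_lt_le (F : nat -> set T) (c : R) k :
  (forall j, measurable (F j)) -> (forall j, (j < k)%N -> (mu (F j) <= c%:E)%E) ->
  (mu [set w | exists2 j, (j < k)%N & F j w] <= (k%:R * c)%:E)%E.
Proof.
move=> mF; elim: k => [|k IH] Fc.
  rewrite mul0r (_ : [set w | _] = set0) ?measure0//.
  by apply/seteqP; split => w //= [].
have -> : [set w | exists2 j, (j < k.+1)%N & F j w] =
    [set w | exists2 j, (j < k)%N & F j w] `|` F k.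
  apply/seteqP; split => w /=.
    move=> [j]; rewrite ltnS leq_eqVlt => /predU1P[->|jk] Fj; [by right|left].
    by exists j.
  by move=> [[j jk Fj]|Fk]; [exists j => //; exact: ltnW|exists k].
apply: (le_trans (measureU2 _ (measurable_exists_lt _ mF) (mF k))).
rewrite -natr1 mulrDl mul1r EFinD leeD//; last exact: Fc.
by apply: IH => j jk; apply: Fc; exact: ltnW.
Qed.

Lemma measure_nondecreasing_bigcup_le (F : (set T)^nat) (M : \bar R) :
  (forall j, measurable (F j)) -> {homo F : n m / (n <= m)%N >-> n `<=` m} ->
  (forall n, (mu (F n) <= M)%E) -> (mu (\bigcup_n F n) <= M)%E.
Proof.
move=> mF ndF FM.
have mU : measurable (\bigcup_n F n) by exact: bigcup_measurable.
have ndF' : {homo F : n m / (n <= m)%N >-> (n <= m)%O}.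
  by move=> n k nk; apply/subsetPset; exact: ndF.
have cv := @nondecreasing_cvg_mu _ _ _ mu F mF mU ndF'.
rewrite -(cvg_lim _ cv)//; apply: lime_le; first by apply/cvg_ex; exists (mu (\bigcup_n F n)).
by apply: nearW => n /=.
Qed.

End finite_unions.

Section dyadic_chaining.
Context {R : realType}.

(** A point of rank [n.+1] is a point of rank [n] or the right neighbour of one, so that
    each rank adds at most [M * b ^+ n.+1]. *)
Lemma dyadic_chaining (g : nat -> nat -> R) (M b : R) (N : nat) :
  0 <= M -> 0 <= b < 1 -> g 0%N 0%N = 0 ->
  (forall n j, g n.+1 j.*2 = g n j) ->
  (forall n j, (n <= N)%N -> (j < 2 ^ n)%N -> `|g n j.+1 - g n j| <= M * b ^+ n) ->
  forall j, (j <= 2 ^ N)%N -> `|g N j| <= M / (1 - b).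
Proof.
move=> M0 /andP[b0 b1] g00 g2 gD.
have key n : (n <= N)%N -> forall j, (j <= 2 ^ n)%N -> `|g n j| <= M * \sum_(k < n.+1) b ^+ k.
  elim: n => [_|n IH nN] j.
    rewrite big_ord_recl big_ord0 expr0 addr0 mulr1 expn0.
    case: j => [|[|//]] _; first by rewrite g00 normr0.
    by have := gD 0%N 0%N (leq0n _) isT; rewrite g00 subr0 expr0 mulr1.
  rewrite -(odd_double_half j) expnS mul2n => jn.
  have S0 : 0 <= M * b ^+ n.+1 by rewrite mulr_ge0 ?exprn_ge0.
  rewrite big_ord_recr /= mulrDr.
  case: (odd j) jn => /= jn; last first.
    rewrite add0n in jn *; rewrite leq_double in jn.
    by rewrite g2 (le_trans (IH (ltnW nN) _ jn))// lerDl.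
  rewrite add1n in jn *.
  have jn' : (j./2 < 2 ^ n)%N by rewrite -ltn_double.
  rewrite -[g _ _](subrK (g n.+1 j./2.*2)) addrC.
  apply: (le_trans (ler_normD _ _)); apply: lerD.
    by rewrite g2; apply: IH (ltnW nN) _ (ltnW jn').
  by apply: gD => //; rewrite expnS mul2n ltn_double.
move=> j jN; apply: (le_trans (key N (leqnn N) j jN)).
apply: ler_wpM2l => //.
have h : (1 - b) * \sum_(k < N.+1) b ^+ k = 1 - b ^+ N.+1.
  have := subrX1 b N.+1 => e.
  by rewrite -[1 - b ^+ _]opprB e -mulNr opprB.
rewrite -[leRHS]mul1r ler_pdivlMr ?subr_gt0// mulrC h.
by rewrite gerBl exprn_ge0.
Qed.

End dyadic_chaining.

Section residual_tail.
Context {R : realType}.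
Variables (H eps0 : R).
Hypothesis H01 : 0 < H < 1.
Hypothesis eps01 : 0 < eps0 < 1.
Let m : R := min_sd H eps0.
Let m0 : 0 < m. Proof. exact: min_sd_gt0. Qed.
Let m1 : m <= 1. Proof. exact: min_sd_le1. Qed.

(** Increment between [t'] and [t] of the residual of the regression on the value
    at [a]. *)
Definition residual_increment {T : Type} (X : R -> T -> R) a t t' w : R :=
  (X t w - regression H a t * X a w) - (X t' w - regression H a t' * X a w).

(** The residual increment is uncorrelated with the value at [a], and its variance is at
    most that of the increment of the process. *)
Lemma residual_rectangle :
  forall (disp : measure_display) (T : measurableType disp) (P : probability T R)
    (X : R -> {RV P >-> R}), gaussian_fbm H X ->
  forall a t t' y z e s : R, eps0 <= a <= 1 -> 0 <= t <= 1 -> 0 <= t' <= 1 ->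
    0 < e -> 0 < s -> `|t - t'| `^ H <= s ->
    (P [set w | (`|X a w - y| <= e)%R /\ (`|residual_increment X a t t' w - z| <= s)%R] <=
     (expR 1 * (e / m) * expR (- (z ^+ 2 / (4 * s ^+ 2))))%:E)%E.
Proof.
move=> disp T P X [gX cX covX] a t t' y z e s /andP[ea a1] /andP[t0 t1] /andP[t'0 t'1] e0 s0 ts.
have a0 : 0 < a by apply: lt_le_trans ea; case/andP: eps01.
have caa := cov_diag_gt0 H01 eps01 ea.
pose k := regression H a t - regression H a t'.
pose p : 'I_3 -> R := @pts R [:: a; t; t'] 3.
pose u : 'I_3 -> R := @pts R [:: 1; 0; 0] 3.
pose b : 'I_3 -> R := @pts R [:: - k; 1; -1] 3.
have p01 j : p j \in `[0, 1].
  by case: j => -[|[|[|//]]] i; rewrite /p /pts in_itv /= ?t0 ?t1 ?t'0 ?t'1 ?(ltW a0) ?a1.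
have kE : k * fbm_cov H a a = fbm_cov H a t - fbm_cov H a t'.
  by rewrite /k /regression mulrBl !divfK// gt_eqF.
have uu : lincov H p u u = fbm_cov H a a.
  rewrite /lincov !big_ord_recl !big_ord0 /= /u /p /pts /=; ring.
have ub : lincov H p u b = 0.
  rewrite /lincov !big_ord_recl !big_ord0 /= /u /b /p /pts /=.
  have -> : fbm_cov H a t = k * fbm_cov H a a + fbm_cov H a t' by rewrite kE subrK.
  ring.
have bb : lincov H p b b = (`|t - t'| `^ H) ^+ 2 - k ^+ 2 * fbm_cov H a a.
  rewrite -fbm_cov_increment//.
  rewrite /lincov !big_ord_recl !big_ord0 /= /b /p /pts /=.
  rewrite (fbm_covC H t a) (fbm_covC H t' a) (fbm_covC H t t').
  have -> : fbm_cov H a t = k * fbm_cov H a a + fbm_cov H a t' by rewrite kE subrK.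
  ring.
have lX w : lincomb X p u w = X a w.
  by rewrite /lincomb !big_ord_recl big_ord0 /= /u /p /pts /= mul1r !mul0r !addr0.
have lW w : lincomb X p b w = residual_increment X a t t' w.
  by rewrite /lincomb !big_ord_recl big_ord0 /= /b /p /pts /= /residual_increment /k; ring.
have rect := @rectangle_lincomb_le _ _ _ P H X gX cX covX _ p p01 u b e y s z e0 s0 ub.
have -> : [set w | (`|X a w - y| <= e)%R /\ (`|residual_increment X a t t' w - z| <= s)%R] =
   [set w | (`|lincomb X p u w - y| <= e)%R /\ (`|lincomb X p b w - z| <= s)%R].
  by apply/seteqP; split => w /=; rewrite lX lW.
apply: (le_trans rect); rewrite lee_fin -[leRHS]mulrA.
apply: ler_wpM2l; first exact: expR_ge0.
have bb0 := lincov_ge0 covX p01 b.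
apply: ler_pM.
- by rewrite /smoothed_density mulr_ge0 ?gauss_bump_ge0// divr_ge0 ?sqrtr_ge0// ltW.
- by rewrite /smoothed_density mulr_ge0 ?gauss_bump_ge0// divr_ge0 ?sqrtr_ge0// ltW.
- apply: smoothed_density_le => //; rewrite uu fbm_cov_diag ?(ltW a0)//.
  by rewrite lerXn2r ?nnegrE ?powR_ge0 ?(ltW m0)// min_sd_le.
- apply: smoothed_density_le1 => //; rewrite bb.
  apply: (@le_trans _ _ ((`|t - t'| `^ H) ^+ 2)).
    by rewrite gerBl mulr_ge0 ?sqr_ge0// ltW.
  by rewrite lerXn2r ?nnegrE ?powR_ge0// ltW.
Qed.

Lemma measurable_residual_increment disp (T : measurableType disp) (P : probability T R)
    (X : R -> {RV P >-> R}) a t t' :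
  measurable_fun [set: T] (residual_increment X a t t').
Proof.
by apply: measurable_funB; apply: measurable_funB => //; apply: measurable_funM.
Qed.

(** The distance from [X a] to [y] is compared with the random size of an increment of
    the residual that is abnormally large. On the event, [i s <= |residual| <= (i + 1)
    s] for an integer [i > lambda - 1]; the corresponding rectangles are summed over
    [i]. *)
Lemma conditional_tail (n : nat) : exists2 G : R, 0 < G &
  forall (disp : measure_display) (T : measurableType disp) (P : probability T R)
    (X : R -> {RV P >-> R}), gaussian_fbm H X ->
  forall a t t' y s A lambda : R, eps0 <= a <= 1 -> 0 <= t <= 1 -> 0 <= t' <= 1 ->
    0 < s -> `|t - t'| `^ H <= s -> 0 < A -> 0 < lambda ->
    (P [set w | (`|X a w - y| <= A * `|residual_increment X a t t' w|)%R /\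
                (lambda * s < `|residual_increment X a t t' w|)%R] <=
      (G * A * s / lambda ^+ n)%:E)%E.
Proof.
have [G0 G00 hG] := @gauss_tail R n.
exists (2 * (expR 1 / m) * G0); first by rewrite !mulr_gt0 ?expR_gt0 ?invr_gt0.
move=> disp T P X gX a t t' y s A lambda ha ht ht' s0 ts A0 l0.
have mD := measurable_residual_increment X a t t'.
set D := residual_increment X a t t' in mD *.
have mX : measurable_fun [set: T] (fun w => `|X a w - y|).
  by apply: measurableT_comp => //; exact: measurable_funB.
have mR c c' e : measurable [set w | `|X a w - y| <= e /\ `|D w - c'| <= c].
  have -> : [set w | `|X a w - y| <= e /\ `|D w - c'| <= c] =
    [set w | `|X a w - y| <= e] `&` [set w | `|D w - c'| <= c] by [].
  by apply: measurableI; apply: measurable_le_set => //; apply: measurableT_comp => //;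
    exact: measurable_funB.
pose F (i : nat) : set T := if lambda < i.+1%:R then
  [set w | `|X a w - y| <= A * s * i.+1%:R /\ `|D w - i%:R * s| <= s] `|`
  [set w | `|X a w - y| <= A * s * i.+1%:R /\ `|D w - - (i%:R * s)| <= s] else set0.
apply: (@measure_bigcup_le _ _ _ P _ F).
- have -> : [set w | `|X a w - y| <= A * `|D w| /\ lambda * s < `|D w|] =
    [set w | `|X a w - y| <= A * `|D w|] `&` [set w | lambda * s < `|D w|] by [].
  apply: measurableI; [apply: measurable_le_set => //|apply: measurable_lt_set => //].
    by apply: measurable_funM => //; exact: measurableT_comp.
  exact: measurableT_comp.
- by move=> i; rewrite /F; case: ifP => // _; exact: measurableU.
- move=> w /= [h1 h2].
  have q0 : 0 <= `|D w| / s by rewrite divr_ge0// ltW.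
  have /andP[i1 i2] := truncn_itv q0.
  set i := Num.truncn _ in i1 i2.
  rewrite ler_pdivlMr// in i1; rewrite ltr_pdivrMr// in i2.
  exists i => //; rewrite /F.
  have -> : lambda < i.+1%:R by rewrite -(ltr_pM2r s0) (lt_trans h2).
  have hX : `|X a w - y| <= A * s * i.+1%:R.
    apply: (le_trans h1); rewrite -mulrA; apply: ler_wpM2l; first exact: ltW.
    by rewrite mulrC ltW.
  rewrite -natr1 in i2.
  have [D0|D0] := lerP 0 (D w); [left|right]; split => //.
  + rewrite ger0_norm// in i1 i2; rewrite ler_norml; lra.
  + rewrite ltr0_norm// in i1 i2; rewrite ler_norml; lra.
- by rewrite !mulr_ge0 ?expR_ge0 ?invr_ge0 ?exprn_ge0 ?(ltW m0) ?(ltW s0) ?(ltW A0) ?(ltW G00) ?(ltW l0).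
move=> i; rewrite /F; case: ifPn => [li|_]; last first.
  rewrite measure0 lee_fin.
  by rewrite !mulr_ge0 ?expR_ge0 ?invr_ge0 ?exprn_ge0 ?(ltW m0) ?(ltW s0) ?(ltW A0) ?(ltW G00) ?(ltW l0).
apply: (le_trans (measureU2 _ (mR _ _ _) (mR _ _ _))).
have e0 : 0 < A * s * i.+1%:R by rewrite !mulr_gt0.
apply: (le_trans (leeD (residual_rectangle gX y (i%:R * s) ha ht ht' e0 s0 ts)
  (residual_rectangle gX y (- (i%:R * s)) ha ht ht' e0 s0 ts))).
rewrite -EFinD lee_fin sqrrN.
have -> : (i%:R * s) ^+ 2 / (4 * s ^+ 2) = i%:R ^+ 2 / 4 by field; rewrite gt_eqF.
have l1 : expR (- (i%:R ^+ 2 / 4)) * i.+1%:R <= G0 / (2 ^ i.+1)%:R / lambda ^+ n.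
  rewrite ler_pdivlMr ?exprn_gt0//; apply: le_trans (hG i).
  rewrite -mulrA; apply: ler_wpM2l; first exact: expR_ge0.
  rewrite exprS; apply: ler_wpM2l => //.
  by rewrite lerXn2r ?nnegrE ?(ltW l0)// ltW.
have c0 : 0 <= 2 * (expR 1 / m) * A * s.
  by rewrite !mulr_ge0 ?expR_ge0 ?invr_ge0 ?(ltW m0) ?(ltW A0) ?(ltW s0).
have := ler_wpM2l c0 l1.
rewrite (_ : 2 * (expR 1 / m) * A * s * (expR (- (i%:R ^+ 2 / 4)) * i.+1%:R) =
  expR 1 * (A * s * i.+1%:R / m) * expR (- (i%:R ^+ 2 / 4)) +
  expR 1 * (A * s * i.+1%:R / m) * expR (- (i%:R ^+ 2 / 4))); last first.
  by field; rewrite gt_eqF.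
move=> /le_trans; apply; rewrite le_eqVlt; apply/orP; left; apply/eqP.
by rewrite !mulrA; ring.
Qed.

End residual_tail.

Section small_ball.
Context {R : realType}.
Variables (H eps0 : R).
Hypothesis H01 : 0 < H < 1.
Hypothesis eps01 : 0 < eps0 < 1.
Let m : R := min_sd H eps0.
Let m0 : 0 < m. Proof. exact: min_sd_gt0. Qed.
Let m1 : m <= 1. Proof. exact: min_sd_le1. Qed.
Let H0 : 0 < H. Proof. by case/andP: H01. Qed.

Definition dyadic (a delta : R) (n j : nat) : R := a - delta * j%:R / 2 ^+ n.

Lemma dyadic_double a delta n j : dyadic a delta n.+1 j.*2 = dyadic a delta n j.
Proof.
rewrite /dyadic -mul2n natrM exprS; congr (_ - _).
by field; rewrite expf_neq0.
Qed.

(** Maximal inequality behind the hitting of balls: on a dyadic time interval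
    of length [delta] to the left of [a], the process comes within a multiple of
    [r = delta `^ H] of a given point with probability [O(r)].
    If all the residual increments of rank [n] are at most [r * b ^+ n], chaining gives
    [|X a - y| = O(r)], an event of probability [O(r)]. Otherwise let [Mx > r] be the
    largest of them after division by [b ^+ n]: chaining gives [|X a - y| = O(Mx)], and
    [Mx] is the normalized size of one increment, so that [conditional_tail] bounds the
    probability for each possible place of the maximum. *)
Lemma dyadic_small_ball (M A0 : R) : 0 <= M -> 0 <= A0 -> exists C r0 : R, [/\ 0 < C, 0 < r0 &
  forall (disp : measure_display) (T : measurableType disp) (P : probability T R)
    (X : R -> {RV P >-> R}), gaussian_fbm H X ->
  forall a delta y : R, eps0 <= a <= 1 -> 0 < delta <= eps0 -> delta `^ H <= r0 -> `|y| <= M ->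
    (P (\bigcup_n [set w | exists2 j, (j < (2 ^ n).+1)%N &
          (`|X (dyadic a delta n j) w - y| <= A0 * delta `^ H)%R]) <=
      (C * delta `^ H)%:E)%E].
Proof.
move=> M0 A00.
(* increments of rank [n] are of order [r * b ^+ (2 * n)]; one factor [b ^+ n] is kept for
   the summability of the chain, the other one is the excess in [conditional_tail] *)
pose b : R := 2 `^ (- (H / 2)).
have b0 : 0 < b by rewrite powR_gt0.
have b1 : b < 1.
  rewrite /b powRN invf_lt1 ?powR_gt0//.
  rewrite -[ltLHS](powRr0 2).
  rewrite /powR gt_eqF// ltr_expR ltr_pM2r ?ln_gt0//; rewrite ?divr_gt0//; lra.
have b2E : b ^+ 2 = 2 `^ (- H).
  by rewrite -powR_mulrn ?powR_ge0// -powRrM; congr (_ `^ _); field.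
(* there are [2 ^ n] increments of rank [n], which requires a tail of order [4 ^- n] *)
have [q hq] : exists q : nat, b ^+ q.+1 <= 4^-1.
  have := @cvg_expr R b; rewrite ger0_norm ?(ltW b0)// => /(_ b1)/cvgr0Pnorm_le/(_ 4^-1).
  rewrite invr_gt0 => /(_ (ltr0n _ 4))[q _ /(_ q.+1)]/= h; exists q.
  by have := h (leqnSn q); rewrite ger0_norm// exprn_ge0// ltW.
have [G G0 hG] := @conditional_tail R H eps0 H01 eps01 q.
have [C2 C20 hC2] := @two_point_probability R H eps0 H01 eps01 M 0.
pose K1 : R := 3 / 2 / m ^+ 2.
have K10 : 0 < K1 by rewrite !divr_gt0 ?exprn_gt0// mulr_gt0.
pose A1 : R := 2 * (A0 + K1 * M) + 2 / (1 - b) + 1.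
have ib : 0 < 1 - b by rewrite subr_gt0.
have A10 : 0 < A1.
  apply: ltr_wpDl => //; apply: addr_ge0; last by apply: divr_ge0 => //; exact: ltW.
  apply: mulr_ge0 => //; apply: addr_ge0 => //; apply: mulr_ge0 => //; exact: ltW.
exists (C2 * A1 + 2 * G * A1), (2^-1 / K1); split.
- by rewrite addr_gt0 ?mulr_gt0.
- by rewrite divr_gt0.
move=> disp T P X gX a delta y /andP[ea a1] /andP[d0 de] dr yM.
have a01 : eps0 <= a <= 1 by rewrite ea a1.
have a0 : 0 < a by apply: lt_le_trans ea; case/andP: eps01.
set r := delta `^ H in dr *.
have r0 : 0 < r by exact: powR_gt0.
have t01 n j : (j <= 2 ^ n)%N -> 0 <= dyadic a delta n j <= 1.
  move=> jn; rewrite /dyadic -mulrA.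
  have h1 : 0 <= j%:R / 2 ^+ n :> R by rewrite divr_ge0 ?exprn_ge0.
  have h2 : j%:R / 2 ^+ n <= 1 :> R.
    by rewrite ler_pdivrMr ?exprn_gt0// mul1r -natrX ler_nat.
  move: (_ / _) h1 h2 => z z0 z1; apply/andP; split; nra.
have ta n j : (j <= 2 ^ n)%N -> `|dyadic a delta n j - a| <= delta.
  move=> jn; rewrite /dyadic -mulrA addrAC subrr sub0r normrN.
  have h1 : 0 <= j%:R / 2 ^+ n :> R by rewrite divr_ge0 ?exprn_ge0.
  have h2 : j%:R / 2 ^+ n <= 1 :> R.
    by rewrite ler_pdivrMr ?exprn_gt0// mul1r -natrX ler_nat.
  rewrite ger0_norm; last by rewrite mulr_ge0// ltW.
  by rewrite ler_piMr// ltW.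
have tt n j : `|dyadic a delta n j.+1 - dyadic a delta n j| `^ H = r * (b ^+ n) ^+ 2.
  have -> : dyadic a delta n j.+1 - dyadic a delta n j = - (delta * (2 ^+ n)^-1).
    by rewrite /dyadic -natr1; field; rewrite expf_neq0.
  rewrite normrN ger0_norm; last by rewrite mulr_ge0 ?invr_ge0 ?exprn_ge0// ltW.
  rewrite powRM ?(ltW d0) ?invr_ge0 ?exprn_ge0// -/r; congr (_ * _).
  rewrite -exprM mulnC exprM b2E -powR_invn// -powRrM -powR_mulrn ?powR_ge0// -powRrM.
  by congr (_ `^ _); ring.
pose D n j w := residual_increment H X a (dyadic a delta n j.+1) (dyadic a delta n j) w.
pose B n j := [set w | `|X a w - y| <= (A1 / b ^+ n) * `|D n j w| /\ (b ^+ n)^-1 * (r * (b ^+ n) ^+ 2) < `|D n j w|].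
have bn0 n : 0 < b ^+ n by rewrite exprn_gt0.
have mB n j : measurable (B n j).
  have -> : B n j = [set w | `|X a w - y| <= (A1 / b ^+ n) * `|D n j w|] `&`
    [set w | (b ^+ n)^-1 * (r * (b ^+ n) ^+ 2) < `|D n j w|] by [].
  have mD : measurable_fun [set: T] (fun w => `|D n j w|).
    by apply: measurableT_comp => //; exact: measurable_residual_increment.
  apply: measurableI; [apply: measurable_le_set => //|apply: measurable_lt_set => //].
    by apply: measurableT_comp => //; exact: measurable_funB.
  exact: measurable_funM.
have PB n j : (j < 2 ^ n)%N -> (P (B n j) <= (G * A1 * r * (4 ^+ n)^-1)%:E)%E.
  move=> jn.
  have rb : 0 < r * (b ^+ n) ^+ 2 by rewrite mulr_gt0// exprn_gt0.
  apply: (le_trans (hG _ _ _ _ gX a _ _ y _ (A1 / b ^+ n) (b ^+ n)^-1 a01 (t01 _ _ jn)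
    (t01 _ _ (ltnW jn)) rb _ _ _)).
  - by rewrite tt.
  - by rewrite divr_gt0.
  - by rewrite invr_gt0.
  rewrite lee_fin.
  have -> : G * (A1 / b ^+ n) * (r * (b ^+ n) ^+ 2) / (b ^+ n)^-1 ^+ q =
     G * A1 * r * (b ^+ q.+1) ^+ n.
    rewrite exprVn invrK -[in RHS]exprM mulnC exprM [b ^+ n ^+ q.+1]exprS.
    by field; rewrite gt_eqF.
  apply: ler_wpM2l; first by rewrite !mulr_ge0// ltW.
  rewrite -exprVn lerXn2r ?nnegrE ?exprn_ge0 ?(ltW b0)//.
pose BB n := [set w | exists2 j, (j < 2 ^ n)%N & B n j w].
have mBB n : measurable (BB n) by exact: measurable_exists_lt.
have PBB n : (P (BB n) <= (2 * G * A1 * r / (2 ^ n.+1)%:R)%:E)%E.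
  apply: (le_trans (measure_exists_lt_le (mB n) (PB n))).
  rewrite lee_fin le_eqVlt; apply/orP; left; apply/eqP.
  rewrite !natrX exprS (_ : 4 = 2 * 2 :> R); last by ring.
  by rewrite exprMn; field; rewrite expf_neq0.
pose E0 := [set w | `|X a w - y| <= A1 * r].
have mE0 : measurable E0.
  by apply: measurable_le_set => //; apply: measurableT_comp => //; exact: measurable_funB.
have PE0 : (P E0 <= (C2 * A1 * r)%:E)%E.
  have A1r : 0 < A1 * r by rewrite mulr_gt0.
  have Ue : A1 * r = `|a - a| `^ H + A1 * r by rewrite subrr normr0 powR0 ?add0r ?gt_eqF.
  have := hC2 _ _ _ _ gX a a (A1 * r) y y _ a01 a01 A1r yM Ue.
  rewrite (_ : [set w | _] = E0); last by apply/seteqP; split => w //= [].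
  move=> /le_trans; apply; rewrite lee_fin subrr normr0 addr0 expr0 mulr1 expr1.
  rewrite le_eqVlt; apply/orP; left; apply/eqP.
  by field; rewrite !gt_eqF.
have mdist t : measurable_fun [set: T] (fun w => `|X t w - y|).
  by apply: measurableT_comp => //; exact: measurable_funB.
apply: measure_nondecreasing_bigcup_le => [n|n k nk|N].
- by apply: measurable_exists_lt => j; exact: measurable_le_set.
- move=> w [j jn Xj]; exists (2 ^ (k - n) * j)%N.
    by rewrite ltnS -{2}(subnK nk) expnD leq_mul2l -ltnS jn orbT.
  have dy i : dyadic a delta (i + n) (2 ^ i * j) = dyadic a delta n j.
    elim: i => [|i IH]; first by rewrite mul1n.
    by rewrite addSn expnS -mulnA mul2n dyadic_double.
  by rewrite -{1}(subnK nk) dy.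
have mBU : measurable (\bigcup_n BB n) by exact: bigcup_measurable.
apply: (@le_trans _ _ (P (E0 `|` \bigcup_n BB n))).
  apply: le_measure; rewrite ?inE.
  - by apply: measurable_exists_lt => j; exact: measurable_le_set.
  - exact: measurableU.
  move=> w [j jN Xj].
  pose W t := X t w - regression H a t * X a w.
  have Wa : W a = 0.
    by rewrite /W /regression divff ?mul1r ?subrr// gt_eqF// (cov_diag_gt0 H01 eps01 ea).
  (* [Mx] is a common bound for the normalized residual increments *)
  have chain Mx : r <= Mx ->
      (forall n i, (n <= N)%N -> (i < 2 ^ n)%N -> `|D n i w| <= Mx * b ^+ n) ->
      `|X a w - y| <= A1 * Mx.
    move=> rMx DMx.
    have Mx0 : 0 <= Mx by apply: le_trans rMx; exact: ltW.
    have Wj : `|W (dyadic a delta N j)| <= Mx / (1 - b).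
      apply: (@dyadic_chaining _ (fun n j => W (dyadic a delta n j)) Mx b N) => //.
      - by rewrite (ltW b0).
      - by rewrite /dyadic mulr0 mul0r subr0.
      - by move=> n i; rewrite dyadic_double.
    set t := dyadic a delta N j in Wj Xj.
    have cK : `|1 - regression H a t| <= K1 * r.
      apply: (le_trans (regression_dist H01 eps01 a01 (t01 _ _ _))) => //.
      rewrite -/m -/K1; apply: ler_wpM2l; first exact: ltW.
      apply: ge0_ler_powR; rewrite ?nnegrE ?(ltW H0)// ?(ltW d0)//.
      exact: ta.
    set c := regression H a t in cK.
    have K1r : K1 * r <= 2^-1 by rewrite mulrC -ler_pdivlMr.
    have c2 : 2^-1 <= c by move: cK; rewrite ler_norml; lra.
    have E : c * (X a w - y) = (X t w - y) - W t + (1 - c) * y by rewrite /W -/c; ring.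
    have hE : `|c * (X a w - y)| <= A0 * r + Mx / (1 - b) + K1 * r * M.
      rewrite E; apply: (le_trans (ler_normD _ _)); apply: lerD.
        by apply: (le_trans (ler_normB _ _)); exact: lerD.
      by rewrite normrM; apply: ler_pM.
    have h1 : A0 * r <= A0 * Mx by exact: ler_wpM2l.
    have h2 : K1 * r * M <= K1 * M * Mx.
      rewrite mulrAC; apply: ler_wpM2l => //; apply: mulr_ge0 => //; exact: ltW.
    have h3 : 2^-1 * `|X a w - y| <= `|c * (X a w - y)|.
      by rewrite normrM; apply: ler_wpM2r => //; rewrite (le_trans c2)// ler_norm.
    have -> : A1 * Mx = 2 * (A0 * Mx + K1 * M * Mx + Mx / (1 - b)) + Mx by rewrite /A1; ring.
    lra.
  have [allD|] := pselect (forall n i, (n <= N)%N -> (i < 2 ^ n)%N -> `|D n i w| <= r * b ^+ n).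
    by left; rewrite /E0 /=; exact: chain.
  move=> /existsNP[n1 /existsNP[i1 /not_implyP[n1N /not_implyP[i1n /negP]]]].
  rewrite -ltNge => D1.
  pose Fm (p : 'I_N.+1 * 'I_(2 ^ N)) : R := if (p.2 < 2 ^ p.1)%N then `|D p.1 p.2 w| / b ^+ p.1 else 0.
  have leN n i : (n <= N)%N -> (i < 2 ^ n)%N -> (i < 2 ^ N)%N.
    by move=> nN /leq_trans; apply; rewrite leq_exp2l.
  have n1N' : (n1 < N.+1)%N by [].
  pose p1 := (Ordinal n1N', Ordinal (leN _ _ n1N i1n)).
  have [/= p _ pmax] := @arg_maxP _ _ _ p1 xpredT Fm isT.
  have Fp1 : r < Fm p.
    apply: (@lt_le_trans _ _ (Fm p1)); last exact: pmax.
    by rewrite /Fm /= i1n ltr_pdivlMr.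
  right; exists (nat_of_ord p.1) => //; exists (nat_of_ord p.2).
    by move: Fp1; rewrite /Fm; case: ifP => // _; rewrite ltNge (ltW r0).
  have FpE : Fm p = `|D p.1 p.2 w| / b ^+ p.1.
    by move: Fp1; rewrite /Fm; case: ifP => // _; rewrite ltNge (ltW r0).
  split.
    rewrite (_ : A1 / _ * _ = A1 * Fm p); last by rewrite FpE; ring.
    apply: chain => [|n i nN jn]; first exact: ltW.
    have nN' : (n < N.+1)%N by [].
    have := pmax (Ordinal nN', Ordinal (leN _ _ nN jn)) isT.
    by rewrite {1}/Fm /= jn ler_pdivrMr.
  move: Fp1; rewrite FpE ltr_pdivlMr//.
  by rewrite (_ : _^-1 * _ = r * b ^+ p.1)//; field; rewrite gt_eqF.
apply: (le_trans (measureU2 _ mE0 mBU)).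
rewrite mulrDl EFinD; apply: leeD => //.
apply: (@measure_bigcup_le _ _ _ P _ BB) => //.
by rewrite !mulr_ge0// ltW.
Qed.

End small_ball.

(** * Suslin sets and capacitability *)

Section souslin_sets.
Context {T : topologicalType}.

(** [E] is the projection of a closed subset of [T * (nat -> nat)]: the set at
    rank [n] depends on the first [n] values of the sequence. *)
Definition souslin (E : set T) := exists C : nat -> (nat -> nat) -> set T,
  [/\ forall n s, closed (C n s),
      forall n s s', (forall i, (i < n)%N -> s i = s' i) -> C n s = C n s' &
      E = [set t | exists s, forall n, C n s t]].

Lemma closed_souslin (A : set T) : closed A -> souslin A.
Proof.
move=> cA; exists (fun _ _ => A); split => //.
by apply/seteqP; split => t; [exists id|move=> [s /(_ 0%N)]].
Qed.

Lemma bigcup_souslin (F : (set T)^nat) : (forall k, souslin (F k)) -> souslin (\bigcup_k F k).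
Proof.
move=> /choice[C hC].
exists (fun n s => if n is n'.+1 then C (s 0%N) n' (fun i => s i.+1) else setT); split.
- move=> [|n] s; first exact: closedT.
  by have [+ _ _] := hC (s 0%N); exact.
- move=> [|n] s s' ss'//; rewrite -ss'//.
  by have [_ h _] := hC (s 0%N); apply: h => i ik; apply: ss'.
- apply/seteqP; split => t /=.
    move=> [k _]; have [_ _ ->] := hC k => -[s Cs].
    by exists (fun i => if i is i'.+1 then s i' else k) => -[|n].
  move=> [s Cs]; exists (s 0%N) => //.
  have [_ _ ->] := hC (s 0%N).
  by exists (fun i => s i.+1) => n; have := Cs n.+1.
Qed.

(** A sequence codes a sequence of sequences through an enumeration of pairs. *)
Lemma bigcap_souslin (F : (set T)^nat) : (forall k, souslin (F k)) -> souslin (\bigcap_k F k).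
Proof.
move=> /choice[C hC].
pose sub (s : nat -> nat) (k i : nat) : nat := s (pickle (k, i)).
exists (fun n s => \bigcap_(km in [set km : nat * nat |
   forall i : nat, (i < km.2)%N -> (pickle (km.1, i) < n)%N]) C km.1 km.2 (sub s km.1)); split.
- move=> n s; apply: closed_bigI => -[k m] _ /=.
  by have [+ _ _] := hC k; exact.
- move=> n s s' ss'; apply: eq_bigcapr => -[k m] /= km.
  have [_ h _] := hC k; apply: h => i im.
  by rewrite /sub ss'// km.
- apply/seteqP; split => t /=.
    move=> Ft.
    have /choice[s hs] : forall k, exists s : nat -> nat, forall n, C k n s t.
      by move=> k; have [_ _ FE] := hC k; have := Ft k I; rewrite FE.
    exists (fun n => if unpickle n is Some (k, i) then s k i else 0%N).
    move=> n [k m] /= _; have [_ h _] := hC k.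
    by rewrite (h _ _ (s k))// => i _; rewrite /sub pickleK.
  move=> [s hs] k _; have [_ _ ->] := hC k; exists (sub s k) => m.
  pose n := (\max_(i < m) (pickle (k, nat_of_ord i))).+1.
  apply: (hs n (k, m)) => i /= im.
  by rewrite ltnS (@leq_bigmax _ (fun j : 'I_m => pickle (k, nat_of_ord j)) (Ordinal im)).
Qed.

End souslin_sets.

Section borel_souslin.
Context {R : realType}.

Lemma souslin_itv_infty_o (x : R) : souslin (`]-oo, x[%classic : set R).
Proof.
have -> : `]-oo, x[%classic = \bigcup_n (`]-oo, x - n.+1%:R^-1]%classic : set R).
  apply/seteqP; split => y /=; rewrite in_itv /=.
    move=> yx; have xy0 : 0 < x - y by rewrite subr_gt0.
    exists (Num.truncn (x - y)^-1) => //=; rewrite in_itv /=.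
    rewrite lerBrDr -lerBrDl invf_ple ?posrE ?ltr0n//.
    by rewrite ltW// truncnS_gt.
  by move=> [n _] /=; rewrite in_itv /= => /le_lt_trans; apply; rewrite ltrBlDr ltrDl invr_gt0.
by apply: bigcup_souslin => n; apply: closed_souslin; exact: closed_le.
Qed.

(** The sets that are Suslin together with their complement form a sigma-algebra. *)
Lemma borel_souslin (E : set (measurableTypeR R)) : measurable E -> souslin (E : set R).
Proof.
pose G : set (set R) := [set A | souslin A /\ souslin (~` A)].
suff h : <<s @RGenCInfty.G R >> `<=` G.
  have e : @measurable _ (measurableTypeR R) E = <<s @RGenCInfty.G R >> E :=
    congr1 (fun m : set (set R) => m E) (@RGenCInfty.measurableE R).
  by rewrite e => /h[].
apply: smallest_sub; last first.
  move=> A [x ->]; split.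
    by apply: closed_souslin; exact: interval_closed.
  by rewrite setCitvr; exact: souslin_itv_infty_o.
split.
- split; first by apply: closed_souslin; exact: closed0.
  by rewrite setC0; apply: closed_souslin; exact: closedT.
- by move=> A [A1 A2]; rewrite setTD; split => //; rewrite setCK.
- move=> A hA; split; first by apply: bigcup_souslin => k; have [] := hA k.
  by rewrite setC_bigcup; apply: bigcap_souslin => k; have [] := hA k.
Qed.

End borel_souslin.

Section measurable_hull.
Context {R : realType} {d : measure_display} {T : measurableType d}.
Variable mu : {finite_measure set T -> \bar R}.

Lemma measurable_hull_exists (A : set T) : exists M, [/\ measurable M, A `<=` M &
  forall M', measurable M' -> A `<=` M' -> (mu M <= mu M')%E].
Proof.
pose V : set R := [set x | exists M, [/\ measurable M, A `<=` M & x = fine (mu M)]].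
have V0 : V !=set0 by exists (fine (mu setT)), setT.
have lV : has_lbound V by exists 0 => _ [M [_ _ ->]]; exact: fine_ge0.
have h (n : nat) : exists M, [/\ measurable M, A `<=` M & fine (mu M) <= inf V + n.+1%:R^-1].
  have n0 : 0 < n.+1%:R^-1 :> R by rewrite invr_gt0.
  have [_ [M [mM AM ->]] Mlt] := inf_adherent n0 (conj V0 lV).
  by exists M; split => //; exact: ltW.
have [M hM] := choice h.
have mI : measurable (\bigcap_n M n) by apply: bigcap_measurable => // n _; have [] := hM n.
exists (\bigcap_n M n); split => //.
  by move=> w Aw n _; have [_ + _] := hM n; exact.
move=> M' mM' AM'.
rewrite -(fineK (fin_num_measure mu _ mI)) -(fineK (fin_num_measure mu _ mM')) lee_fin.
have infM' : inf V <= fine (mu M') by apply: ge_inf => //; exists M'.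
apply: (le_trans _ infM'); apply/ler_addgt0Pr => e e0.
pose n := Num.truncn e^-1.
have [mMn _ hn] := hM n.
apply: (@le_trans _ _ (fine (mu (M n)))).
  apply: fine_le; [exact: fin_num_measure|exact: fin_num_measure|].
  by apply: le_measure; rewrite ?inE//; exact: bigcap_inf.
apply: (le_trans hn); rewrite lerD2l invf_ple ?posrE//.
by rewrite ltW// truncnS_gt.
Qed.

Definition measurable_hull (A : set T) : set T := sval (cid (measurable_hull_exists A)).

Lemma measurable_measurable_hull A : measurable (measurable_hull A).
Proof. by rewrite /measurable_hull; case: cid => M []. Qed.

Lemma sub_measurable_hull A : A `<=` measurable_hull A.
Proof. by rewrite /measurable_hull; case: cid => M []. Qed.

Lemma measurable_hull_le A M : measurable M -> A `<=` M -> (mu (measurable_hull A) <= mu M)%E.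
Proof. by rewrite /measurable_hull; case: cid => M0 [] ? ? h /= mM AM; exact: h. Qed.

Definition outer A := mu (measurable_hull A).

(** Replacing each hull by the intersection of the later ones makes the hulls increase. *)
Lemma outer_continuous (F : (set T)^nat) (c : \bar R) :
  {homo F : n k / (n <= k)%N >-> n `<=` k} ->
  (c < outer (\bigcup_n F n))%E -> exists n, (c < outer (F n))%E.
Proof.
move=> ndF cF; apply: contrapT => /forallNP Fc; move: cF; apply/negP; rewrite -leNgt.
pose M n := \bigcap_(k in [set k | (n <= k)%N]) measurable_hull (F k).
have mM n : measurable (M n).
  by apply: bigcap_measurableType => k _; exact: measurable_measurable_hull.
have FM : \bigcup_n F n `<=` \bigcup_n M n.
  move=> w [n _ Fw]; exists n => // k /= nk; apply: sub_measurable_hull.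
  exact: ndF Fw.
apply: (le_trans (measurable_hull_le (bigcup_measurable (fun n _ => mM n)) FM)).
apply: measure_nondecreasing_bigcup_le => //.
  by move=> n k nk w Mw i /= ki; apply: Mw => /=; exact: leq_trans ki.
move=> n; apply: (@le_trans _ _ (outer (F n))).
  apply: le_measure; rewrite ?inE//; first exact: measurable_measurable_hull.
  by move=> w; apply => /=.
by have /negP := Fc n; rewrite -leNgt.
Qed.

End measurable_hull.

Section souslin_trees.
Context {T : topologicalType}.
Variable C : nat -> (nat -> nat) -> set T.
Hypothesis closedC : forall n s, closed (C n s).
Hypothesis localC : forall n s s', (forall i, (i < n)%N -> s i = s' i) -> C n s = C n s'.
Variable b : nat -> nat.

Definition bounded_stage n : set T :=
  [set t | exists s, (forall i, (i < n)%N -> (s i <= b i)%N) /\ forall m, (m <= n)%N -> C m s t].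

Let upd (tau : nat -> nat) (n j i : nat) : nat := if i == n then j else tau i.

(** The first [n] entries are prescribed and the next [k] are bounded; this generality is
    for the induction on [k]. *)
Let stage_from n k (tau : nat -> nat) : set T :=
  [set t | exists s, [/\ forall i, (i < n)%N -> s i = tau i,
     forall i, (n <= i < n + k)%N -> (s i <= b i)%N &
     forall m, (m <= n + k)%N -> C m s t]].

Let closed_stage_from k : forall n tau, closed (stage_from n k tau).
Proof.
elim: k => [|k IH] n tau.
  have -> : stage_from n 0 tau = \bigcap_(m in [set m | (m <= n)%N]) C m tau.
    apply/seteqP; split => t /=.
      move=> [s [st _ Cs]] m /= mn; rewrite -(@localC _ s); first by apply: Cs; rewrite addn0.
      by move=> i im; apply: st; exact: leq_trans mn.
    move=> Ct; exists tau; split => // [i|m]; last by rewrite addn0; exact: Ct.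
    by rewrite addn0 => /andP[/leq_ltn_trans h /h]; rewrite ltnn.
  by apply: closed_bigI => m _; exact: closedC.
have -> : stage_from n k.+1 tau = \bigcup_(j in `I_(b n).+1) stage_from n.+1 k (upd tau n j).
  apply/seteqP; split => t /=.
    move=> [s [st sb Cs]]; exists (s n) => /=.
      by rewrite ltnS; apply: sb; rewrite leqnn addnS ltnS leq_addr.
    exists s; split.
    + move=> i; rewrite ltnS leq_eqVlt /upd => /predU1P[->|iN]; first by rewrite eqxx.
      by rewrite ltn_eqF// st.
    + move=> i /andP[ni ik]; apply: sb; rewrite (ltnW ni)/=.
      by rewrite addnS -addSn.
    + by move=> m mn; apply: Cs; rewrite addnS -addSn.
  move=> [j /= jb [s [st sb Cs]]]; exists s; split.
  + move=> i iN; rewrite st; last exact: ltnW.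
    by rewrite /upd ltn_eqF.
  + move=> i /andP[]; rewrite leq_eqVlt => /predU1P[<- _|ni ik].
      by rewrite st// /upd eqxx -ltnS.
    by apply: sb; rewrite ni /= addSn -addnS.
  + by move=> m mn; apply: Cs; rewrite addSn -addnS.
apply: closed_bigcup; first exact: finite_II.
by move=> j _; exact: IH.
Qed.

(** Only finitely many prefixes of length [n] are below [b]. *)
Lemma closed_bounded_stage n : closed (bounded_stage n).
Proof.
have -> : bounded_stage n = stage_from 0 n (fun=> 0%N).
  apply/seteqP; split => t /=.
    by move=> [s [sb Cs]]; exists s; split => // i /=; exact: sb.
  by move=> [s [_ sb Cs]]; exists s; split => // i iN; apply: sb.
exact: closed_stage_from.
Qed.

Lemma bounded_stage_nonincreasing n k : (n <= k)%N -> bounded_stage k `<=` bounded_stage n.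
Proof.
move=> nk t [s [sb Cs]]; exists s; split => i iN; [apply: sb|apply: Cs]; exact: leq_trans nk.
Qed.

(** Konig's lemma: a point of all the stages has a branch below [b]. *)
Lemma bigcap_bounded_stage t : (forall n, bounded_stage n t) -> exists s, forall n, C n s t.
Proof.
move=> st.
pose Q n tau := forall N, exists s, [/\ forall i, (i < n)%N -> s i = tau i,
     forall i, (i < N)%N -> (s i <= b i)%N & forall m, (m <= N)%N -> C m s t].
have Q0 : Q 0%N (fun=> 0%N) by move=> N; have [s [sb Cs]] := st N; exists s.
have step n tau : Q n tau -> exists j, Q n.+1 (upd tau n j).
  move=> Qn; apply: contrapT => /forallNP nQ.
  have /choice[N hN] : forall j, exists N, ~ exists s, [/\ forall i, (i < n.+1)%N -> s i = upd tau n j i,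
     forall i, (i < N)%N -> (s i <= b i)%N & forall m, (m <= N)%N -> C m s t].
    by move=> j; exact/existsNP/nQ.
  pose NN := (n.+1 + \max_(j < (b n).+1) N j)%N.
  have [s [s1 s2 s3]] := Qn NN.
  have snb : (s n < (b n).+1)%N by rewrite ltnS s2// /NN addSn ltnS leq_addr.
  have NNN : (N (s n) <= NN)%N.
    by rewrite (leq_trans _ (leq_addl _ _))// (@leq_bigmax _ (fun j : 'I_(b n).+1 => N j) (Ordinal snb)).
  apply: (hN (s n)); exists s; split.
  - move=> i; rewrite ltnS leq_eqVlt /upd => /predU1P[->|iN]; first by rewrite eqxx.
    by rewrite ltn_eqF// s1.
  - by move=> i iN; apply: s2; exact: leq_trans NNN.
  - by move=> m mN; apply: s3; exact: leq_trans NNN.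
have /choice[f hf] : forall p : nat * (nat -> nat), exists j, Q p.1 p.2 -> Q p.1.+1 (upd p.2 p.1 j).
  move=> [n tau] /=.
  have [/step[j hj]|nQ] := pselect (Q n tau); first by exists j.
  by exists 0%N.
pose tau := fix tau n := if n is k.+1 then upd (tau k) k (f (k, tau k)) else (fun=> 0%N).
have Qtau n : Q n (tau n).
  by elim: n => [//|n IH]; exact: (hf (n, tau n)).
have tauE n k i : (i < n)%N -> (n <= k)%N -> tau k i = tau n i.
  move=> iN; elim: k => [|k IH]; first by rewrite leqn0 => /eqP->.
  rewrite leq_eqVlt => /predU1P[->//|nk]; rewrite /= /upd ltn_eqF ?IH//.
  exact: leq_trans iN _.
exists (fun i => tau i.+1 i) => n.
have [s [s1 _ s3]] := Qtau n n.
rewrite (@localC _ _ s); first exact: s3.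
by move=> i iN; rewrite s1// (tauE i.+1).
Qed.

End souslin_trees.

Section capacitability.
Context {R : realType} {d : measure_display} {T : measurableType d}.
Variables (mu : {finite_measure set T -> \bar R}) (Z : T -> set R) (lo hi : R).
Let J : set R := `[lo, hi]%classic.

Definition hitting (S : set R) : set T := [set w | exists2 t, S t & Z w t].

Hypothesis mK : forall K, compact K -> K `<=` J -> measurable (hitting K).
Hypothesis capK : forall K : (set R)^nat, (forall n, compact (K n)) -> (forall n, K n `<=` J) ->
  {homo K : n k / (n <= k)%N >-> k `<=` n} ->
  \bigcap_n hitting (K n) `<=` hitting (\bigcap_n K n).

Lemma hitting_sub S S' : S `<=` S' -> hitting S `<=` hitting S'.
Proof. by move=> SS' w [t St Zt]; exists t => //; exact: SS'. Qed.

(** Choquet's capacitability theorem for hitting probabilities. The entries of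
    the sequences coding the points of [E] are bounded one after the other while
    keeping the outer measure above [c]; the bounded sequences give a compact set. *)
Theorem hitting_capacitability (E : set R) (c : \bar R) : souslin E -> E `<=` J ->
  (c < outer mu (hitting E))%E ->
  exists K, [/\ compact K, K `<=` E & (c <= mu (hitting K))%E].
Proof.
move=> [C [closedC localC EE]] EJ cE.
pose Es (l : seq nat) : set R :=
  [set t | exists s, (forall i, (i < size l)%N -> (s i <= nth 0%N l i)%N) /\ forall n, C n s t].
have EsE l : Es l `<=` E by move=> t [s [_ Cs]]; rewrite EE; exists s.
have step l : (c < outer mu (hitting (Es l)))%E -> exists k, (c < outer mu (hitting (Es (rcons l k))))%E.
  have -> : hitting (Es l) = \bigcup_k hitting (Es (rcons l k)).
    apply/seteqP; split => w.
      move=> [t [s [sl Cs]] Zt]; exists (s (size l)) => //; exists t => //.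
      exists s; split => // i; rewrite size_rcons ltnS leq_eqVlt nth_rcons => /predU1P[->|il].
        by rewrite ltnn eqxx.
      by rewrite il; exact: sl.
    move=> [k _ [t [s [sl Cs]] Zt]]; exists t => //; exists s; split => // i il.
    have := sl i; rewrite size_rcons nth_rcons il; apply; exact: ltnW.
  apply: outer_continuous => n k nk; apply: hitting_sub => t [s [sl Cs]].
  exists s; split => // i; rewrite size_rcons nth_rcons => il.
  have := sl i; rewrite size_rcons nth_rcons => /(_ il).
  case: ifP => // _; case: ifP => // _ /leq_trans; exact.
have /choice[f hf] : forall l, exists k, (c < outer mu (hitting (Es l)))%E ->
    (c < outer mu (hitting (Es (rcons l k))))%E.
  move=> l; have [/step[k hk]|h] := pselect (c < outer mu (hitting (Es l)))%E; first by exists k.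
  by exists 0%N.
pose l n := iter n (fun l => rcons l (f l)) [::].
have sl n : size (l n) = n by elim: n => //= n IH; rewrite size_rcons IH.
have cl n : (c < outer mu (hitting (Es (l n))))%E.
  elim: n => [|n IH]; last exact: hf.
  rewrite (_ : Es (l 0%N) = E)//; apply/seteqP; split; first exact: EsE.
  by move=> t; rewrite {1}EE => -[s Cs]; exists s.
pose b i := nth 0%N (l i.+1) i.
have lb n i : (i < n)%N -> nth 0%N (l n) i = b i.
  elim: n => // n IH; rewrite ltnS leq_eqVlt => /predU1P[->//|iN].
  by rewrite /= nth_rcons sl iN IH.
pose K n := J `&` bounded_stage C b n.
have cK n : compact (K n).
  apply: (@subclosed_compact _ _ J); last exact: subIsetl.
    by apply: closedI; [exact: interval_closed|exact: closed_bounded_stage].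
  exact: segment_compact.
have KJ n : K n `<=` J by exact: subIsetl.
have ndK : {homo K : n k / (n <= k)%N >-> k `<=` n}.
  by move=> n k nk; apply: setIS; exact: bounded_stage_nonincreasing.
have cKn n : (c <= mu (hitting (K n)))%E.
  apply: (le_trans (ltW (cl n))); apply: measurable_hull_le; first exact: mK.
  apply: hitting_sub => t Et; split; first exact/EJ/EsE/Et.
  case: Et => s [sln Cs]; exists s; split => // i iN.
  by rewrite -(lb n)// sln// sl.
have KI : compact (\bigcap_n K n).
  apply: (@subclosed_compact _ _ J); last by move=> t /(_ 0%N I)/KJ.
    apply: closed_bigI => n _; apply: compact_closed => //; exact: Rhausdorff.
  exact: segment_compact.
have hitI : hitting (\bigcap_n K n) = \bigcap_n hitting (K n).
  apply/seteqP; split; last exact: capK.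
  by move=> w [t Kt Zt] n _; exists t => //; exact: Kt.
exists (\bigcap_n K n); split => //.
  move=> t Kt; rewrite EE; apply: (@bigcap_bounded_stage _ C localC b) => n.
  by have [] := Kt n I.
have mKn n : measurable (hitting (K n)) by exact: mK.
have mI : measurable (\bigcap_n hitting (K n)) by exact: bigcap_measurableType.
have cv : mu (hitting (K n)) @[n --> \oo] --> mu (\bigcap_n hitting (K n)).
  apply: (@nonincreasing_cvg_mu _ _ _ mu (fun n => hitting (K n))) => //.
    by rewrite -ge0_fin_numE// fin_num_measure.
  by move=> n k nk; apply/subsetPset; apply: hitting_sub; exact: ndK.
rewrite hitI -(cvg_lim _ cv)//; apply: lime_ge.
  by apply/cvg_ex; exists (mu (\bigcap_n hitting (K n))).
by apply: nearW => n; exact: cKn.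
Qed.

End capacitability.

Section capacitability_consequences.
Context {R : realType}.

(** By capacitability, the event contains a measurable event of the same outer measure;
    completeness makes the difference measurable. *)
Lemma hitting_measurable {d} {T : measurableType d} (P : probability T R) (Z : T -> set R)
    (lo hi : R) (E : set (measurableTypeR R)) :
  measure_is_complete P ->
  (forall K, compact K -> K `<=` `[lo, hi] -> measurable (hitting Z K)) ->
  (forall K : (set R)^nat, (forall n, compact (K n)) -> (forall n, K n `<=` `[lo, hi]) ->
    {homo K : n k / (n <= k)%N >-> k `<=` n} ->
    \bigcap_n hitting Z (K n) `<=` hitting Z (\bigcap_n K n)) ->
  measurable E -> E `<=` `[lo, hi] -> measurable (hitting Z E).
Proof.
move=> cP mK capK mE EJ.
have sE := borel_souslin mE.
pose H := hitting Z E; pose M := measurable_hull P H.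
have mM : measurable M by exact: measurable_measurable_hull.
have HM : H `<=` M by exact: sub_measurable_hull.
have h (n : nat) : exists K, [/\ compact K, K `<=` E & (P M - (n.+1%:R^-1)%:E <= P (hitting Z K))%E].
  apply: (hitting_capacitability mK capK sE EJ).
  rewrite /outer -/H -/M lteBlDr// ?fin_num_measure//.
  rewrite -[ltLHS]adde0 lteD2lE ?fin_num_measure// lte_fin invr_gt0//.
have [K hK] := choice h.
pose L := \bigcup_n hitting Z (K n).
have mL : measurable L.
  apply: bigcup_measurable => n _; have [cK KE _] := hK n.
  by apply: mK => //; exact: subset_trans EJ.
have LH : L `<=` H.
  by move=> w [n _]; apply: hitting_sub; have [] := hK n.
have PL : (P M <= P L)%E.
  rewrite -(fineK (fin_num_measure P _ mM)) -(fineK (fin_num_measure P _ mL)) lee_fin.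
  apply/ler_addgt0Pr => e e0.
  pose n := Num.truncn e^-1.
  have mKn : measurable (hitting Z (K n)).
    by have [cK KE _] := hK n; apply: mK => //; exact: subset_trans EJ.
  have hn : fine (P M) - n.+1%:R^-1 <= fine (P (hitting Z (K n))).
    rewrite -lee_fin EFinB !fineK; last 2 first.
    - exact: fin_num_measure.
    - exact: fin_num_measure.
    by have [] := hK n.
  rewrite -lerBlDr; apply: (@le_trans _ _ (fine (P M) - n.+1%:R^-1)).
    by rewrite lerD2l lerN2 invf_ple ?posrE// ltW// truncnS_gt.
  apply: (le_trans hn).
    apply: fine_le; [exact: fin_num_measure|exact: fin_num_measure|].
    by apply: le_measure; rewrite ?inE// => w hw; exists n.
have nul : P.-negligible (M `\` L).
  exists (M `\` L); split => //; first exact: measurableD.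
  rewrite measureD//; last by rewrite -ge0_fin_numE// fin_num_measure.
  rewrite (_ : M `&` L = L); last by apply/setIidr; exact: subset_trans HM.
  have PML : P M = P L.
    apply/eqP; rewrite eq_le PL; apply: le_measure; rewrite ?inE//.
    exact: subset_trans HM.
  transitivity (P L - P L)%E; first by congr (_ - _)%E.
  by rewrite subee// fin_num_measure.
have -> : hitting Z E = L `|` (H `\` L) by rewrite setDUK.
apply: measurableU => //; apply: cP; apply: negligibleS nul.
exact: setSD.
Qed.

(** Capacitability for the random set reduced to the sample point. *)
Lemma compact_subset_positive (nu : {finite_measure set (measurableTypeR R) -> \bar R})
    (lo hi : R) (E : set (measurableTypeR R)) :
  measurable E -> E `<=` `[lo, hi] -> (0 < nu E)%E ->
  exists K : set R, [/\ compact K, K `<=` E & (0 < nu K)%E].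
Proof.
move=> mE EJ E0.
have sE := borel_souslin mE.
pose Z (w : measurableTypeR R) : set R := [set w : R].
have hitE S : hitting Z S = S.
  by apply/seteqP; split => w; [move=> [t St /= tw]; rewrite -tw|move=> Sw; exists w].
have mK (K : set R) : compact K -> K `<=` `[lo, hi] -> @measurable _ (measurableTypeR R) (hitting Z K).
  move=> cK _; rewrite hitE; apply: closed_measurable.
  by apply: compact_closed => //; exact: Rhausdorff.
have capK (K : (set R)^nat) : (forall n, compact (K n)) -> (forall n, K n `<=` `[lo, hi]) ->
    {homo K : n k / (n <= k)%N >-> k `<=` n} ->
    \bigcap_n hitting Z (K n) `<=` hitting Z (\bigcap_n K n).
  move=> _ _ _; rewrite hitE => w h n _; have := h n I; by rewrite hitE.
have [//|K [cK KE Kc]] := @hitting_capacitability _ _ _ nu Z lo hi mK capK E (fine (nu E) / 2)%:E sE EJ.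
  apply: (@lt_le_trans _ _ (nu E)).
    rewrite -[ltRHS](fineK (fin_num_measure nu _ mE)) lte_fin.
    have : 0 < fine (nu E) by rewrite fine_gt0// E0 /= -ge0_fin_numE// fin_num_measure.
    lra.
  rewrite /outer hitE; apply: le_measure; rewrite ?inE//; first exact: measurable_measurable_hull.
  exact: sub_measurable_hull.
exists K; split => //; rewrite hitE in Kc; apply: lt_le_trans Kc.
have : 0 < fine (nu E) by rewrite fine_gt0// E0 /= -ge0_fin_numE// fin_num_measure.
by rewrite lte_fin; lra.
Qed.

End capacitability_consequences.

(** * Measurability of the hitting event *)

Section nets.
Context {R : realType}.

Lemma compact_net (M : ptopologicalType) (K : set M) (V : M -> set M) : compact K ->
  (forall x, nbhs x (V x)) ->
  exists s : seq M, (forall x, x \in s -> K x) /\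
    forall y, K y -> exists2 x, x \in s & V x y.
Proof.
move=> cK nV; move: cK; rewrite compact_cover => /(_ M K (fun x => (V x)^°)).
case.
- by move=> x _; exact: open_interior.
- by move=> x Kx; exists x => //; exact: nV.
- move=> D DK KD; exists (finmap.enum_fset D); split.
    by move=> x xD; have := DK x xD; rewrite inE.
  by move=> y /KD[x xD /interior_subset xy]; exists x.
Qed.

Lemma compact_accumulation (K : set R) (u : nat -> R) : compact K -> (forall n, K (u n)) ->
  exists2 t, K t & forall (e : R) N, 0 < e -> exists2 n, (N <= n)%N & `|u n - t| < e.
Proof.
move=> cK Ku; have [|t [Kt clt]] := cK (u n @[n --> \oo]) _.
  by exists 0%N => // n _; exact: Ku.
exists t => // e N e0.
have [||_ [[n Nn <-]]] := clt (u @` [set n | (N <= n)%N]) (ball t e).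
- by exists N => // n /= Nn; exists n.
- exact: nbhsx_ballx.
- by rewrite /ball /= distrC => h; exists n.
Qed.

Lemma rV_closure_point d (F : set 'rV[R]_d) (x : 'rV[R]_d) : closed F ->
  (forall e, 0 < e -> exists2 y, F y & forall i, `|x 0 i - y 0 i| < e) -> F x.
Proof.
move=> cF h; apply: cF => A /nbhs_ballP[e /= e0 eA].
have [y Fy xy] := h e e0; exists y; split => //; apply: eA; split => // i j.
by rewrite (ord1 i); exact: xy.
Qed.

End nets.

(** Coordinatewise continuity on [[0, 1]] of the paths indexed by [Om]. *)
Definition continuous_paths {R : realType} {d : nat} {T : Type} (G : T -> R -> 'rV[R]_d)
    (Om : set T) :=
  forall w (t e : R), Om w -> t \in `[0, 1] -> 0 < e ->
  exists2 delta : R, 0 < delta & forall s : R, s \in `[0, 1] -> `|s - t| < delta ->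
    forall i, `|G w s 0 i - G w t 0 i| < e.

Section hitting_events.
Context {R : realType} {d : nat} {disp : measure_display} {T : measurableType disp}.
Variables (P : probability T R) (G : T -> R -> 'rV[R]_d) (Om : set T) (F : set 'rV[R]_d).
Hypothesis mOm : measurable Om.
Hypothesis cF : compact F.
Hypothesis mG : forall (t : R) i, t \in `[0, 1] -> measurable_fun setT (fun w => G w t 0 i).
Hypothesis contG : continuous_paths G Om.

Definition contact w : set R := [set t | [/\ Om w, t \in `[0, 1] & F (G w t)]].

Let clF : closed F.
Proof. by apply: compact_closed => //; exact: norm_hausdorff. Qed.

(** Approximate contact times accumulate in [K], and continuity of the path passes to the
    limit. *)
Lemma contact_of_approximate (K : set R) w : compact K -> K `<=` `[0, 1] -> Om w ->
  (forall e, 0 < e -> exists t y, [/\ K t, F y & forall i, `|G w t 0 i - y 0 i| < e]) ->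
  hitting contact K w.
Proof.
move=> cK KI Omw h.
have /choice[u hu] : forall n : nat, exists t, K t /\ exists2 y, F y &
    forall i, `|G w t 0 i - y 0 i| < n.+1%:R^-1.
  by move=> n; have [|t [y [Kt Fy ty]]] := h n.+1%:R^-1; [by rewrite invr_gt0|exists t; split => //; exists y].
have [t Kt ht] := compact_accumulation cK (fun n => (hu n).1).
have t01 : t \in `[0, 1] by exact: KI.
exists t => //; split => //; apply: rV_closure_point => // e e0.
have e20 : 0 < e / 2 by lra.
have [delta delta0 hd] := contG Omw t01 e20.
have [n nN utd] := ht delta (Num.truncn (e / 2)^-1) delta0.
have [Ku [y Fy uy]] := hu n.
exists y => // i.
rewrite -(subrKA (G w (u n) 0 i)) (le_lt_trans (ler_normD _ _))//.
have h1 : `|G w t 0 i - G w (u n) 0 i| < e / 2.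
  by rewrite distrC; apply: hd => //; exact: KI.
have h2 : `|G w (u n) 0 i - y 0 i| < e / 2.
  apply: (lt_le_trans (uy i)); rewrite invf_ple ?posrE//.
  by apply: (le_trans (ltW (truncnS_gt _))); rewrite ler_nat ltnS.
lra.
Qed.

(** By [contact_of_approximate], contact amounts to approximate contact at every scale,
    which can be tested on finite nets of times and of points. *)
Lemma measurable_contact_compact (K : set R) : compact K -> K `<=` `[0, 1] ->
  measurable (hitting contact K).
Proof.
move=> cK KI.
have inv0 (n : nat) : 0 < n.+1%:R^-1 :> R by rewrite invr_gt0.
have /choice[NK hNK] := fun n : nat => compact_net cK (fun x => nbhsx_ballx x _ (inv0 n)).
have /choice[NF hNF] := fun n : nat => compact_net cF (fun x => nbhsx_ballx x _ (inv0 n)).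
pose A n m := \bigcup_(p in [set` [seq (t, y) | t <- NK m, y <- NF n]])
  \bigcap_(i in [set: 'I_d]) [set w | `|G w p.1 0 i - p.2 0 i| < 2 * n.+1%:R^-1].
have -> : hitting contact K = Om `&` \bigcap_n \bigcup_m A n m.
  apply/seteqP; split => w.
    move=> [t Kt [Omw t01 FG]]; split => // n _.
    have [y yN yb] := (hNF n).2 _ FG.
    have [delta delta0 hd] := contG Omw t01 (inv0 n).
    pose m := Num.truncn delta^-1.
    have [s sN sb] := (hNK m).2 _ Kt.
    exists m => //; exists (s, y) => /=.
      by apply/allpairsP; exists (s, y).
    move=> i _ /=.
    have h1 : `|G w s 0 i - G w t 0 i| < n.+1%:R^-1.
      apply: hd; first exact/KI/(hNK m).1.
      apply: (lt_le_trans sb); rewrite invf_ple ?posrE//.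
      exact: (ltW (truncnS_gt _)).
    have h2 : `|y 0 i - G w t 0 i| < n.+1%:R^-1 by case: yb => _ /(_ 0 i).
    rewrite -(subrKA (G w t 0 i)) (le_lt_trans (ler_normD _ _))//.
    by rewrite (distrC _ (y 0 i)) mulr_natl mulr2n ltrD.
  move=> [Omw Aw]; apply: contact_of_approximate => // e e0.
  pose n := Num.truncn (e / 2)^-1.
  have [m _ [[t y] /= /allpairsP[[t' y'] /= [tN yN [-> ->]]] tyw]] := Aw n I.
  exists t', y'; split; [exact: (hNK m).1|exact: (hNF n).1|] => i.
  apply: (lt_le_trans (tyw i I)).
  have e20 : 0 < e / 2 by lra.
  have : n.+1%:R^-1 <= e / 2.
    by rewrite invf_ple ?posrE//; exact: (ltW (truncnS_gt _)).
  by rewrite ler_pdivlMr// mulrC.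
apply: measurableI => //; apply: bigcap_measurableType => n _.
apply: bigcup_measurable => m _; apply: fin_bigcup_measurable => [|[t y] /=].
  exact: finite_seq.
move=> /allpairsP[[t' y'] /= [tN yN [-> ->]]].
apply: fin_bigcap_measurable; first exact: finite_finset.
move=> i _; apply: measurable_lt_set; last exact: measurable_cst.
apply: measurableT_comp => //; apply: measurable_funB => //.
by apply: mG; exact/KI/(hNK m).1.
Qed.

(** Contact times chosen in each [K n] accumulate at a point of all of them. *)
Lemma contact_bigcap_compact (K : (set R)^nat) : (forall n, compact (K n)) ->
  (forall n, K n `<=` `[0, 1]) -> {homo K : n k / (n <= k)%N >-> k `<=` n} ->
  \bigcap_n hitting contact (K n) `<=` hitting contact (\bigcap_n K n).
Proof.
move=> cK KI ndK w hw.
have /choice[u hu] : forall n : nat, exists t, K n t /\ contact w t.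
  by move=> n; have [t Kt Zt] := hw n I; exists t.
have Omw : Om w by have [_ []] := hu 0%N.
have [t K0t ht] := compact_accumulation (cK 0%N) (fun n => ndK _ _ (leq0n n) _ (hu n).1).
have t01 : t \in `[0, 1] by exact: KI K0t.
have clK n : closed (K n) by apply: compact_closed => //; exact: Rhausdorff.
exists t.
  move=> n _; apply: clK => A /nbhs_ballP[e /= e0 eA].
  have [k nk utk] := ht e n e0.
  exists (u k); split; first exact: (ndK _ _ nk _ (hu k).1).
  by apply: eA; rewrite /ball /= distrC.
split => //; apply: rV_closure_point => // e e0.
have [delta delta0 hd] := contG Omw t01 e0.
have [n _ utd] := ht delta 0%N delta0.
have [_ [_ u01 FGu]] := hu n.
by exists (G w (u n)) => // i; rewrite distrC; exact: hd.
Qed.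

Lemma measurable_contact (E : set (measurableTypeR R)) : measure_is_complete P ->
  measurable E -> E `<=` `[0, 1] -> measurable (hitting contact E).
Proof.
move=> cP mE EI; apply: (hitting_measurable cP _ _ mE EI).
- exact: measurable_contact_compact.
- exact: contact_bigcap_compact.
Qed.

End hitting_events.

Section euclidean_norm.
Context {R : realType} {d : nat}.
Implicit Types x : 'rV[R]_d.

Lemma enorm_ge0 x : 0 <= enorm x.
Proof. exact: sqrtr_ge0. Qed.

Lemma coord_le_enorm x i : `|x 0 i| <= enorm x.
Proof.
rewrite -sqrtr_sqr ler_wsqrtr// (bigD1 i)//= lerDl sumr_ge0// => j _.
exact: sqr_ge0.
Qed.

Lemma enorm_le_coord x (M : R) : 0 <= M -> (forall i, `|x 0 i| <= M) -> enorm x <= d%:R * M.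
Proof.
move=> M0 xM; rewrite -(ger0_norm (mulr_ge0 (ler0n _ d) M0)) -sqrtr_sqr ler_wsqrtr//.
apply: (@le_trans _ _ (\sum_(i < d) M ^+ 2)).
  by apply: ler_sum => i _; rewrite -real_normK ?num_real// lerXn2r ?nnegrE.
rewrite sumr_const card_ord -(mulr_natl (M ^+ 2) d) exprMn ler_wpM2r ?sqr_ge0//.
by rewrite -natrX ler_nat; case: (d) => // n; rewrite -{1}(expn1 n.+1) leq_pexp2l.
Qed.

End euclidean_norm.

Section perturbed_paths.
Context {R : realType} {d : nat} {disp : measure_display} {T : measurableType disp}.
Variables (P : probability T R) (H K : R) (B : 'I_d -> R -> {RV P >-> R}) (f : R -> 'rV[R]_d).
Hypothesis H0 : 0 < H.
Hypothesis cB : {ae P, forall w, forall i, {within `[0, 1], continuous (fun t : R => B i t w)}}.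
Hypothesis hf : holder_continuous H K f.

Definition drifted_path w t : 'rV[R]_d := \row_i B i t w + f t.

Lemma drifted_pathE w t i : drifted_path w t 0 i = B i t w + f t 0 i.
Proof. by rewrite !mxE. Qed.

Lemma measurable_drifted_path t i : measurable_fun setT (fun w => drifted_path w t 0 i).
Proof.
rewrite (_ : (fun _ => _) = (fun w => B i t w + f t 0 i)).
  by apply: measurable_funD => //; exact: measurable_funPTI.
by apply/funext => w; rewrite drifted_pathE.
Qed.

Lemma holder_modulus (e : R) : 0 < e -> exists2 delta : R, 0 < delta &
  forall s t : R, s \in `[0, 1] -> t \in `[0, 1] -> `|s - t| < delta ->
    forall i, `|f s 0 i - f t 0 i| < e.
Proof.
move=> e0; have K0 : 0 < `|K| + 1 by rewrite ltr_pwDr.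
exists ((e / (`|K| + 1)) `^ H^-1); first by rewrite powR_gt0 ?divr_gt0.
move=> s t s01 t01 st i.
have := coord_le_enorm (f s - f t) i; rewrite !mxE => /le_lt_trans; apply.
apply: (le_lt_trans (hf t01 s01)).
have h : `|s - t| `^ H < e / (`|K| + 1).
  have -> : e / (`|K| + 1) = ((e / (`|K| + 1)) `^ H^-1) `^ H.
    by rewrite -powRrM mulVf ?lt0r_neq0// powRr1// ltW// divr_gt0.
  by rewrite gt0_ltr_powR// ?nnegrE ?powR_ge0.
apply: (@le_lt_trans _ _ (`|K| * `|s - t| `^ H)).
  by rewrite ler_wpM2r ?powR_ge0// ler_norm.
move: h; rewrite ltr_pdivlMr// mulrDr mulr1 mulrC => /(le_lt_trans _); apply.
by rewrite lerDl powR_ge0.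
Qed.

Lemma regular_paths : exists Om,
  [/\ measurable Om, P (~` Om) = 0%E & continuous_paths drifted_path Om].
Proof.
have [N [mN PN cN]] := cB.
exists (~` N); split; [exact: measurableC|by rewrite setCK|].
move=> w t e wN t01 e0.
have e20 : 0 < e / 2 by lra.
have cw i : {within `[0, 1], continuous (fun t : R => B i t w)}.
  by apply: contrapT => h; apply: wN; apply: cN => /(_ i).
have near : \forall s \near within `[0, 1] (nbhs t), forall i : 'I_d, `|B i s w - B i t w| < e / 2.
  apply: filter_forall => i.
  have /subspace_continuousP/(_ t t01) h := cw i.
  by move/cvgrPdist_lt : h => /(_ _ e20); apply: filterS => s; rewrite distrC.
have [d1 /= d10 h1] : exists2 d1 : R, 0 < d1 & forall s : R, s \in `[0, 1] -> `|s - t| < d1 ->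
    forall i, `|B i s w - B i t w| < e / 2.
  move: near; rewrite /within /= => /nbhs_ballP[d1 /= d10 h1].
  by exists d1 => // s s01 st; apply: h1 => //; rewrite /ball /= distrC.
have [d2 d20 h2] := holder_modulus e20.
exists (Num.min d1 d2); first by rewrite lt_min d10.
move=> s s01; rewrite lt_min => /andP[st1 st2] i.
rewrite !drifted_pathE opprD addrACA (le_lt_trans (ler_normD _ _))//.
have := h1 _ s01 st1 i; have := h2 _ _ s01 t01 st2 i; lra.
Qed.

Definition hit_event (E : set R) (F : set 'rV[R]_d) :=
  [set w | ((fun t => \row_i B i t w + f t) @` E) `&` F !=set0].

(** On the event of full probability on which the paths are continuous, the hitting
    event is the one to which capacitability applies. *)
Lemma hit_event_contact (E : set (measurableTypeR R)) (F : set 'rV[R]_d) Om :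
  measure_is_complete P -> measurable Om -> P (~` Om) = 0%E ->
  E `<=` `[0, 1] -> measurable (hitting (contact drifted_path Om F) E) ->
  measurable (hit_event E F) /\ P (hit_event E F) = P (hitting (contact drifted_path Om F) E).
Proof.
move=> cP mOm POm EI mC.
have nul : P.-negligible (~` Om) by apply/negligibleP => //; exact: measurableC.
have -> : hit_event E F = hitting (contact drifted_path Om F) E `|` (hit_event E F `&` ~` Om).
  apply/seteqP; split => w.
    move=> hw; have [wO|wO] := pselect (Om w); [left|by right].
    by case: hw => _ [[t Et <-] Ft]; exists t => //; split => //; exact: EI.
  move=> [[t Et [_ _ Ft]]|[]//].
  by exists (drifted_path w t); split => //; exists t.
have nul' : P.-negligible (hit_event E F `&` ~` Om) by apply: negligibleS nul => w [].
have mN : measurable (hit_event E F `&` ~` Om) by exact: cP.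
split; first exact: measurableU.
rewrite measureU//; last first.
  by apply/seteqP; split => // w [[t Et [Omw _ _]] [_]]; apply.
have /negligibleP -> // : P.-negligible (hit_event E F `&` ~` Om) by [].
by rewrite adde0.
Qed.

End perturbed_paths.

(** * Covering bound *)

Section regular_sets.
Context {R : realType}.
Variables (nu : {finite_measure set (measurableTypeR R) -> \bar R}) (beta c : R) (E : set R).

Definition grid_cell (delta : R) (k : nat) : set (measurableTypeR R) :=
  `]1 - k%:R * delta, 1 - k%:R * delta + delta]%classic.

Lemma disjoint_grid_le (delta : R) (n l : nat) : 0 < delta ->
  (\sum_(j < n) nu (grid_cell delta (j + l)) <= nu [set: R])%E.
Proof.
move=> d0.
pose I (j : nat) : set (measurableTypeR R) := grid_cell delta (j + l).
have tI : trivIset setT I.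
  apply: ltn_trivIset => m k km.
  apply/seteqP; split => // x []; rewrite /I /grid_cell /= !in_itv /= => /andP[x1 _] /andP[_ x2].
  have : (k + l)%:R + 1 <= (m + l)%:R :> R.
    by rewrite natr1 ler_nat -addSn leq_add2r.
  rewrite -(ler_pM2r d0); lra.
have mI j : measurable (I j) by exact: measurable_itv.
rewrite -(@measure_bigsetU_ord _ _ _ nu n xpredT (fun j => I j))//.
- by apply: le_measure; rewrite ?inE//; exact: bigsetU_measurable.
- by move=> i j _ _ h; apply/val_inj; apply: tI.
Qed.

Hypothesis c0 : 0 < c.
Hypothesis regE : forall a delta : R, E a -> 0 < delta <= 1 ->
  ((c^-1 * delta `^ beta)%R%:E <= nu `[(a - delta)%R, (a + delta)%R]%classic)%E.

(** The intervals of radius [delta] around points of distinct grid cells overlap at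
    most four times, and each has mass at least [delta `^ beta / c]. *)
Lemma regular_set_cells (delta : R) (n : nat) (S : pred nat) : 0 < delta <= 1 ->
  (forall j, S j -> exists2 e, E e & 1 - j%:R * delta - delta <= e <= 1 - j%:R * delta) ->
  (\sum_(j < n | S j) 1%N)%:R <= 4 * c * fine (nu [set: R]) * delta `^ (- beta).
Proof.
move=> /andP[d0 d1] hS.
have ge j : S j -> ((c^-1 * delta `^ beta)%:E <=
    \sum_(l < 4) nu (grid_cell delta (j + l)))%E.
  move=> /hS[e Ee /andP[e1 e2]].
  apply: (@le_trans _ _ (nu `[(e - delta)%R, (e + delta)%R]%classic)).
    by apply: regE => //; rewrite d0.
  pose I (l : nat) : set (measurableTypeR R) :=
    grid_cell delta (j + l).
  apply: (@le_trans _ _ (nu (\big[setU/set0]_(l < 4) I l))).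
    apply: le_measure; rewrite ?inE//.
      by apply: bigsetU_measurable => l _; exact: measurable_itv.
    move=> x /=; rewrite in_itv /= => /andP[x1 x2].
    rewrite !big_ord_recl big_ord0 /I /grid_cell.
    have [h0|h0] := ltP (1 - j%:R * delta) x; [left|right].
      by rewrite /= /bump /= !natrD !in_itv /= ?addn0; apply/andP; split; lra.
    have [h1|h1] := ltP (1 - j%:R * delta - delta) x; [left|right].
      by rewrite /= /bump /= !natrD !in_itv /=; apply/andP; split; lra.
    have [h2|h2] := ltP (1 - j%:R * delta - 2 * delta) x; [left|right; left];
      by rewrite /= /bump /= !natrD !in_itv /=; apply/andP; split; lra.
  by apply: (Boole_inequality nu (A := I)) => l _; exact: measurable_itv.
have fT : (nu [set: R] \is a fin_num)%E by exact: fin_num_measure.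
rewrite powRN ler_pdivlMr ?powR_gt0//.
suff h : ((\sum_(j < n | S j) 1%N)%:R * (c^-1 * delta `^ beta)) <= 4 * fine (nu [set: R]).
  move: h; rewrite mulrCA mulrC ler_pdivrMr// => h.
  by apply: (le_trans h); rewrite mulrAC.
rewrite -lee_fin [leRHS]EFinM fineK//.
apply: (@le_trans _ _ (\sum_(j < n | S j) \sum_(l < 4)
    nu (grid_cell delta (j + l)))%E).
  rewrite natr_sum mulr_suml -sumEFin; apply: lee_sum => j Sj.
  by rewrite mul1r; exact: ge.
apply: (@le_trans _ _ (\sum_(j < n) \sum_(l < 4)
    nu (grid_cell delta (j + l)))%E).
  by rewrite big_mkcond /=; apply: lee_sum => j _; case: ifP => // _; exact: sume_ge0.
rewrite exchange_big /=.
apply: (@le_trans _ _ (\sum_(l < 4) nu [set: R])%E).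
  by apply: lee_sum => l _; exact: disjoint_grid_le.
by rewrite -(fineK fT) -EFinM sumEFin lee_fin sumr_const card_ord mulr_natl.
Qed.

End regular_sets.

Section ball_estimate.
Context {R : realType} {d : nat}.
Variables (H K eps0 : R) (f0 : 'rV[R]_d) (F : set 'rV[R]_d).
Hypothesis H01 : 0 < H < 1.
Hypothesis eps01 : 0 < eps0 < 1.
Hypothesis cF : compact F.

Lemma compact_coord_bounded : exists2 M : R, 0 <= M & forall y, F y -> forall i, `|y 0 i| <= M.
Proof.
have [s [_ hs]] := compact_net cF (fun x => nbhsx_ballx x _ (@ltr01 R)).
exists (\sum_(x <- s) \sum_i `|x 0 i| + 1); first by rewrite addr_ge0// sumr_ge0// => x _; exact: sumr_ge0.
move=> y /hs[x xs xy] i.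
rewrite -(subrK (x 0 i) (y 0 i)) addrC (le_trans (ler_normD _ _))// lerD//.
  rewrite (big_rem x)//= (bigD1 i)//= -addrA lerDl addr_ge0//; first exact: sumr_ge0.
  by apply: sumr_ge0 => z _; exact: sumr_ge0.
by case: xy => _ /(_ 0 i); rewrite /ball /= distrC => /ltW.
Qed.

Lemma holder_coord_bounded (f : R -> 'rV[R]_d) t i : holder_continuous H K f -> f 0 = f0 ->
  t \in `[0, 1] -> `|f t 0 i| <= enorm f0 + `|K|.
Proof.
move=> hf ff0 t01; rewrite -(subrK (f0 0 i) (f t 0 i)) addrC (le_trans (ler_normD _ _))// lerD//.
  exact: coord_le_enorm.
have := coord_le_enorm (f t - f 0) i; rewrite !mxE ff0 => /le_trans; apply.
have O01 : (0 : R) \in `[0, 1] by rewrite in_itv /= lexx ler01.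
rewrite -{1}ff0 (le_trans (hf _ _ O01 t01))//.
move: t01; rewrite in_itv /= => /andP[t0 t1]; have [H0 H1] := andP H01.
rewrite subr0 ger0_norm// (le_trans (ler_wpM2r (powR_ge0 _ _) (ler_norm K)))//.
by rewrite -[leRHS]mulr1 ler_wpM2l// powR_le1// t0.
Qed.

Lemma dyadic_dense (a delta t e : R) : 0 < delta -> a - delta <= t <= a -> 0 < e ->
  exists n j, (j < (2 ^ n).+1)%N /\ `|dyadic a delta n j - t| < e.
Proof.
move=> d0 /andP[t1 t2] e0.
pose n := Num.truncn (delta / e).
have p0 : 0 < 2 ^+ n :> R by rewrite exprn_gt0.
have dn : delta / 2 ^+ n < e.
  rewrite ltr_pdivrMr// -ltr_pdivrMl// mulrC.
  apply: (lt_le_trans (truncnS_gt _)); rewrite -natrX ler_nat.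
  exact: ltn_expl.
pose j := Num.truncn ((a - t) / delta * 2 ^+ n).
have z0 : 0 <= (a - t) / delta * 2 ^+ n.
  by rewrite mulr_ge0 ?(ltW p0)// divr_ge0 ?(ltW d0)// subr_ge0.
have /andP[j1 j2] := truncn_itv z0.
exists n, j; split.
  rewrite ltnS -(ler_nat R) (le_trans j1)// natrX.
  rewrite -[leRHS]mul1r ler_wpM2r ?(ltW p0)// ler_pdivrMr// mul1r; lra.
rewrite /dyadic (le_lt_trans _ dn)//.
have -> : a - delta * j%:R / 2 ^+ n - t = ((a - t) / delta * 2 ^+ n - j%:R) * (delta / 2 ^+ n).
  by field; rewrite !lt0r_neq0.
have dp0 : 0 <= delta / 2 ^+ n by rewrite divr_ge0// ltW.
rewrite normrM (ger0_norm dp0) ler_piMl//.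
by rewrite ler_norml; move: j1 j2; rewrite -(natr1 (Num.truncn _)) -/j; lra.
Qed.

Lemma process_sigma_algebra_dyadic {disp} {T : measurableType disp} (P : probability T R)
    (X : R -> {RV P >-> R}) (a delta y r : R) : 0 <= a - delta -> a <= 1 -> 0 < delta ->
  process_sigma_algebra X (\bigcup_n [set w | exists2 j, (j < (2 ^ n).+1)%N &
    `|X (dyadic a delta n j) w - y| <= r]).
Proof.
move=> a0 a1 d0; apply: sigma_algebra_bigcup => n.
have -> : [set w | exists2 j, (j < (2 ^ n).+1)%N & `|X (dyadic a delta n j) w - y| <= r] =
    \bigcup_j (if (j < (2 ^ n).+1)%N then X (dyadic a delta n j) @^-1` `[y - r, y + r] else set0).
  apply/seteqP; split => w.
    move=> [j jn h]; exists j => //; rewrite jn /= in_itv /=.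
    by move: h; rewrite ler_norml; lra.
  move=> [j _]; case: ifP => // jn; rewrite /= in_itv /= => h.
  by exists j => //; rewrite ler_norml; lra.
apply: sigma_algebra_bigcup => j.
case: ifP => jn; last exact: sigma_algebra0.
apply: sub_sigma_algebra; exists (dyadic a delta n j), `[y - r, y + r]%classic; split => //.
rewrite in_itv /= /dyadic; apply/andP; split.
  have : delta * j%:R / 2 ^+ n <= delta.
    rewrite ler_pdivrMr ?exprn_gt0// ler_wpM2l// ?(ltW d0)//.
    by rewrite -natrX ler_nat -ltnS.
  lra.
have : 0 <= delta * j%:R / 2 ^+ n by rewrite divr_ge0 ?exprn_ge0// mulr_ge0// ltW.
lra.
Qed.

Lemma process_sigma_algebra_measurable {disp} {T : measurableType disp} (P : probability T R)
    (X : R -> {RV P >-> R}) A : process_sigma_algebra X A -> measurable A.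
Proof.
apply: smallest_sub; first exact: sigma_algebra_measurable.
move=> _ [t [B [_ mB ->]]]; rewrite -[X in measurable X]setTI.
by have := @measurable_funPT _ _ _ _ (X t); apply.
Qed.

Lemma independent_bigcap_le {disp} {T : measurableType disp} (P : probability T R)
    (B : 'I_d -> R -> {RV P >-> R}) (A : 'I_d -> set T) (q : R) :
  independent_processes B -> (forall i, process_sigma_algebra (B i) (A i)) ->
  (forall i, P (A i) <= q%:E)%E -> (P (\bigcap_i A i) <= (q ^+ d)%:E)%E.
Proof.
move=> indB BA Aq; rewrite indB//.
have fA i : (P (A i) \is a fin_num)%E.
  by apply: fin_num_measure; exact: process_sigma_algebra_measurable.
rewrite (eq_bigr (fun i => (fine (P (A i)))%:E)); last by move=> i _; rewrite fineK.
rewrite prodEFin lee_fin.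
apply: (@le_trans _ _ (\prod_(i < d) q)); last by rewrite prodr_const card_ord.
by apply: ler_prod => i _; rewrite fine_ge0//= -lee_fin fineK.
Qed.

Variables (nu : {finite_measure set (measurableTypeR R) -> \bar R}) (beta c : R).
Variable E : set (measurableTypeR R).
Hypothesis c0 : 0 < c.
Hypothesis regE : forall a delta : R, E a -> 0 < delta <= 1 ->
  ((c^-1 * delta `^ beta)%R%:E <= nu `[(a - delta)%R, (a + delta)%R]%classic)%E.
Hypothesis EI : E `<=` `[eps0, 1].

(** The time set is covered by [O(delta `^ - beta)] grid intervals of length
    [delta = r `^ H^-1]; on each of them the drift moves by [O(r)], so that the
    coordinates have to come within [O(r)] of given points, independently. *)
Lemma ball_hitting_le : exists C r0 : R, [/\ 0 < C, 0 < r0 &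
  forall (disp : measure_display) (T : measurableType disp) (P : probability T R)
    (B : 'I_d -> R -> {RV P >-> R}) (f : R -> 'rV[R]_d) (Om : set T),
  independent_processes B -> (forall i, gaussian_fbm H (B i)) ->
  holder_continuous H K f -> f 0 = f0 -> continuous_paths (drifted_path B f) Om ->
  forall (x : 'rV[R]_d) (r : R), 0 <= r <= r0 -> exists S, [/\ measurable S,
    hitting (contact (drifted_path B f) Om (F `&` eball x r)) E `<=` S &
    (P S <= (C * r `^ (d%:R - beta / H))%:E)%E]].
Proof.
have [H0 H1] := andP H01; have [eps00 eps0lt1] := andP eps01.
have [M M0 hM] := compact_coord_bounded.
pose M' := M + 1 + enorm f0 + `|K|.
have M'0 : 0 <= M' by rewrite /M' !addr_ge0// enorm_ge0.
have A00 : 0 <= 2 + `|K| by rewrite addr_ge0.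
have [C0 [r0 [C00 r00 hC]]] := dyadic_small_ball H01 eps01 M'0 A00.
pose C := 4 * c * fine (nu [set: R]) * C0 ^+ d + 1.
have Cge : 0 <= 4 * c * fine (nu [set: R]) * C0 ^+ d.
  by rewrite !mulr_ge0 ?exprn_ge0 ?(ltW c0) ?(ltW C00)// fine_ge0.
exists C, (Num.min (Num.min r0 1) (eps0 `^ H)); split.
- by rewrite /C ltr_wpDl.
- by rewrite !lt_min r00 ltr01 powR_gt0.
move=> disp T P B f Om indB gB hf ff0 contG x r; rewrite !le_min => /and3P[rge /andP[rr0 r1] reps].
have emptyS : ~ ((F `&` eball x r) !=set0) -> exists S, [/\ measurable S,
    hitting (contact (drifted_path B f) Om (F `&` eball x r)) E `<=` S &
    (P S <= (C * r `^ (d%:R - beta / H))%:E)%E].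
  move=> Fx; exists set0; split => //.
    by move=> w [t _ [_ _ FG]]; apply: Fx; exists (drifted_path B f w t).
  by rewrite measure0 lee_fin mulr_ge0 ?powR_ge0// /C ltW// ltr_wpDl.
have [[z [Fz xz]]|/emptyS//] := pselect ((F `&` eball x r) !=set0).
have {emptyS}r_gt0 : 0 < r by exact: (le_lt_trans (enorm_ge0 (z - x)) xz).
have xM i : `|x 0 i| <= M + 1.
  rewrite -(subrK (z 0 i) (x 0 i)) (le_trans (ler_normD _ _))// addrC lerD ?hM//.
  have := coord_le_enorm (z - x) i; rewrite !mxE distrC => /le_trans; apply.
  exact: (ltW (lt_le_trans (xz : enorm (z - x) < r) r1)).
pose delta := r `^ H^-1.
have dH : delta `^ H = r by rewrite -powRrM mulVf ?lt0r_neq0// powRr1.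
have d0 : 0 < delta by exact: powR_gt0.
have deps : delta <= eps0.
  rewrite -[leRHS](powRr1 (ltW eps00)) -(mulfV (lt0r_neq0 H0)) powRrM.
  by rewrite ge0_ler_powR ?nnegrE ?powR_ge0 ?invr_ge0 ?(ltW H0).
pose a (j : nat) := 1 - j%:R * delta.
pose S0 (j : nat) := `[< exists2 e, E e & a j - delta <= e <= a j >].
pose y j i := x 0 i - f (a j) 0 i.
pose A j i := \bigcup_n [set w | exists2 k, (k < (2 ^ n).+1)%N &
  `|B i (dyadic (a j) delta n k) w - y j i| <= (2 + `|K|) * delta `^ H].
pose n := (Num.truncn delta^-1).+1.
have aI j : S0 j -> eps0 <= a j <= 1.
  move=> /asboolP[e /EI]; rewrite /= in_itv /= => /andP[e1 e2] /andP[e3 e4].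
  by rewrite (le_trans e1 e4)/= /a gerDl oppr_le0 mulr_ge0// ltW.
have psaA j i : S0 j -> process_sigma_algebra (B i) (A j i).
  move=> /aI/andP[aj1 aj2]; apply: process_sigma_algebra_dyadic => //; lra.
have mA j : S0 j -> measurable (\bigcap_i A j i).
  move=> Sj; apply: fin_bigcap_measurable; first exact: finite_finset.
  by move=> i _; apply: process_sigma_algebra_measurable (psaA j i Sj).
pose D j := if S0 j then \bigcap_i A j i else set0.
have mD j : measurable (D j) by rewrite /D; case: ifPn => // Sj; exact: mA.
exists (\big[setU/set0]_(j < n) D j); split.
- exact: bigsetU_measurable.
- move=> w [t Et [Omw t01 [FG xG]]]; rewrite -bigcup_mkord.
  have := t01; rewrite in_itv /= => /andP[t0 t1].
  have z0 : 0 <= (1 - t) / delta by rewrite divr_ge0 ?(ltW d0)// subr_ge0.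
  pose j := Num.truncn ((1 - t) / delta).
  have := truncn_itv z0; rewrite -/j => /andP[].
  rewrite ler_pdivlMr// ltr_pdivrMr// => j1 j2.
  have tj : a j - delta <= t <= a j.
    by rewrite /a; move: j1 j2; rewrite -natr1 mulrDl mul1r => j1 j2; apply/andP; split; lra.
  have Sj : S0 j by apply/asboolP; exists t.
  have [aj1 aj2] := andP (aI j Sj).
  exists j => /=.
    rewrite -(ltr_nat R); apply: le_lt_trans (truncnS_gt _).
    by rewrite -[leRHS]mul1r ler_pdivlMr// (le_trans j1)//; lra.
  rewrite /D Sj => i _.
  have [eta eta0 heta] := contG w t r Omw t01 r_gt0.
  have [m [k [km dk]]] := dyadic_dense d0 tj eta0.
  exists m => //; exists k => //.
  set s := dyadic _ _ _ _ in dk *.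
  have /andP[s1 s2] : a j - delta <= s <= a j.
    have h : 0 <= delta * k%:R / 2 ^+ m by rewrite divr_ge0 ?exprn_ge0// mulr_ge0// ltW.
    have h' : delta * k%:R / 2 ^+ m <= delta.
      rewrite ler_pdivrMr ?exprn_gt0// ler_wpM2l// ?(ltW d0)//.
      by rewrite -natrX ler_nat -ltnS.
    by rewrite /s /dyadic; apply/andP; split; lra.
  have s01 : s \in `[0, 1] by rewrite in_itv /=; apply/andP; split; lra.
  have a01 : a j \in `[0, 1] by rewrite in_itv /=; apply/andP; split; lra.
  have h1 := heta s s01 dk i; rewrite !drifted_pathE in h1.
  have h2 : `|B i t w + f t 0 i - x 0 i| < r.
    have := coord_le_enorm (drifted_path B f w t - x) i.
    by move=> /le_lt_trans/(_ xG); rewrite -drifted_pathE !mxE.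
  have h3 : `|f s 0 i - f (a j) 0 i| <= `|K| * r.
    have := coord_le_enorm (f s - f (a j)) i; rewrite !mxE => /le_trans; apply.
    apply: (le_trans (hf _ _ a01 s01)).
    apply: (le_trans (ler_wpM2r (powR_ge0 _ _) (ler_norm K))).
    rewrite ler_wpM2l// -dH ge0_ler_powR ?nnegrE ?(ltW H0) ?(ltW d0)//.
    by rewrite ler_norml; apply/andP; split; lra.
  rewrite dH /y.
  have -> : B i s w - (x 0 i - f (a j) 0 i) =
      (B i s w + f s 0 i - (B i t w + f t 0 i)) + (B i t w + f t 0 i - x 0 i) -
      (f s 0 i - f (a j) 0 i) by ring.
  apply: (le_trans (ler_normB _ _)).
  have := ler_normD (B i s w + f s 0 i - (B i t w + f t 0 i)) (B i t w + f t 0 i - x 0 i).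
  by rewrite mulrDl; lra.
- apply: (le_trans (Boole_inequality P _)); first by move=> j _; exact: mD.
  have PD j : (P (D j) <= (if S0 j then (C0 * r) ^+ d else 0)%:E)%E.
    rewrite /D; case: ifPn => Sj; last by rewrite measure0.
    apply: (independent_bigcap_le indB (fun i => psaA j i Sj)) => i.
    rewrite -dH; apply: hC => //.
    + exact: aI.
    + by rewrite d0.
    + by rewrite dH.
    + rewrite /y (le_trans (ler_normB _ _))// /M' -addrA lerD//.
      apply: (holder_coord_bounded i hf ff0).
      by rewrite in_itv /=; have /andP[] := aI j Sj; lra.
  apply: (@le_trans _ _ (\sum_(j < n) (if S0 j then (C0 * r) ^+ d else 0)%:E)%E).
    by apply: lee_sum => j _; exact: PD.
  rewrite sumEFin lee_fin -big_mkcond /=.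
  rewrite (eq_bigr (fun=> 1 * (C0 * r) ^+ d)); last by move=> j _; rewrite mul1r.
  rewrite -mulr_suml -(natr_sum _ _ _ (fun=> 1%N)).
  have d1 : 0 < delta <= 1 by rewrite d0 (le_trans deps)// ltW.
  have := regular_set_cells c0 regE n d1 (S := S0).
  move=> /(_ (fun j Sj => asboolW Sj)) Nle.
  apply: (le_trans (ler_wpM2r (exprn_ge0 _ (mulr_ge0 (ltW C00) (ltW r_gt0))) Nle)).
  rewrite exprMn.
  have -> : delta `^ (- beta) = r `^ (- beta / H).
    by rewrite -powRrM mulrC.
  have -> : r `^ (d%:R - beta / H) = r ^+ d * r `^ (- beta / H).
    by rewrite powRD ?powR_mulrn ?(ltW r_gt0)// ?mulNr// (lt0r_neq0 r_gt0) implybT.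
  rewrite [leLHS](_ : _ = (4 * c * fine (nu [set: R]) * C0 ^+ d) * (r ^+ d * r `^ (- beta / H))).
    by rewrite ler_wpM2r ?mulr_ge0 ?exprn_ge0 ?powR_ge0 ?(ltW r_gt0)// /C lerDl.
  ring.
Qed.

Let hausdorff_content_nonincreasing (gamma : R) (A : set 'rV[R]_d) (rho rho' : R) : rho <= rho' ->
  (hausdorff_content gamma rho' A <= hausdorff_content gamma rho A)%E.
Proof.
move=> rr; apply: le_ereal_inf => _ [x [r [rx Ax ->]]]; exists x, r; split => // n.
by have /andP[-> /le_trans ->] := rx n.
Qed.

(** The content is nonincreasing in the mesh, hence the limit at 0 is a supremum. *)
Lemma hausdorff_content_le_measure (gamma rho : R) (A : set 'rV[R]_d) : 0 < gamma -> 0 < rho ->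
  (hausdorff_content gamma rho A <= hausdorff_measure gamma A)%E.
Proof.
move=> g0 rho0; rewrite /hausdorff_measure (leNgt gamma) g0 /=.
have cv : hausdorff_content gamma x A @[x --> 0^'+] --> ereal_sup
    ((fun x => hausdorff_content gamma x A) @` [set` `]0%R, rho[%R]).
  apply: (@nonincreasing_at_right_cvge _ _ _ (BLeft rho)); first by rewrite bnd_simp.
  by move=> x y _ _ xy; exact: hausdorff_content_nonincreasing.
rewrite (cvg_lim _ cv)//.
apply: (@le_trans _ _ (hausdorff_content gamma (rho / 2) A)).
  by apply: hausdorff_content_nonincreasing; lra.
apply: ereal_sup_ubound; exists (rho / 2) => //=; rewrite in_itv /=.
by apply/andP; split; lra.
Qed.

(** [ball_hitting_le] is summed over a cover of [F] by balls of radius at most [r0]. *)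
Lemma hitting_le_hausdorff : 0 < d%:R - beta / H -> exists C : R, [/\ 0 < C &
  forall (disp : measure_display) (T : measurableType disp) (P : probability T R)
    (B : 'I_d -> R -> {RV P >-> R}) (f : R -> 'rV[R]_d) (Om : set T),
  independent_processes B -> (forall i, gaussian_fbm H (B i)) ->
  holder_continuous H K f -> f 0 = f0 -> continuous_paths (drifted_path B f) Om ->
  measurable (hitting (contact (drifted_path B f) Om F) E) ->
  (P (hitting (contact (drifted_path B f) Om F) E) <=
    C%:E * hausdorff_measure (d%:R - beta / H) F)%E].
Proof.
move=> g0; have [C [r0 [C0 r00 hC]]] := ball_hitting_le.
exists C; split => // disp T P B f Om indB gB hf ff0 contG mh.
rewrite muleC -lee_pdivrMr//.
apply: le_trans (hausdorff_content_le_measure F g0 r00).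
apply: le_ereal_inf_tmp => _ [x [r [rr Fx ->]]].
have /choice[S hS] := fun n => hC _ _ P B f Om indB gB hf ff0 contG (x n) (r n) (rr n).
have mS n : measurable (S n) by have [] := hS n.
apply: (@le_trans _ _ ((\sum_(0 <= n <oo) P (S n)) * (C^-1)%:E)%E).
  rewrite lee_pmul2r//; last by rewrite lte_fin invr_gt0.
  apply: (measure_sigma_subadditive P) => // w [t Et [Omw t01 FG]].
  have [n _ xn] := Fx _ FG; exists n => //; have [_ + _] := hS n; apply.
  by exists t.
rewrite lee_pdivrMr// muleC -nneseriesZl//; last by move=> n _; rewrite lee_fin powR_ge0.
apply: lee_nneseries => // n _.
have [_ _ Sn] := hS n; apply: (le_trans Sn); rewrite -EFinM lee_fin ler_wpM2l ?(ltW C0)//.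
have /andP[rn0 _] := rr n.
by rewrite ge0_ler_powR ?nnegrE ?(ltW g0) ?mulr_ge0//; lra.
Qed.

End ball_estimate.

(** * Second moments of finite sums of events *)

Section finite_sums_of_events.
Context {R : realType} {disp : measure_display} {T : measurableType disp}.

(** The integral of a nonnegative function being a supremum over simple functions, its
    monotonicity needs no measurability. *)
Lemma ge0_le_integralT (mu : {measure set T -> \bar R}) (f g : T -> \bar R) :
  (forall x, 0 <= f x)%E -> (forall x, f x <= g x)%E ->
  (\int[mu]_x f x <= \int[mu]_x g x)%E.
Proof.
move=> f0 fg; rewrite !ge0_integralTE//; last by move=> x; exact: le_trans (fg x).
apply: le_ereal_sup => _ [h /= hf <-]; exists h => //= x.
exact: le_trans (fg x).
Qed.

Lemma ge0_integral_weighted_indic (I : finType) (mu : {measure set T -> \bar R})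
    (W : I -> R) (A : I -> set T) : (forall a, 0 <= W a) -> (forall a, measurable (A a)) ->
  (\int[mu]_x (\sum_a W a * \1_(A a) x)%:E = \sum_a (W a)%:E * mu (A a))%E.
Proof.
move=> W0 mA.
under eq_integral do rewrite -sumEFin.
rewrite (@ge0_integral_sum _ _ _ mu setT measurableT I (fun a x => (W a * \1_(A a) x)%:E)).
- apply: eq_bigr => a _; under eq_integral do rewrite EFinM.
  rewrite ge0_integralZl//.
  + by rewrite integral_indic// setIT.
  + by apply/measurable_EFinP; exact: measurable_indic.
  + by rewrite lee_fin W0.
- by move=> a; apply/measurable_EFinP; apply: measurable_funM => //; exact: measurable_indic.
- by move=> a x _; rewrite lee_fin mulr_ge0 ?W0.
Qed.

(** Expectation of [2 lam Z - lam^2 Z^2 <= 1], for [Z] the sum of the [W a 1_(A a)],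
    written without subtraction. The multiplier [lam] is left free since its optimal
    value is a quotient of moments. *)
Lemma second_moment (I : finType) (P : probability T R) (W : I -> R) (A : I -> set T) (U : set T)
    (lam : R) : (forall a, 0 <= W a) -> (forall a, measurable (A a)) -> measurable U ->
  (forall a, A a `<=` U) -> 0 <= lam ->
  ((2 * lam)%:E * (\sum_a (W a)%:E * P (A a)) <=
   P U + (lam ^+ 2)%:E * (\sum_a \sum_b (W a * W b)%:E * P (A a `&` A b)))%E.
Proof.
move=> W0 mA mU AU lam0.
rewrite -(ge0_integral_weighted_indic P W0 mA) pair_bigA /=.
have mAA (p : I * I) : measurable (A p.1 `&` A p.2) by exact: measurableI.
have WW0 (p : I * I) : 0 <= W p.1 * W p.2 by rewrite mulr_ge0.
rewrite -(ge0_integral_weighted_indic P WW0 mAA).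
rewrite -(setIT U) -integral_indic//.
have mS : measurable_fun [set: T] (fun x => \sum_a W a * \1_(A a) x).
  by apply: measurable_sum => a; apply: measurable_funM => //; exact: measurable_indic.
have mSS : measurable_fun [set: T] (fun x => \sum_(p : I * I) W p.1 * W p.2 * \1_(A p.1 `&` A p.2) x).
  by apply: measurable_sum => a; apply: measurable_funM => //; exact: measurable_indic.
have S0 x : 0 <= \sum_a W a * \1_(A a) x by apply: sumr_ge0 => a _; rewrite mulr_ge0.
have SS0 x : 0 <= \sum_(p : I * I) W p.1 * W p.2 * \1_(A p.1 `&` A p.2) x.
  by apply: sumr_ge0 => a _; rewrite mulr_ge0.
rewrite -!ge0_integralZl//; first last.
- by rewrite lee_fin sqr_ge0.
- by move=> x _; rewrite lee_fin.
- exact/measurable_EFinP.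
- by rewrite lee_fin mulr_ge0.
- by move=> x _; rewrite lee_fin.
- exact/measurable_EFinP.
rewrite -ge0_integralD//; first last.
- by apply/measurable_EFinP; apply: measurable_funM.
- by move=> x _; rewrite lee_fin mulr_ge0 ?sqr_ge0.
- by apply/measurable_EFinP; exact: measurable_indic.
apply: ge0_le_integralT => x; first by rewrite lee_fin mulr_ge0// mulr_ge0.
rewrite -!EFinM -EFinD lee_fin.
have -> : \sum_(p : I * I) W p.1 * W p.2 * \1_(A p.1 `&` A p.2) x =
    (\sum_a W a * \1_(A a) x) ^+ 2.
  rewrite expr2 mulr_suml -(pair_bigA _ (fun a b => W a * W b * \1_(A a `&` A b) x)) /=.
  apply: eq_bigr => a _; rewrite mulr_sumr; apply: eq_bigr => b _.
  by rewrite indicI /=; ring.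
have [Ux|Ux] := pselect (U x).
  rewrite indicE mem_set//=.
  set s := \sum_a _; have := sqr_ge0 (1 - lam * s).
  rewrite sqrrB expr1n mul1r exprMn; lra.
rewrite big1 ?mulr0 ?expr0n ?mulr0 ?addr0//.
by move=> a _; rewrite indicE memNset ?mulr0// => /AU.
Qed.

Lemma simple_le_integral (n : nat) (mu : {measure set T -> \bar R}) (D : nat -> set T)
    (a : 'I_n -> R) (g : T -> \bar R) : (forall k, 0 <= a k) -> (forall k, measurable (D k)) ->
  trivIset setT D -> (forall x, 0 <= g x)%E -> (forall (k : 'I_n) x, D k x -> (a k)%:E <= g x)%E ->
  (\sum_(k < n) (a k)%:E * mu (D k) <= \int[mu]_x g x)%E.
Proof.
move=> a0 mD tD g0 ag.
rewrite -(@ge0_integral_weighted_indic _ mu a (fun k => D k))//.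
apply: ge0_le_integralT => // x.
  by rewrite lee_fin sumr_ge0// => k _; rewrite mulr_ge0.
have [[k Dk]|nD] := pselect (exists k : 'I_n, D k x).
  rewrite (bigD1 k)//= indicE mem_set// mulr1 big1 ?addr0; first exact: ag.
  move=> j jk; rewrite indicE memNset ?mulr0// => Dj.
  by move/eqP: jk; apply; apply/val_inj; apply: (tD j k) => //; exists x.
rewrite big1// => k _; rewrite indicE memNset ?mulr0// => Dk.
by apply: nD; exists k.
Qed.

End finite_sums_of_events.

(** * The Riesz kernel as a sum over dyadic shells *)

Section riesz_kernel_shells.
Context {R : realType}.

Lemma riesz_kernel_ge0 (gam r : R) : 0 <= r -> (0 <= riesz_kernel gam r)%E.
Proof.
move=> r0; rewrite /riesz_kernel; case: ifP => // _; case: ifPn => // rn0.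
have rp : 0 < r by rewrite lt0r rn0.
case: ifP => _; last by rewrite lee_fin powR_ge0.
have m0 : 0 < Num.min r 1 by rewrite lt_min rp ltr01.
rewrite lee_fin ln_ge0// ler_pdivlMr// mul1r.
by rewrite (@le_trans _ _ 1)// ?ge_min ?lexx ?orbT// -expR0 ler_expR.
Qed.

Lemma geometric_sum_le (q : R) n : 0 < q < 1 -> \sum_(m < n) q ^+ m <= (1 - q)^-1.
Proof.
move=> /andP[q0 q1]; rewrite -[leRHS]mul1r ler_pdivlMr ?subr_gt0//.
have := subrX1 q n; have : 0 <= q ^+ n by rewrite exprn_ge0// ltW.
set s := \sum_(i < n) _; lra.
Qed.

(** The radii [2 ^+ m * r0] run from [r0] to a constant. The geometric sum is of the order
    of its first term if [gam > 0] and of its last one if [gam < 0]; if [gam = 0] it is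
    the number of its terms, of the order of [ln r0^-1]. In each case this is the Riesz
    kernel at [r0], which decreases: hence the comparison with smaller [r]. *)
Lemma dyadic_shell_sum (gam rmax D : R) : 0 < rmax -> 1 <= D -> exists2 C : R, 0 < C &
  forall r0 : R, 0 < r0 <= rmax -> exists N, 1 <= 2 ^+ N * r0 /\
    forall r : R, 0 <= r <= D * r0 ->
      ((\sum_(m < N.+1) (2 ^+ m * r0) `^ (- gam))%:E <= C%:E * riesz_kernel gam r)%E.
Proof.
move=> rm0 D1; have D0 : 0 < D by exact: lt_le_trans D1.
(* the least number of doublings that bring [r0] above 1 *)
have expN (r0 : R) : 0 < r0 <= rmax -> exists N, [/\ 1 <= 2 ^+ N * r0,
    2 ^+ N * r0 <= rmax + 2 & forall n, N = n.+1 -> 2 ^+ n * r0 < 1].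
  move=> /andP[r00 r0m].
  have ex : exists N, 1 <= 2 ^+ N * r0.
    exists (Num.truncn r0^-1).+1; rewrite -ler_pdivrMr// mul1r.
    apply: (le_trans (ltW (truncnS_gt _))); rewrite -natrX ler_nat.
    exact/ltnW/ltn_expl.
  exists (ex_minn ex); case: ex_minnP => N N1 Nmin.
  have lt1 n : N = n.+1 -> 2 ^+ n * r0 < 1.
    move=> Nn; rewrite ltNge; apply/negP => /Nmin; rewrite Nn ltnn//.
  split => //; case: N N1 Nmin lt1 => [|n] _ _ lt1; first by rewrite mul1r; lra.
  by have := lt1 n erefl; rewrite exprS -mulrA; lra.
have q01 (p : R) : 0 < p -> 0 < 2 `^ (- p) < 1.
  move=> p0; rewrite powR_gt0//= powRN invf_lt1 ?powR_gt0//.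
  apply: (@le_lt_trans _ _ (1 `^ p)); first by rewrite powR1.
  by rewrite gt0_ltr_powR ?nnegrE ?ltr1n.
have powX (r0 p : R) m : 0 < r0 -> (2 ^+ m * r0) `^ p = r0 `^ p * (2 `^ p) ^+ m.
  move=> r00; rewrite powRM ?exprn_ge0 ?(ltW r00)// mulrC.
  rewrite -(powR_mulrn m (ler0n R 2)) -(powR_mulrn m (powR_ge0 2 p)).
  by rewrite -!powRrM (mulrC p).
have [g0|g0|g0] := ltgtP gam 0.
- have p0 : 0 < - gam by rewrite oppr_gt0.
  have /andP[qq0 qq1] := q01 _ p0.
  exists ((rmax + 2) `^ (- gam) * (1 - 2 `^ (- - gam))^-1).
    by rewrite mulr_gt0 ?powR_gt0 ?invr_gt0 ?subr_gt0//; lra.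
  move=> r0 hr0; have [N [N1 N2 _]] := expN _ hr0; exists N; split => // r _.
  have /andP[r00 _] := hr0.
  rewrite /riesz_kernel g0 mule1 lee_fin.
  rewrite (reindex_inj rev_ord_inj)/=.
  rewrite (eq_bigr (fun m : 'I_N.+1 => (2 ^+ N * r0) `^ (- gam) * (2 `^ (- - gam)) ^+ m)).
    rewrite -mulr_sumr; apply: ler_pM; first exact: powR_ge0.
    + by apply: sumr_ge0 => m _; rewrite exprn_ge0 ?powR_ge0.
    + rewrite ge0_ler_powR ?nnegrE ?(ltW p0)//; last lra.
      by rewrite mulr_ge0 ?exprn_ge0 ?(ltW r00).
    + by apply: geometric_sum_le; rewrite qq0.
  move=> m _; rewrite subSS !powX// -mulrA; congr (_ * _).
  have -> : (2 `^ (- gam)) ^+ N = (2 `^ (- gam)) ^+ (N - m) * (2 `^ (- gam)) ^+ m.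
    by rewrite -exprD subnK// -ltnS.
  by rewrite -mulrA -exprMn (powRN 2 (- gam)) mulfV ?expr1n ?mulr1// gt_eqF// powR_gt0.
- have /andP[qq0 qq1] := q01 _ g0.
  exists (D `^ gam * (1 - 2 `^ (- gam))^-1).
    by rewrite mulr_gt0 ?powR_gt0 ?invr_gt0 ?subr_gt0.
  move=> r0 hr0; have [N [N1 N2 _]] := expN _ hr0; exists N; split => // r /andP[rge rle].
  have /andP[r00 _] := hr0.
  rewrite /riesz_kernel ltNge (ltW g0)/=; case: eqP => [_|/eqP rn0].
    by rewrite gt0_muley ?leey// lte_fin mulr_gt0 ?powR_gt0 ?invr_gt0 ?subr_gt0.
  have rp : 0 < r by rewrite lt0r rn0.
  rewrite gt_eqF// -EFinM lee_fin.
  rewrite (eq_bigr (fun m : 'I_N.+1 => r0 `^ (- gam) * (2 `^ (- gam)) ^+ m)); last first.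
    by move=> m _; rewrite powX.
  rewrite -mulr_sumr mulrAC; apply: ler_pM; first exact: powR_ge0.
  + by apply: sumr_ge0 => m _; rewrite exprn_ge0 ?powR_ge0.
  + rewrite !powRN ler_pdivlMr ?powR_gt0// mulrC ler_pdivrMr ?powR_gt0//.
    rewrite -powRM ?(ltW D0) ?(ltW r00)// ge0_ler_powR ?nnegrE ?(ltW g0)//.
    by rewrite mulr_ge0 ?(ltW D0) ?(ltW r00).
  + by apply: geometric_sum_le; rewrite qq0.
- have l2 : 0 < ln 2 :> R by rewrite ln_gt0// ltr1n.
  have lD : 0 <= ln D by rewrite ln_ge0.
  exists (2 + (1 + ln D) / ln 2).
    by rewrite addr_gt0// divr_gt0// ltr_pwDl.
  move=> r0 hr0; have [N [N1 _ N2]] := expN _ hr0; exists N; split => // r /andP[rge rle].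
  have /andP[r00 _] := hr0.
  have C0 : 0 < 2 + (1 + ln D) / ln 2 by rewrite addr_gt0// divr_gt0// ltr_pwDl.
  rewrite /riesz_kernel g0 ltxx; case: eqP => [_|/eqP rn0].
    by rewrite gt0_muley ?leey.
  have rp : 0 < r by rewrite lt0r rn0.
  rewrite eqxx -EFinM lee_fin oppr0.
  rewrite (eq_bigr (fun=> 1)); last by move=> m _; rewrite powRr0.
  rewrite sumr_const card_ord.
  have m0 : 0 < Num.min r 1 by rewrite lt_min rp ltr01.
  rewrite ln_div ?posrE ?expR_gt0// expRK.
  set L := ln (Num.min r 1).
  have L0 : L <= 0 by rewrite ln_le0// ge_min lexx orbT.
  have LD : L <= ln D + ln r0.
    by rewrite -lnM ?posrE// ler_ln ?posrE ?mulr_gt0// ge_min rle.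
  have CL : 2 + (- L + ln D) / ln 2 <= (2 + (1 + ln D) / ln 2) * (1 - L).
    have -> : (2 + (1 + ln D) / ln 2) * (1 - L) = 2 - 2 * L +
      (1 - L + ln D * (1 - L)) / ln 2 by ring.
    apply: lerD; first lra.
    rewrite ler_wpM2r ?invr_ge0 ?(ltW l2)//.
    have : 0 <= ln D * - L by rewrite mulr_ge0// oppr_ge0.
    lra.
  apply: le_trans CL.
  case: N N1 N2 => [|n] _ N2.
    have : 0 <= (- L + ln D) / ln 2 by rewrite divr_ge0 ?(ltW l2)// addr_ge0// oppr_ge0.
    rewrite mulr1n; lra.
  have : n%:R <= (- L + ln D) / ln 2.
    rewrite ler_pdivlMr//.
    have := N2 n erefl; rewrite -ltr_ln ?posrE ?mulr_gt0 ?exprn_gt0//.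
    rewrite ln1 lnM ?posrE ?exprn_gt0// lnXn// -mulr_natl; lra.
  by rewrite -[n.+2]addn2 natrD; lra.
Qed.

End riesz_kernel_shells.

(** * Kernel sums on regular sets *)

Section kernel_sums.
Context {R : realType}.
Variables (H beta c : R) (nu : {finite_measure set (measurableTypeR R) -> \bar R}) (E : set R).
Hypothesis H0 : 0 < H.
Hypothesis beta0 : 0 <= beta.

(** Radii above 1 are absorbed by the total mass. *)
Lemma regular_set_upper : 0 < c ->
  (forall a delta : R, E a -> 0 < delta <= 1 ->
    (nu `[(a - delta)%R, (a + delta)%R]%classic <= (c * delta `^ beta)%R%:E)%E) ->
  exists2 C : R, 0 < C & forall a delta : R, E a -> 0 < delta ->
    (nu `[(a - delta)%R, (a + delta)%R]%classic <= (C * delta `^ beta)%:E)%E.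
Proof.
move=> c0 hc; have f0 : 0 <= fine (nu [set: R]) by exact: fine_ge0.
exists (c + fine (nu [set: R])); first by rewrite ltr_wpDr.
move=> a delta Ea d0; have [d1|d1] := leP delta 1.
  apply: (le_trans (hc a delta Ea _)); first by rewrite d0.
  by rewrite lee_fin ler_wpM2r ?powR_ge0// lerDl.
apply: (@le_trans _ _ (nu [set: R])); first by apply: le_measure; rewrite ?inE.
rewrite -(fineK (fin_num_measure nu _ measurableT)) lee_fin.
have d1b : 1 <= delta `^ beta.
  apply: (@le_trans _ _ (1 `^ beta)); first by rewrite powR1.
  by rewrite ge0_ler_powR ?nnegrE ?(ltW d1)// ltW.
apply: (@le_trans _ _ ((c + fine (nu [set: R])) * 1)); first by rewrite mulr1 lerDr ltW.
by rewrite ler_wpM2l// addr_ge0// ltW.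
Qed.

Hypothesis c0 : 0 < c.
Hypothesis hc : forall a delta : R, E a -> 0 < delta ->
  (nu `[(a - delta)%R, (a + delta)%R]%classic <= (c * delta `^ beta)%:E)%E.

(** The points at [H]-distance at most [2 ^ m * r0] of [t] have mass of order
    [(2 ^ m * r0) `^ (beta / H)], which is compared with the kernel shell by shell. *)
Lemma regular_kernel_sum (n k N : nat) (D : 'I_n -> set (measurableTypeR R)) (u : 'I_n -> R)
    (eta r0 t : R) : 0 < r0 -> 0 < eta -> eta `^ H <= r0 -> 1 <= 2 ^+ N * r0 -> E t ->
  (forall l, measurable (D l)) -> trivIset setT D -> (forall l x, D l x -> `|x - u l| <= eta) ->
  (forall l, `|t - u l| <= 1) ->
  \sum_l fine (nu (D l)) * ((`|t - u l| `^ H + r0) ^+ k)^-1 <=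
  2 ^+ k * c * 2 `^ beta * \sum_(m < N.+1) (2 ^+ m * r0) `^ (- (k%:R - beta / H)).
Proof.
move=> r00 eta0 etar N1 Et mD tD Du tu.
pose rho (m : nat) := 2 ^+ m * r0.
have rho0 m : 0 < rho m by rewrite mulr_gt0 ?exprn_gt0.
have w0 l : 0 <= fine (nu (D l)) by exact: fine_ge0.
have pt l : ((`|t - u l| `^ H + r0) ^+ k)^-1 <=
    \sum_(m < N.+1) 2 ^+ k * (rho m ^+ k)^-1 * ((`|t - u l| `^ H <= rho m)%R)%:R.
  set v := `|t - u l| `^ H; have v0 : 0 <= v by exact: powR_ge0.
  have vN : v <= rho N.
    apply: le_trans N1; apply: (@le_trans _ _ (1 `^ H)); last by rewrite powR1.
    by rewrite ge0_ler_powR ?nnegrE ?(ltW H0).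
  have ex : exists m, v <= rho m by exists N.
  case: (ex_minnP ex) => m vm mmin.
  have mN : (m < N.+1)%N by rewrite ltnS mmin.
  rewrite (bigD1 (Ordinal mN))//= vm mulr1.
  apply: (@le_trans _ _ (2 ^+ k * (rho m ^+ k)^-1)); last first.
    by rewrite lerDl sumr_ge0// => j _; rewrite mulr_ge0// mulr_ge0 ?invr_ge0 ?exprn_ge0// ltW.
  have h : rho m / 2 <= v + r0.
    case: (m) mmin => [|m'] mmin; first by rewrite /rho mul1r; lra.
    have : rho m' < v by rewrite ltNge; apply/negP => /mmin; rewrite ltnn.
    have -> : rho m'.+1 = 2 * rho m' by rewrite /rho exprS mulrA.
    lra.
  have -> : 2 ^+ k * (rho m ^+ k)^-1 = ((rho m / 2) ^+ k)^-1.
    by rewrite expr_div_n invf_div.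
  rewrite lef_pV2 ?posrE ?exprn_gt0 ?divr_gt0 ?addr_ge0//; last by rewrite ltr_wpDl.
  by rewrite lerXn2r ?nnegrE ?addr_ge0 ?divr_ge0// ltW.
apply: (@le_trans _ _ (\sum_l \sum_(m < N.+1) fine (nu (D l)) *
    (2 ^+ k * (rho m ^+ k)^-1 * ((`|t - u l| `^ H <= rho m)%R)%:R))).
  by apply: ler_sum => l _; rewrite -mulr_sumr ler_wpM2l.
rewrite exchange_big /= mulr_sumr; apply: ler_sum => m _.
rewrite (eq_bigr (fun l => 2 ^+ k * (rho m ^+ k)^-1 *
    (if `|t - u l| `^ H <= rho m then fine (nu (D l)) else 0))); last first.
  by move=> l _; case: ifP => _; rewrite ?mulr1 ?mulr0// mulrC.
rewrite -mulr_sumr -big_mkcond /=.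
pose s := rho m `^ H^-1.
have s0 : 0 < s by exact: powR_gt0.
have mass : \sum_(l | `|t - u l| `^ H <= rho m) fine (nu (D l)) <= c * (2 * s) `^ beta.
  rewrite -lee_fin -sumEFin.
  rewrite (eq_bigr (fun l => nu (D l))); last by move=> l _; rewrite fineK ?fin_num_measure.
  rewrite -measure_bigsetU_ord_cond//; last by apply: sub_trivIset tD.
  apply: le_trans (hc Et (mulr_gt0 _ s0)) => //.
  apply: le_measure; rewrite ?inE//; first exact: bigsetU_measurable.
  apply: (big_ind (fun S => S `<=` `[(t - 2 * s)%R, (t + 2 * s)%R]%classic)) => //.
    by move=> A A' AI A'I x []; [exact: AI|exact: A'I].
  move=> l lm x Dx.
  have h1 : `|t - u l| <= s.
    rewrite -[leLHS]powRr1// -(mulfV (lt0r_neq0 H0)) powRrM.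
    by rewrite ge0_ler_powR ?nnegrE ?powR_ge0 ?invr_ge0 ?(ltW H0) ?(ltW (rho0 m)).
  have h2 : eta <= s.
    rewrite -[leLHS](powRr1 (ltW eta0)) -(mulfV (lt0r_neq0 H0)) powRrM.
    rewrite ge0_ler_powR ?nnegrE ?powR_ge0 ?invr_ge0 ?(ltW H0) ?(ltW (rho0 m))//.
    apply: (le_trans etar); rewrite /rho -[leLHS]mul1r ler_wpM2r ?(ltW r00)//.
    by rewrite exprn_ege1// ler1n.
  have h3 := Du l x Dx.
  rewrite /= in_itv /=.
  by move: h1 h3; rewrite !ler_norml => /andP[? ?] /andP[? ?]; apply/andP; split; lra.
rewrite -!mulrA ler_wpM2l ?exprn_ge0//.
rewrite powRM ?(ltW s0)// in mass.
have -> : (2 ^+ m * r0) `^ (- (k%:R - beta / H)) = (rho m ^+ k)^-1 * s `^ beta.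
  rewrite /s -powRrM opprB powRD; last by rewrite (gt_eqF (rho0 m)) implybT.
  by rewrite powRN powR_mulrn ?(ltW (rho0 m))// mulrC (mulrC beta).
rewrite (mulrCA (2 `^ beta)) (mulrCA c).
by rewrite ler_wpM2l// invr_ge0 exprn_ge0// ltW.
Qed.

End kernel_sums.

(** * Probabilities of approximate hitting at given times *)

Section one_point.
Context {R : realType}.
Variables (H eps0 : R).
Hypothesis H01 : 0 < H < 1.
Hypothesis eps01 : 0 < eps0 < 1.

Lemma normal_prob_itv_ge (s m M y e : R) : 0 < m -> m ^+ 2 <= s ^+ 2 <= 1 -> `|y| <= M -> 0 < e <= 1 ->
  ((normal_peak 1 * expR (- ((M + 1) ^+ 2 / (2 * m ^+ 2))) * e)%:E <=
    normal_prob 0 s `[(y - e)%R, (y + e)%R]%classic)%E.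
Proof.
move=> m0 /andP[ms s1] yM /andP[e0 e1].
have s20 : 0 < s ^+ 2 by apply: lt_le_trans ms; rewrite exprn_gt0.
have s0 : s != 0 by rewrite -sqrf_eq0 gt_eqF.
set q := normal_peak 1 * _.
have q0 : 0 <= q by rewrite mulr_ge0 ?normal_peak_ge0 ?expR_ge0.
apply: (@le_trans _ _ (\int[lebesgue_measure]_(x in `[(y - e)%R, (y + e)%R]) q%:E)%E).
  rewrite integral_cst//= lebesgue_measure_itv/= lte_fin ltrD2l.
  rewrite (_ : (- e < e)%R); last by lra.
  by rewrite -EFinD -EFinM lee_fin ler_wpM2l//; lra.
apply: ge0_le_integral => //.
- apply/measurable_EFinP; apply: measurable_funTS; exact: measurable_normal_pdf.
move=> x; rewrite /= in_itv /= => /andP[x1 x2].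
rewrite lee_fin normal_pdfE// /q; apply: ler_pM; rewrite ?normal_peak_ge0 ?expR_ge0//.
- have p1 : 0 < Num.sqrt (s ^+ 2 * pi *+ 2) :> R.
    by rewrite sqrtr_gt0 mulrn_wgt0// mulr_gt0// pi_gt0.
  have p2 : 0 < Num.sqrt (1 ^+ 2 * pi *+ 2) :> R.
    by rewrite sqrtr_gt0 mulrn_wgt0// mulr_gt0 ?pi_gt0// expr1n.
  rewrite /normal_peak lef_pV2 ?posrE// ler_wsqrtr// lerMn2r/=.
  by rewrite ler_wpM2r ?pi_ge0// expr1n.
- rewrite /normal_fun subr0 ler_expR mulNr lerN2 -(mulr_natl (s ^+ 2)).
  have xM : x ^+ 2 <= (M + 1) ^+ 2.
    rewrite -real_normK ?num_real// lerXn2r ?nnegrE// ?addr_ge0//.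
      by rewrite (le_trans _ yM).
    by move: yM; rewrite !ler_norml; lra.
  have d1 : 0 < 2 * s ^+ 2 by rewrite mulr_gt0.
  have d2 : 0 < 2 * m ^+ 2 by rewrite mulr_gt0// exprn_gt0.
  apply: ler_pM => //; first exact: sqr_ge0.
    by rewrite invr_ge0 ltW.
  by rewrite lef_pV2 ?posrE// ler_wpM2l.
Qed.

(** The variance at times in [[eps0, 1]] is between [eps0 `^ (2 * H)] and 1, hence the
    density is bounded below on bounded sets. *)
Lemma one_point_probability (M : R) : exists2 c : R, 0 < c &
  forall (disp : measure_display) (T : measurableType disp) (P : probability T R)
    (X : R -> {RV P >-> R}), gaussian_fbm H X ->
  forall t e y : R, eps0 <= t <= 1 -> 0 < e <= 1 -> `|y| <= M ->
    ((c * e)%:E <= P [set w | (`|X t w - y| <= e)%R])%E.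
Proof.
have m0 := min_sd_gt0 H eps01.
exists (normal_peak 1 * expR (- ((M + 1) ^+ 2 / (2 * min_sd H eps0 ^+ 2)))).
  by rewrite mulr_gt0 ?expR_gt0// normal_peak_gt0.
move=> disp T P X [gX cX covX] t e y /andP[et t1] e01 yM.
have t0 : 0 <= t by rewrite (le_trans _ et)// ltW//; case/andP: eps01.
pose p : 'I_1 -> R := fun=> t; pose a : 'I_1 -> R := fun=> 1.
have p01 j : p j \in `[0, 1] by rewrite /p in_itv /= t0.
have XE : lincomb X p a = X t by apply/funext => w; rewrite /lincomb big_ord1 mul1r.
have lE : lincov H p a a = (t `^ H) ^+ 2.
  by rewrite /lincov !big_ord1 /a /p !mul1r fbm_cov_diag.
have [s [s2 lawX]] := gaussian_variable_centered (measurable_lincomb X p a)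
  (gX _ p a p01) (integral_lincomb cX covX p01 a) (integral_lincomb_sqr covX p01 a).
rewrite XE lE in s2 lawX.
have -> : [set w | (`|X t w - y| <= e)%R] = X t @^-1` `[(y - e)%R, (y + e)%R]%classic.
  apply/seteqP; split => w /=; rewrite in_itv /= ler_norml; lra.
have s2m : min_sd H eps0 ^+ 2 <= s ^+ 2 <= 1.
  rewrite s2 lerXn2r ?nnegrE ?powR_ge0 ?(ltW m0) ?min_sd_le//=.
  by rewrite expr_le1 ?powR_ge0// powR_le1// t0.
rewrite lawX// /gaussian_law ifF; last first.
  apply/negbTE; rewrite -sqrf_eq0 gt_eqF//; apply: lt_le_trans (andP s2m).1.
  by rewrite exprn_gt0.
exact: normal_prob_itv_ge.
Qed.

End one_point.

Section maximum_norm.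
Context {R : realType} {d : nat}.
Implicit Types x y : 'rV[R]_d.

Definition coord_norm x : R := \big[Num.max/0]_i `|x 0 i|.

Lemma le_coord_norm x i : `|x 0 i| <= coord_norm x.
Proof. by rewrite /coord_norm (bigD1 i)//= le_max lexx. Qed.

Lemma coord_norm_le x (r : R) : 0 <= r -> (forall i, `|x 0 i| <= r) -> coord_norm x <= r.
Proof. by move=> r0 xr; rewrite /coord_norm; apply/bigmax_leP. Qed.

Lemma coord_norm_ge0 x : 0 <= coord_norm x.
Proof. by rewrite /coord_norm; elim/big_ind: _ => // a b a0 b0; rewrite le_max a0. Qed.

Lemma coord_norm_eq x : (0 < d)%N -> exists i, coord_norm x = `|x 0 i|.
Proof.
move=> d0; rewrite /coord_norm (bigmax_eq_arg _ (Ordinal d0))//.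
by exists [arg max_(i > Ordinal d0) `|x 0 i|]%O.
Qed.

End maximum_norm.

Section drifted_small_balls.
Context {R : realType} {d : nat}.
Variables (H K eps0 : R) (f0 : 'rV[R]_d) (M : R).
Hypothesis H01 : 0 < H < 1.
Hypothesis eps01 : 0 < eps0 < 1.
Hypothesis d_gt0 : (0 < d)%N.

Lemma sub01 (t : R) : eps0 <= t <= 1 -> t \in `[0, 1].
Proof.
by move=> /andP[et t1]; rewrite in_itv /= t1 (le_trans _ et)// ltW//; case/andP: eps01.
Qed.

Definition near_event {disp} {T : measurableType disp} (P : probability T R)
  (B : 'I_d -> R -> {RV P >-> R}) (f : R -> 'rV[R]_d) (e t : R) (x : 'rV[R]_d) : set T :=
  [set w | forall i, `|drifted_path B f w t 0 i - x 0 i| <= e].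

Let psa_near {disp} {T : measurableType disp} (P : probability T R) (X : R -> {RV P >-> R})
    (t y e : R) : t \in `[0, 1] -> process_sigma_algebra X [set w | `|X t w - y| <= e].
Proof.
move=> t01; apply: sub_sigma_algebra; exists t, `[y - e, y + e]%classic; split => //.
apply/seteqP; split => w /=; rewrite in_itv /= ler_norml; lra.
Qed.

Lemma near_eventE {disp} {T : measurableType disp} (P : probability T R)
    (B : 'I_d -> R -> {RV P >-> R}) (f : R -> 'rV[R]_d) (e t : R) x :
  near_event B f e t x = \bigcap_i [set w | `|B i t w - (x 0 i - f t 0 i)| <= e].
Proof.
apply/seteqP; split => w h i.
  by move=> _; have := h i; rewrite drifted_pathE /= opprB addrA.
by have := h i I; rewrite drifted_pathE /= opprB addrA.
Qed.

Lemma measurable_near_event {disp} {T : measurableType disp} (P : probability T R)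
    (B : 'I_d -> R -> {RV P >-> R}) (f : R -> 'rV[R]_d) (e t : R) x :
  measurable (near_event B f e t x).
Proof.
rewrite near_eventE; apply: fin_bigcap_measurable; first exact: finite_finset.
move=> i _; apply: measurable_le_set; last exact: measurable_cst.
apply: measurableT_comp => //; apply: measurable_funB => //.
Qed.

Lemma near_event_ge : exists2 c : R, 0 < c &
  forall disp (T : measurableType disp) (P : probability T R)
    (B : 'I_d -> R -> {RV P >-> R}) (f : R -> 'rV[R]_d),
  independent_processes B -> (forall i, gaussian_fbm H (B i)) ->
  holder_continuous H K f -> f 0 = f0 ->
  forall (t e : R) (x : 'rV[R]_d), eps0 <= t <= 1 -> 0 < e <= 1 -> (forall i, `|x 0 i| <= M) ->
  (((c * e) ^+ d)%:E <= P (near_event B f e t x))%E.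
Proof.
have [c c0 hc] := one_point_probability H01 eps01 (M + (enorm f0 + `|K|)).
exists c => // disp T P B f indB gB hf ff0 t e x t01 e01 xM.
rewrite near_eventE indB; last by move=> i; apply: psa_near; exact: sub01.
have mA i : measurable [set w | `|B i t w - (x 0 i - f t 0 i)| <= e].
  by apply: (@process_sigma_algebra_measurable _ _ _ _ (B i)); apply: psa_near; exact: sub01.
rewrite (eq_bigr (fun i => (fine (P [set w | `|B i t w - (x 0 i - f t 0 i)| <= e]))%:E)); last first.
  by move=> i _; rewrite fineK// fin_num_measure.
rewrite prodEFin lee_fin.
apply: (@le_trans _ _ (\prod_(i < d) (c * e))); first by rewrite prodr_const card_ord.
have [e0 _] := andP e01.
apply: ler_prod => i _; rewrite mulr_ge0 ?(ltW c0) ?(ltW e0)//=.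
rewrite -lee_fin fineK ?fin_num_measure//; apply: hc => //.
rewrite (le_trans (ler_normB _ _))// lerD//.
by apply: (holder_coord_bounded H01 i hf ff0); exact: sub01.
Qed.

(** In the coordinate where [x] and [y] are the furthest apart, [two_point_probability] is
    used with a decay of order [d]; the other coordinates contribute [e ^+ 2 / U] each,
    with [U = |t - s| `^ H + e]. The drift displaces [y - x] by [O(U)] only. *)
Lemma near_event_pair_le : exists2 C : R, 0 < C &
  forall disp (T : measurableType disp) (P : probability T R)
    (B : 'I_d -> R -> {RV P >-> R}) (f : R -> 'rV[R]_d),
  independent_processes B -> (forall i, gaussian_fbm H (B i)) ->
  holder_continuous H K f -> f 0 = f0 ->
  forall (s t e : R) (x y : 'rV[R]_d), eps0 <= s <= 1 -> eps0 <= t <= 1 -> 0 < e ->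
    (forall i, `|x 0 i| <= M) ->
  (P (near_event B f e s x `&` near_event B f e t y) <=
    (C * (e ^+ 2) ^+ d * ((`|t - s| `^ H + (e + coord_norm (y - x))) ^+ d)^-1)%:E)%E.
Proof.
have [C1 C10 hC1] := two_point_probability H01 eps01 (M + (enorm f0 + `|K|)) d.-1.
exists (C1 ^+ d * (1 + `|K|) ^+ d); first by rewrite mulr_gt0// exprn_gt0// ltr_pwDl.
move=> disp T P B f indB gB hf ff0 s t e x y s01 t01 e0 xM.
pose A i := [set w | (`|B i s w - (x 0 i - f s 0 i)| <= e)%R /\
  (`|B i t w - (y 0 i - f t 0 i)| <= e)%R].
have -> : near_event B f e s x `&` near_event B f e t y = \bigcap_i A i.
  rewrite !near_eventE; apply/seteqP; split => w.
    by move=> [h1 h2] i _; split; [exact: (h1 i I)|exact: (h2 i I)].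
  by move=> h; split => i _; have [] := h i I.
have psaA i : process_sigma_algebra (B i) (A i).
  have h1 := psa_near (X := B i) (x 0 i - f s 0 i) e (sub01 s01).
  have h2 := psa_near (X := B i) (y 0 i - f t 0 i) e (sub01 t01).
  rewrite /process_sigma_algebra in h1 h2 *.
  set G := [set _ | _] in h1 h2 *.
  exact: (@measurableI _ (g_sigma_algebraType G) _ _ h1 h2).
have mA i : measurable (A i) by exact: process_sigma_algebra_measurable (psaA i).
rewrite indB//.
rewrite (eq_bigr (fun i => (fine (P (A i)))%:E)); last by move=> i _; rewrite fineK ?fin_num_measure.
rewrite prodEFin lee_fin.
set U := `|t - s| `^ H + e.
have U0 : 0 < U by rewrite ltr_wpDl ?powR_ge0.
set rho := coord_norm (y - x); have rho0 : 0 <= rho by exact: coord_norm_ge0.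
pose g i := C1 * e ^+ 2 * U ^+ d.-1 / (U + `|(y 0 i - f t 0 i) - (x 0 i - f s 0 i)|) ^+ d.-1.+1.
have Ag i : fine (P (A i)) <= g i.
  rewrite -lee_fin fineK ?fin_num_measure//; apply: hC1 => //.
  rewrite (le_trans (ler_normB _ _))// lerD//.
  by apply: (holder_coord_bounded H01 i hf ff0); exact: sub01.
have g_le i : g i <= C1 * e ^+ 2 / U.
  rewrite /g -mulrA ler_wpM2l ?mulr_ge0 ?sqr_ge0 ?(ltW C10) ?(ltW e0)//.
  rewrite ler_pdivrMr; last by apply: exprn_gt0; exact: (ltr_wpDr (normr_ge0 _) U0).
  have -> : U ^+ d.-1 = U^-1 * U ^+ d.-1.+1 by rewrite exprS mulKf// gt_eqF.
  rewrite ler_wpM2l ?invr_ge0 ?(ltW U0)// lerXn2r ?nnegrE ?(ltW U0) ?lerDl//.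
  by rewrite addr_ge0// ltW.
have [i0 i0E] := coord_norm_eq (y - x) d_gt0.
have U_rho : 0 < U + rho by exact: (ltr_wpDr rho0 U0).
have K1 : 0 < 1 + `|K| by rewrite ltr_pwDl.
have g_i0 : g i0 <= C1 * e ^+ 2 * U ^+ d.-1 * ((1 + `|K|) ^+ d / (U + rho) ^+ d).
  rewrite /g ler_wpM2l ?mulr_ge0 ?exprn_ge0 ?(ltW C10) ?(ltW U0) ?(ltW e0) ?sqr_ge0//.
  rewrite prednK//; set z := `|y 0 i0 - f t 0 i0 - _|.
  have Uz : 0 < U + z by exact: (ltr_wpDr (normr_ge0 _) U0).
  rewrite -expr_div_n -exprVn lerXn2r ?nnegrE ?invr_ge0 ?divr_ge0 ?(ltW Uz) ?(ltW K1) ?(ltW U_rho)//.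
  rewrite ler_pdivlMr// ler_pdivrMl//.
  have fK : `|f t 0 i0 - f s 0 i0| <= `|K| * U.
    have := coord_le_enorm (f t - f s) i0; rewrite !mxE => /le_trans; apply.
    apply: (le_trans (hf _ _ (sub01 s01) (sub01 t01))).
    apply: (le_trans (ler_wpM2r (powR_ge0 _ _) (ler_norm K))).
    by rewrite ler_wpM2l// /U lerDl ltW.
  have rz : rho <= z + `|K| * U.
    rewrite /rho i0E !mxE.
    have -> : y 0 i0 - x 0 i0 = ((y 0 i0 - f t 0 i0) - (x 0 i0 - f s 0 i0)) +
      (f t 0 i0 - f s 0 i0) by ring.
    by rewrite (le_trans (ler_normD _ _))// lerD.
  have : 0 <= `|K| * z by exact: (mulr_ge0 (normr_ge0 _) (normr_ge0 _)).
  have -> : (U + z) * (1 + `|K|) = U + z + `|K| * U + `|K| * z by ring.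
  lra.
rewrite addrA -/U -/rho.
apply: (@le_trans _ _ (\prod_(i < d) g i)).
  by apply: ler_prod => i _; rewrite fine_ge0//= Ag.
rewrite (bigD1 i0)//=.
have g0 i : 0 <= g i by apply: le_trans (Ag i); exact: fine_ge0.
apply: (@le_trans _ _ (C1 * e ^+ 2 * U ^+ d.-1 * ((1 + `|K|) ^+ d / (U + rho) ^+ d) *
    (C1 * e ^+ 2 / U) ^+ d.-1)).
  apply: ler_pM => //; first exact: prodr_ge0.
  apply: (@le_trans _ _ (\prod_(i < d | i != i0) (C1 * e ^+ 2 / U))).
    by apply: ler_prod => i _; rewrite g0/=.
  by rewrite prodr_const cardC1 card_ord.
have expd (z : R) : z ^+ d = z * z ^+ d.-1 by rewrite -exprS prednK.
have Un : U ^+ d.-1 != 0 by rewrite expf_neq0// gt_eqF.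
have Rn : (U + rho) ^+ d != 0 by rewrite expf_neq0// gt_eqF.
rewrite le_eqVlt; apply/orP; left; apply/eqP.
rewrite expr_div_n exprMn (expd C1) (expd (e ^+ 2)).
by field; rewrite Un Rn.
Qed.

End drifted_small_balls.

(** * Discretization of times and of measures *)

Section discretization.
Context {R : realType}.

Lemma time_cells (nu : {finite_measure set (measurableTypeR R) -> \bar R})
    (E : set (measurableTypeR R)) (eta : R) : measurable E -> E `<=` `[0, 1] -> E !=set0 -> 0 < eta ->
  exists (n : nat) (D : 'I_n -> set (measurableTypeR R)) (u : 'I_n -> R),
    [/\ forall l, measurable (D l), trivIset setT D, forall l, E (u l),
        forall l x, D l x -> `|x - u l| <= eta &
        \sum_l fine (nu (D l)) = fine (nu E)].
Proof.
move=> mE EI [t0 Et0] eta0.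
pose n := (Num.truncn eta^-1).+2.
pose D (j : nat) := grid_cell eta j `&` E.
have /choice[u hu] : forall j, exists u, E u /\ forall x, D j x -> `|x - u| <= eta.
  move=> j; have [[u [ju Eu]]|/nonemptyPn D0] := pselect (D j !=set0); last first.
    by exists t0; split => // x; rewrite D0.
  exists u; split => // x [jx _]; move: ju jx.
  rewrite /grid_cell /= !in_itv /= ler_norml => /andP[? ?] /andP[? ?].
  by apply/andP; split; lra.
have mD j : measurable (D j) by apply: measurableI => //; exact: measurable_itv.
have tD : trivIset [set: nat] D.
  apply: ltn_trivIset => m k km; apply/seteqP; split => // x [[+ _] [+ _]].
  rewrite /grid_cell /= !in_itv /= => /andP[x1 _] /andP[_ x2].
  have : k%:R + 1 <= m%:R :> R by rewrite natr1 ler_nat.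
  rewrite -(ler_pM2r eta0); lra.
exists n, (fun j => D j), (fun j => u j); split => //.
- by move=> i j _ _ h; apply/val_inj; exact: tD.
- by move=> l; have [] := hu l.
- by move=> l; have [_] := hu l; exact.
apply/EFin_inj; rewrite -sumEFin fineK ?fin_num_measure//.
rewrite (eq_bigr (fun l : 'I_n => nu (D l))); last by move=> l _; rewrite fineK ?fin_num_measure.
rewrite -(@measure_bigsetU_ord _ _ _ nu n xpredT (fun j => D j))//; last first.
  by move=> i j _ _ h; apply/val_inj; exact: tD.
congr (nu _); rewrite -bigcup_mkord; apply/seteqP; split => x.
  by move=> [j _ []].
move=> Ex; have := EI x Ex; rewrite /= in_itv /= => /andP[x0 x1].
have z0 : 0 <= (1 - x) / eta by rewrite divr_ge0 ?(ltW eta0)// subr_ge0.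
have := truncn_itv z0; set j := Num.truncn _ => /andP[].
rewrite ler_pdivlMr// ltr_pdivrMr// => j1 j2.
exists j.+1 => /=.
  rewrite /n ltnS -(ltr_nat R); apply: le_lt_trans (truncnS_gt _).
  by rewrite -[leRHS]mul1r ler_pdivlMr// (le_trans j1)//; lra.
split => //; rewrite /grid_cell /= in_itv /=.
by move: j2; rewrite -!(natr1 j) !mulrDl !mul1r => j2; apply/andP; split; lra.
Qed.

Context {d : nat}.

Lemma borel_open (A : set 'rV[R]_d) : open A -> @measurable _ (borel_rV R d) A.
Proof. by move=> oA; exact: sub_sigma_algebra. Qed.

Lemma space_cells (F : set 'rV[R]_d) (mu : probability (borel_rV R d) R) (e : R) :
  compact F -> carried_by F mu -> 0 < e ->
  exists (p : nat) (Q : nat -> set (borel_rV R d)) (x : 'I_p -> 'rV[R]_d),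
    [/\ forall k, measurable (Q k), trivIset setT Q, forall k, F (x k),
        forall (k : 'I_p) y, Q k y -> forall i, `|y 0 i - x k 0 i| <= e &
        \sum_(k < p) fine (mu (Q k)) = 1].
Proof.
move=> cF muF e0.
have nV (x : 'rV[R]_d) : nbhs x (ball x e)^° by apply: nbhs_interior; exact: nbhsx_ballx.
have [s [sF Fs]] := compact_net cF nV.
pose V (k : nat) : set (borel_rV R d) := if (k < size s)%N then (ball (nth 0 s k) e)^° else set0.
have mV k : measurable (V k).
  by rewrite /V; case: ifP => // _; apply: borel_open; exact: open_interior.
have mQ k : measurable (seqDU V k) by apply: measurableD => //; exact: bigsetU_measurable.
exists (size s), (seqDU V), (fun k => nth 0 s k); split => //.
- by move=> k; apply: sF; rewrite mem_nth.
- move=> k y Qy i; have Vy : V k y by exact: subset_seqDU Qy.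
  move: Vy; rewrite /V ltn_ord => Vy.
  have [_ /(_ 0 i) h] : ball (nth 0 s k) e y by exact: interior_subset Vy.
  by rewrite distrC; exact: ltW h.
apply/EFin_inj; rewrite -sumEFin.
rewrite (eq_bigr (fun l : 'I_(size s) => mu (seqDU V l))); last by move=> l _; rewrite fineK ?fin_num_measure.
rewrite -(@measure_bigsetU_ord _ _ _ mu (size s) xpredT (fun j => seqDU V j))//; last first.
  by move=> i j _ _ h; apply/val_inj; exact: (@trivIset_seqDU _ V _ _ I I h).
rewrite -bigsetU_seqDU.
set A := \big[setU/set0]_(i < _) _.
have mA : measurable A by exact: bigsetU_measurable.
have AF : ~` A `<=` ~` F.
  apply: subsetC => y /Fs[x xs xy]; rewrite /A -bigcup_mkord; exists (index x s) => /=.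
    by rewrite index_mem.
  by rewrite /V index_mem xs nth_index.
have /negligibleP : mu.-negligible (~` A) by apply: negligibleS muF.
move=> /(_ (measurableC mA)) muA.
rewrite -(@probability_setT _ _ _ mu) -(setUv A) measureU ?setICr//; last exact: measurableC.
by rewrite [X in (_ + X)%E]muA adde0.
Qed.

(** On products of cells the kernel is bounded below by constants, and the integral of the
    resulting step function is the double sum. *)
Lemma energy_ge (gam C : R) (mu : probability (borel_rV R d) R) (p : nat)
    (Q : nat -> set (borel_rV R d)) (S : 'I_p -> 'I_p -> R) : 0 < C ->
  (forall k, measurable (Q k)) -> trivIset setT Q -> (forall k l, 0 <= S k l) ->
  (forall (k l : 'I_p) x y, Q k x -> Q l y ->
    (S k l)%:E <= C%:E * riesz_kernel gam (enorm (x - y)))%E ->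
  ((\sum_(k < p) \sum_(l < p) fine (mu (Q k)) * fine (mu (Q l)) * S k l)%:E <= C%:E * riesz_energy gam mu)%E.
Proof.
move=> C0 mQ tQ S0 hS.
have ker0 (x y : 'rV[R]_d) : (0 <= riesz_kernel gam (enorm (x - y)))%E.
  by rewrite riesz_kernel_ge0// enorm_ge0.
pose h k := \sum_(l < p) S k l / C * fine (mu (Q l)).
have h0 k : 0 <= h k.
  by apply: sumr_ge0 => l _; rewrite mulr_ge0 ?fine_ge0// divr_ge0// ltW.
have hk (k : 'I_p) x : Q k x -> ((h k)%:E <= \int[mu]_y riesz_kernel gam (enorm (x - y)%R))%E.
  move=> Qx; rewrite /h -sumEFin.
  rewrite (eq_bigr (fun l => (S k l / C)%:E * mu (Q l))%E); last first.
    by move=> l _; rewrite EFinM fineK ?fin_num_measure.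
  apply: (@simple_le_integral _ _ _ _ mu Q (fun l => S k l / C)) => //.
    by move=> l; rewrite divr_ge0// ltW.
  move=> l y Qy; rewrite EFinM muleC lee_pdivrMl//.
  exact: hS.
have -> : \sum_(k < p) \sum_(l < p) fine (mu (Q k)) * fine (mu (Q l)) * S k l =
    C * \sum_(k < p) h k * fine (mu (Q k)).
  rewrite mulr_sumr; apply: eq_bigr => k _; rewrite mulrCA mulr_suml.
  by apply: eq_bigr => l _; field; exact: lt0r_neq0.
rewrite EFinM lee_wpmul2l ?lee_fin ?(ltW C0)// -sumEFin.
rewrite (eq_bigr (fun k => (h k)%:E * mu (Q k))%E); last first.
  by move=> l _; rewrite EFinM fineK ?fin_num_measure.
apply: (@simple_le_integral _ _ _ _ mu Q h) => //.
by move=> x; apply: integral_ge0 => y _; exact: ker0.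
Qed.

End discretization.

(** * Energy bound *)

Section lower_bound.
Context {R : realType} {d : nat}.
Variables (H K eps0 beta c : R) (f0 : 'rV[R]_d) (F : set 'rV[R]_d).
Variables (nu : {finite_measure set (measurableTypeR R) -> \bar R}) (E : set (measurableTypeR R)).
Hypothesis H01 : 0 < H < 1.
Hypothesis eps01 : 0 < eps0 < 1.
Hypothesis cF : compact F.
Hypothesis d_gt0 : (0 < d)%N.
Hypothesis c0 : 0 < c.
Hypothesis nuE : forall a delta : R, E a -> 0 < delta ->
  (nu `[(a - delta)%R, (a + delta)%R]%classic <= (c * delta `^ beta)%:E)%E.
Hypothesis mE : measurable E.
Hypothesis EI : E `<=` `[eps0, 1].
Hypothesis E0 : (0 < nu E)%E.
Let gam := d%:R - beta / H.

(** The second moment method applied to the weighted number of good pairs (cell of [E],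
    cell of [F]). The constants depend neither on the scale [e] nor on [mu]. The
    inequality is kept for all [tau], because positivity of the energy is itself a
    consequence of it. *)
Lemma approximate_hitting : exists a A : R, [/\ 0 < a, 0 < A &
  forall disp (T : measurableType disp) (P : probability T R)
    (B : 'I_d -> R -> {RV P >-> R}) (f : R -> 'rV[R]_d),
  independent_processes B -> (forall i, gaussian_fbm H (B i)) ->
  holder_continuous H K f -> f 0 = f0 ->
  forall (mu : probability (borel_rV R d) R) (en e : R), carried_by F mu ->
    riesz_energy gam mu = en%:E -> 0 < e <= 1 ->
  exists U, [/\ measurable U,
    forall w, U w -> exists t x, [/\ E t, F x & near_event B f e t x w] &
    forall tau, 0 <= tau -> ((2 * tau * a)%:E <= P U + (tau ^+ 2 * A * en)%:E)%E]].
Proof.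
have [H0 H1] := andP H01; have [eps00 eps0lt1] := andP eps01.
have [M M0 hM] := compact_coord_bounded cF.
have [c1 c10 hge] := near_event_ge K f0 M H01 eps01.
have [C2 C20 hpair] := near_event_pair_le K f0 M H01 eps01 d_gt0.
have rm0 : 0 < 2 * M + 1 by rewrite ltr_wpDl// mulr_ge0.
have D1 : 1 <= 2 * d%:R :> R.
  by have : 1 <= d%:R :> R; [rewrite ler1n|lra].
have [C4 C40 hshell] := dyadic_shell_sum gam rm0 D1.
pose m := fine (nu E).
have m0 : 0 < m by rewrite fine_gt0// E0 -ge0_fin_numE// fin_num_measure.
pose C3 := 2 ^+ d * c * 2 `^ beta.
have C30 : 0 < C3 by rewrite !mulr_gt0 ?exprn_gt0 ?powR_gt0.
exists (m * c1 ^+ d), (C2 * C3 * m * C4); split.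
- by rewrite mulr_gt0// exprn_gt0.
- by rewrite !mulr_gt0.
move=> disp T P B f indB gB hf ff0 mu en e muF muen /andP[e0 e1].
pose eta := e `^ H^-1.
have eta0 : 0 < eta by exact: powR_gt0.
have etaH : eta `^ H = e by rewrite -powRrM mulVf ?lt0r_neq0// powRr1// ltW.
have EI01 : E `<=` `[0, 1].
  by move=> t /EI; rewrite /= !in_itv /= => /andP[t1 ->]; rewrite (le_trans _ t1)// ltW.
have En0 : E !=set0.
  by apply/set0P/eqP => h; move: E0; rewrite h measure0 ltxx.
have [n [D [u [mD tD Eu Du Dm]]]] := time_cells nu mE EI01 En0 eta0.
have [p [Q [x [mQ tQ Fx Qx Qm]]]] := space_cells cF muF e0.
have uI l : eps0 <= u l <= 1 by have := EI (Eu l); rewrite /= in_itv.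
pose w (l : 'I_n) := fine (nu (D l)).
pose v (k : 'I_p) := fine (mu (Q k)).
have w0 l : 0 <= w l by exact: fine_ge0.
have v0 k : 0 <= v k by exact: fine_ge0.
pose r k q := e + coord_norm (x q - x k).
have r0 k q : 0 < r k q <= 2 * M + 1.
  rewrite /r ltr_pwDl ?coord_norm_ge0//= addrC lerD//.
  apply: coord_norm_le; first by rewrite mulr_ge0.
  move=> i; rewrite !mxE (le_trans (ler_normB _ _))// mulr_natl mulr2n lerD//; exact: hM.
have /choice[N hN] : forall kq : 'I_p * 'I_p, exists N, 1 <= 2 ^+ N * r kq.1 kq.2 /\
    forall z, 0 <= z <= 2 * d%:R * r kq.1 kq.2 ->
    ((\sum_(m < N.+1) (2 ^+ m * r kq.1 kq.2) `^ (- gam))%:E <= C4%:E * riesz_kernel gam z)%E.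
  by move=> kq; exact: hshell.
pose S k q := \sum_(m < (N (k, q)).+1) (2 ^+ m * r k q) `^ (- gam).
have S0 k q : 0 <= S k q by apply: sumr_ge0 => j _; exact: powR_ge0.
have energy : \sum_k \sum_q v k * v q * S k q <= C4 * en.
  rewrite -lee_fin [leRHS]EFinM -muen; apply: energy_ge => // k q y z Qy Qz.
  apply: (hN (k, q)).2 => /=; rewrite enorm_ge0/=.
  have -> : 2 * d%:R * r k q = d%:R * (2 * r k q) by ring.
  have [rkq _] := andP (r0 k q).
  apply: enorm_le_coord; first by rewrite mulr_ge0// ltW.
  move=> i; rewrite !mxE.
  have -> : y 0 i - z 0 i = (y 0 i - x k 0 i) - (z 0 i - x q 0 i) - (x q 0 i - x k 0 i) by ring.
  have h1 := Qx k y Qy i; have h2 := Qx q z Qz i.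
  have h3 := le_coord_norm (x q - x k) i; rewrite !mxE in h3.
  apply: (le_trans (ler_normB _ _)); have := ler_normB (y 0 i - x k 0 i) (z 0 i - x q 0 i).
  have := coord_norm_ge0 (x q - x k); rewrite /r; lra.
pose A (a : 'I_n * 'I_p) := near_event B f e (u a.1) (x a.2).
have mA a : measurable (A a) by exact: measurable_near_event.
pose W (a : 'I_n * 'I_p) := w a.1 * v a.2.
have W0 a : 0 <= W a by rewrite mulr_ge0.
pose U := \bigcup_(a in [set: 'I_n * 'I_p]) A a.
have mU : measurable U by apply: fin_bigcup_measurable => //; exact: finite_finset.
exists U; split => //.
  by move=> om [[l k] _ h]; exists (u l), (x k).
move=> tau tau0.
have ed0 : 0 < e ^+ d by rewrite exprn_gt0.
have AU a : A a `<=` U by move=> om h; exists a.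
have lam0 : 0 <= tau / e ^+ d by rewrite divr_ge0// ltW.
have := second_moment P W0 mA mU AU lam0.
have first_moment : ((m * (c1 * e) ^+ d)%:E <= \sum_a (W a)%:E * P (A a))%E.
  apply: (@le_trans _ _ (\sum_a (W a)%:E * ((c1 * e) ^+ d)%:E)%E); last first.
    apply: lee_sum => a _; rewrite lee_wpmul2l ?lee_fin//.
    apply: (hge _ _ P B f indB gB hf ff0) => //; first by rewrite e0.
    by move=> i; apply: hM.
  rewrite (eq_bigr (fun a => (W a * (c1 * e) ^+ d)%:E)); last by move=> a _; rewrite EFinM.
  rewrite sumEFin lee_fin -mulr_suml.
  rewrite -(pair_bigA _ (fun l k => w l * v k)) /= -big_distrlr /=.
  by rewrite Qm mulr1 Dm.
have pair_moment : (\sum_a \sum_b (W a * W b)%:E * P (A a `&` A b) <=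
    (C2 * (e ^+ 2) ^+ d * (C3 * m * (C4 * en)))%:E)%E.
  pose g (a b : 'I_n * 'I_p) := ((`|u b.1 - u a.1| `^ H + r a.2 b.2) ^+ d)^-1.
  apply: (@le_trans _ _ (\sum_a \sum_b (W a * W b * (C2 * (e ^+ 2) ^+ d * g a b))%:E)%E).
    apply: lee_sum => a _; apply: lee_sum => b _.
    rewrite [leRHS]EFinM lee_wpmul2l ?lee_fin ?mulr_ge0//.
    apply: (hpair _ _ P B f indB gB hf ff0) => //.
    by move=> i; apply: hM.
  rewrite (eq_bigr (fun a => (\sum_b W a * W b * (C2 * (e ^+ 2) ^+ d * g a b))%:E)); last first.
    by move=> a _; rewrite sumEFin.
  rewrite sumEFin lee_fin.
  have -> : \sum_a \sum_b W a * W b * (C2 * (e ^+ 2) ^+ d * g a b) =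
      C2 * (e ^+ 2) ^+ d * \sum_a \sum_b W a * W b * g a b.
    rewrite mulr_sumr; apply: eq_bigr => a _; rewrite mulr_sumr; apply: eq_bigr => b _; ring.
  rewrite ler_wpM2l ?mulr_ge0 ?exprn_ge0 ?(ltW C20) ?(ltW e0)//.
  apply: (@le_trans _ _ (\sum_l \sum_k \sum_q w l * v k * v q * (C3 * S k q))).
    rewrite -(pair_bigA _ (fun l k => \sum_b W (l, k) * W b * g (l, k) b)) /=.
    apply: ler_sum => l _; apply: ler_sum => k _.
    rewrite -(pair_bigA _ (fun l' q => W (l, k) * W (l', q) * g (l, k) (l', q))) /=.
    rewrite exchange_big /=; apply: ler_sum => q _.
    rewrite (eq_bigr (fun l' => w l * v k * v q * (w l' * g (l, k) (l', q)))); last first.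
      by move=> l' _; rewrite /W /=; ring.
    rewrite -mulr_sumr ler_wpM2l ?mulr_ge0//.
    rewrite (eq_bigr (fun l' => fine (nu (D l')) * ((`|u l - u l'| `^ H + r k q) ^+ d)^-1)); last first.
      by move=> l' _; rewrite /g /= distrC.
    have [rkq _] := andP (r0 k q).
    apply: (@regular_kernel_sum _ H beta c nu E H0 nuE n d (N (k, q)) D u eta (r k q) (u l)) => //.
    - by rewrite etaH /r lerDl coord_norm_ge0.
    - exact: (hN (k, q)).1.
    - by move=> l'; have := uI l; have := uI l'; rewrite ler_norml; lra.
  have -> : \sum_l \sum_k \sum_q w l * v k * v q * (C3 * S k q) =
      C3 * m * \sum_k \sum_q v k * v q * S k q.
    rewrite /m -Dm -mulrA mulr_suml mulr_sumr; apply: eq_bigr => l _.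
    rewrite !mulr_sumr; apply: eq_bigr => k _; rewrite !mulr_sumr; apply: eq_bigr => q _.
    by rewrite /w; ring.
  by rewrite ler_wpM2l ?mulr_ge0// ltW.
have fU : (P U \is a fin_num)%E by exact: fin_num_measure.
rewrite -(fineK fU) => h.
have {}h : 2 * (tau / e ^+ d) * (m * (c1 * e) ^+ d) <=
    fine (P U) + (tau / e ^+ d) ^+ 2 * (C2 * (e ^+ 2) ^+ d * (C3 * m * (C4 * en))).
  rewrite -lee_fin [X in (X <= _)%E]EFinM [X in (_ <= X)%E]EFinD [X in (_ <= _ + X)%E]EFinM.
  apply: (le_trans _ (le_trans h _)).
    by rewrite lee_wpmul2l// lee_fin mulr_ge0.
  by rewrite leeD2l// lee_wpmul2l// lee_fin sqr_ge0.
rewrite -EFinD lee_fin.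
have -> : 2 * tau * (m * c1 ^+ d) = 2 * (tau / e ^+ d) * (m * (c1 * e) ^+ d).
  by rewrite exprMn; field; exact: lt0r_neq0.
suff -> : tau ^+ 2 * (C2 * C3 * m * C4) * en =
  (tau / e ^+ d) ^+ 2 * (C2 * (e ^+ 2) ^+ d * (C3 * m * (C4 * en))) by [].
by rewrite -exprM mulnC exprM; field; exact: lt0r_neq0.
Qed.

End lower_bound.

Section limsup_of_events.
Context {R : realType} {disp : measure_display} {T : measurableType disp}.

(** A reverse form of Fatou's lemma. *)
Lemma probability_limsup_ge (P : probability T R) (U : (set T)^nat) (q : \bar R) :
  (forall n, measurable (U n)) -> (forall n, q <= P (U n))%E ->
  (q <= P (\bigcap_N \bigcup_(n in [set n | (N <= n)%N]) U n))%E.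
Proof.
move=> mU qU; pose V N := \bigcup_(n in [set n | (N <= n)%N]) U n.
have mV N : measurable (V N) by apply: bigcup_measurable.
have mI : measurable (\bigcap_N V N) by exact: bigcap_measurableType.
have cv : P (V N) @[N --> \oo] --> P (\bigcap_N V N).
  apply: (@nonincreasing_cvg_mu _ _ _ P V) => //.
    by rewrite -ge0_fin_numE// fin_num_measure.
  move=> N N' NN; apply/subsetPset => w [n /= Nn Uw]; exists n => //=.
  exact: leq_trans Nn.
rewrite -(cvg_lim _ cv)//; apply: lime_ge.
  by apply/cvg_ex; exists (P (\bigcap_N V N)).
apply: nearW => N; apply: (le_trans (qU N)); apply: le_measure; rewrite ?inE//.
by move=> w Uw; exists N => /=.
Qed.

End limsup_of_events.

Section capacity_lower_bound.
Context {R : realType} {d : nat}.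
Variables (H K eps0 beta c : R) (f0 : 'rV[R]_d) (F : set 'rV[R]_d).
Variables (nu : {finite_measure set (measurableTypeR R) -> \bar R}) (E : set (measurableTypeR R)).
Hypothesis H01 : 0 < H < 1.
Hypothesis eps01 : 0 < eps0 < 1.
Hypothesis cF : compact F.
Hypothesis d_gt0 : (0 < d)%N.
Hypothesis c0 : 0 < c.
Hypothesis nuE : forall a delta : R, E a -> 0 < delta ->
  (nu `[(a - delta)%R, (a + delta)%R]%classic <= (c * delta `^ beta)%:E)%E.
Hypothesis cE : compact (E : set R).
Hypothesis mE : measurable E.
Hypothesis EI : E `<=` `[eps0, 1].
Hypothesis E0 : (0 < nu E)%E.
Let gam := d%:R - beta / H.

(** Points of infinitely many approximate hitting events are in the hitting event, which
    removes the scale from [approximate_hitting]; optimizing [tau] gives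
    [P hit >= (a ^+ 2 / A) / energy]. *)
Lemma capacity_le_hitting : exists C : R, 0 < C /\
  forall disp (T : measurableType disp) (P : probability T R)
    (B : 'I_d -> R -> {RV P >-> R}) (f : R -> 'rV[R]_d) (Om : set T),
  independent_processes B -> (forall i, gaussian_fbm H (B i)) ->
  holder_continuous H K f -> f 0 = f0 ->
  measurable Om -> P (~` Om) = 0%E -> continuous_paths (drifted_path B f) Om ->
  measurable (hitting (contact (drifted_path B f) Om F) E) ->
  ((C^-1)%:E * riesz_capacity gam F <= P (hitting (contact (drifted_path B f) Om F) E))%E.
Proof.
have [a [A [a0 A0 happrox]]] :=
  approximate_hitting K f0 H01 eps01 cF d_gt0 c0 nuE mE EI E0.
exists (A / a ^+ 2); split; first by rewrite divr_gt0// exprn_gt0.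
move=> disp T P B f Om indB gB hf ff0 mOm POm contG; set hit := hitting _ E => mhit.
have EI01 : E `<=` `[0, 1].
  move=> t /EI; rewrite /= !in_itv /= => /andP[t1 ->].
  by rewrite (le_trans _ t1)// ltW//; case/andP: eps01.
have fhit : (P hit \is a fin_num)%E by exact: fin_num_measure.
set p := fine (P hit).
have p0 : 0 <= p by exact: fine_ge0.
have p1 : p <= 1 by rewrite -lee_fin fineK//; exact: probability_le1.
have key mu en tau : carried_by F mu -> riesz_energy gam mu = en%:E -> 0 <= tau ->
    2 * tau * a <= p + tau ^+ 2 * A * en.
  move=> muF muen tau0.
  have /choice[U hU] : forall n : nat, exists U, [/\ measurable U,
      forall w, U w -> exists t x, [/\ E t, F x & near_event B f n.+1%:R^-1 t x w] &
      ((2 * tau * a)%:E <= P U + (tau ^+ 2 * A * en)%:E)%E].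
    move=> n; have n01 : 0 < (n.+1%:R^-1 : R) <= 1.
      by rewrite invr_gt0 ltr0Sn/= invf_le1// ler1n.
    have [U [mU nU PU]] := happrox _ _ P B f indB gB hf ff0 mu en _ muF muen n01.
    by exists U; split => //; exact: PU.
  pose L := \bigcap_N \bigcup_(n in [set n | (N <= n)%N]) U n.
  have mU n : measurable (U n) by have [] := hU n.
  have mL : measurable L.
    by apply: bigcap_measurableType => N _; exact: bigcup_measurable.
  have Lhit : L `<=` hit `|` ~` Om.
    move=> w Lw; have [Ow|Ow] := pselect (Om w); [left|by right].
    apply: (contact_of_approximate cF contG cE) => // e e0.
    pose N := Num.truncn e^-1.
    have [n /= Nn Uw] := Lw N I.
    have [_ /(_ w Uw)[t [x [Et Fx near]]] _] := hU n.
    exists t, x; split => // i; apply: (le_lt_trans (near i)).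
    rewrite invf_plt ?posrE// (lt_le_trans (truncnS_gt _))//.
    by rewrite ler_nat ltnS.
  have PL : (P L <= P hit)%E.
    apply: (@le_trans _ _ (P (hit `|` ~` Om))).
      apply: le_measure; rewrite ?inE//.
      by apply: measurableU => //; exact: measurableC.
    apply: (le_trans (measureU2 _ _ _)) => //; first exact: measurableC.
    by rewrite [X in (_ + X)%E]POm adde0.
  have : ((2 * tau * a - tau ^+ 2 * A * en)%:E <= P L)%E.
    apply: probability_limsup_ge => // n; have [_ _ PU] := hU n.
    by rewrite EFinB leeBlDr.
  by move=> /le_trans/(_ PL); rewrite -(fineK fhit) -/p lee_fin; lra.
have energy_gt0 mu en : carried_by F mu -> riesz_energy gam mu = en%:E -> 0 < en.
  move=> muF muen; rewrite ltNge; apply/negP => en0.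
  have ia0 : 0 <= a^-1 by rewrite invr_ge0 ltW.
  have := key mu en a^-1 muF muen ia0.
  have -> : 2 * a^-1 * a = 2 by field; exact: lt0r_neq0.
  have : a^-1 ^+ 2 * A * en <= 0 by rewrite mulr_ge0_le0// mulr_ge0 ?exprn_ge0// ltW.
  lra.
have energy_ge mu en : carried_by F mu -> riesz_energy gam mu = en%:E -> a ^+ 2 / A <= p * en.
  move=> muF muen; have en0 := energy_gt0 mu en muF muen.
  have t0 : 0 <= a / (A * en) by rewrite divr_ge0// ?mulr_ge0// ltW.
  have := key mu en _ muF muen t0.
  have -> : 2 * (a / (A * en)) * a = 2 * (a ^+ 2 / A / en).
    by field; rewrite !lt0r_neq0.
  have -> : (a / (A * en)) ^+ 2 * A * en = a ^+ 2 / A / en.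
    by field; rewrite !lt0r_neq0.
  move=> h; rewrite -ler_pdivrMr//; lra.
have a2A : 0 < a ^+ 2 / A by rewrite divr_gt0// exprn_gt0.
have riesz0 (mu : probability (borel_rV R d) R) : (0 <= riesz_energy gam mu)%E.
  apply: integral_ge0 => x _; apply: integral_ge0 => y _.
  by apply: riesz_kernel_ge0; exact: enorm_ge0.
rewrite /riesz_capacity invf_div.
set S := [set _ | _ in _].
have [[mu [muF fmu]]|nofin] := pselect (exists mu, carried_by F mu /\ riesz_energy gam mu \is a fin_num); last first.
  rewrite (_ : ereal_inf S = +oo%E) ?invey ?mule0//.
  apply/ereal_inf_pinfty => _ [mu muF <-].
  apply: contrapT => /= /eqP h; apply: nofin; exists mu; split => //.
  by rewrite ge0_fin_numE// lt_neqAle h leey.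
pose en := fine (riesz_energy gam mu).
have muen : riesz_energy gam mu = en%:E by rewrite /en fineK.
have pgt0 : 0 < p.
  have en0 := energy_gt0 mu en muF muen.
  by rewrite -(pmulr_lgt0 _ en0); exact: lt_le_trans (energy_ge mu en muF muen).
have Sge : ((a ^+ 2 / A / p)%:E <= ereal_inf S)%E.
  apply: le_ereal_inf_tmp => _ [mu' mu'F <-].
  have [e'|->] : riesz_energy gam mu' \is a fin_num \/ riesz_energy gam mu' = +oo%E.
  - by move: (riesz0 mu'); case: (riesz_energy gam mu') => //; [left|right].
  - rewrite -(fineK e') lee_fin ler_pdivrMr// [leRHS]mulrC.
    by apply: (energy_ge mu') => //; rewrite fineK.
  - exact: leey.
have Sle : (ereal_inf S <= en%:E)%E by rewrite -muen; apply: ereal_inf_lbound; exists mu.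
move: Sge Sle; case: (ereal_inf S) => [x|//|]; last by rewrite leeNy_eq.
rewrite !lee_fin => xge _.
have x0 : 0 < x by apply: lt_le_trans xge; rewrite divr_gt0.
rewrite inver gt_eqF// -EFinM -(fineK fhit) lee_fin -/p.
by rewrite ler_pdivrMr// [leRHS]mulrC -ler_pdivrMr.
Qed.

End capacity_lower_bound.

(** * Hausdorff measure and capacity *)

Lemma riesz_capacity_ge0 (R : realType) (d : nat) (alpha : R) (A : set 'rV[R]_d) :
  (0 <= riesz_capacity alpha A)%E.
Proof.
rewrite inve_ge0; apply: le_ereal_inf_tmp => _ [mu _ <-].
apply: integral_ge0 => x _; apply: integral_ge0 => y _.
by apply: riesz_kernel_ge0; exact: enorm_ge0.
Qed.

Theorem proposition2p8 (R : realType) (d : nat) (H K : R) (f0 : 'rV[R]_d)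
    (F : set 'rV[R]_d) (eps0 beta : R) (E : set (measurableTypeR R))
    (d_gt0 : (0 < d)%N) (H01 : 0 < H < 1) (cF : compact F)
    (eps01 : 0 < eps0 < 1) (mE : measurable E) (EI : E `<=` `[eps0, 1])
    (beta01 : 0 < beta <= 1) (rE : regular_set beta E) :
  exists c10 : R, 0 < c10 /\
    forall (disp : measure_display) (T : measurableType disp)
      (P : probability T R) (B : 'I_d -> R -> {RV P >-> R})
      (f : R -> 'rV[R]_d),
      measure_is_complete P ->
      fractional_brownian_motion H B ->
      holder_continuous H K f -> f 0 = f0 ->
      let hit := [set w | ((fun t => \row_i B i t w + f t)%R @` E) `&` F
                            !=set0] in
      ((c10^-1)%R%:E * riesz_capacity (d%:R - beta / H)%R F <= P hit)%E /\
      (P hit <= c10%:E * hausdorff_measure (d%:R - beta / H)%R F)%E.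
Proof.
have [H0 H1] := andP H01; have [eps00 eps0lt1] := andP eps01.
have [b0 b1] := andP beta01.
have EI01 : E `<=` `[0, 1].
  by move=> t /EI; rewrite /= !in_itv /= => /andP[t1 ->]; rewrite (le_trans _ t1)// ltW.
have [nu [c [nu0 nuEc c0 nuE]]] := rE.
have lo a delta : E a -> 0 < delta <= 1 ->
    ((c^-1 * delta `^ beta)%R%:E <= nu `[(a - delta)%R, (a + delta)%R]%classic)%E.
  by move=> Ea d01; have /andP[] := nuE a delta Ea d01.
have [c' c'0 up] : exists2 C : R, 0 < C & forall a delta : R, E a -> 0 < delta ->
    (nu `[(a - delta)%R, (a + delta)%R]%classic <= (C * delta `^ beta)%:E)%E.
  apply: (regular_set_upper (ltW b0) c0) => a delta Ea d01.
  by have /andP[] := nuE a delta Ea d01.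
have nuE0 : (0 < nu E)%E.
  move: nu0; rewrite -(setUv E) measureU ?setICr//; last exact: measurableC.
  by rewrite [X in (_ + X)%E]nuEc adde0.
have [E' [cE' E'E nuE']] := compact_subset_positive mE EI nuE0.
have mE' : @measurable _ (measurableTypeR R) E'.
  by apply: closed_measurable; apply: compact_closed => //; exact: Rhausdorff.
have up' a delta : E' a -> 0 < delta ->
    (nu `[(a - delta)%R, (a + delta)%R]%classic <= (c' * delta `^ beta)%:E)%E.
  by move=> /E'E; exact: up.
have E'I : E' `<=` `[eps0, 1] by exact: subset_trans EI.
have [C1 [C10 hlow]] :=
  capacity_le_hitting K f0 H01 eps01 cF d_gt0 c'0 up' cE' mE' E'I nuE'.
have [C2 C20 hup] : exists2 C2 : R, 0 < C2 &
  forall (disp : measure_display) (T : measurableType disp) (P : probability T R)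
    (B : 'I_d -> R -> {RV P >-> R}) (f : R -> 'rV[R]_d) (Om : set T),
  independent_processes B -> (forall i, gaussian_fbm H (B i)) ->
  holder_continuous H K f -> f 0 = f0 -> continuous_paths (drifted_path B f) Om ->
  measurable (hitting (contact (drifted_path B f) Om F) E) ->
  (P (hitting (contact (drifted_path B f) Om F) E) <=
    C2%:E * hausdorff_measure (d%:R - beta / H) F)%E.
  have [g0|g0] := leP (d%:R - beta / H) 0.
    exists 1 => // disp T P B f Om _ _ _ _ _ mh.
    by rewrite /hausdorff_measure g0 mule1 probability_le1.
  have [C2 [C20 h]] := hitting_le_hausdorff K f0 H01 eps01 cF c0 lo EI g0.
  by exists C2.
exists (Num.max C1 C2); split; first by rewrite lt_max C10.
move=> disp T P B f cP [indB fB contB] hf ff0 hit.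
have gB i : gaussian_fbm H (B i) by have [? ? _ ?] := fB i.
have [Om [mOm POm contG]] := regular_paths H0 contB hf.
have mG (t : R) i : t \in `[0, 1] -> measurable_fun setT (fun w => drifted_path B f w t 0 i).
  by move=> _; exact: measurable_drifted_path.
have mC := measurable_contact mOm cF mG contG cP mE EI01.
have E'I01 : E' `<=` `[0, 1] by exact: subset_trans EI01.
have mC' := measurable_contact mOm cF mG contG cP mE' E'I01.
have [_ hitE] := hit_event_contact cP mOm POm EI01 mC.
rewrite -/(hit_event B f E F) in hit *; rewrite /hit hitE.
have maxgt0 : 0 < Num.max C1 C2 by rewrite lt_max C10.
have haus0 : (0 <= hausdorff_measure (d%:R - beta / H) F)%E.
  have := le_trans (measure_ge0 P _) (hup _ _ P B f Om indB gB hf ff0 contG mC).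
  by rewrite pmule_rge0.
split.
  apply: (@le_trans _ _ (P (hitting (contact (drifted_path B f) Om F) E'))); last first.
    by apply: le_measure; rewrite ?inE//; exact: hitting_sub.
  apply: le_trans (hlow _ _ P B f Om indB gB hf ff0 mOm POm contG mC').
  rewrite lee_wpmul2r ?riesz_capacity_ge0// lee_fin lef_pV2 ?posrE//.
  by rewrite le_max lexx.
apply: (le_trans (hup _ _ P B f Om indB gB hf ff0 contG mC)).
by rewrite lee_wpmul2r// lee_fin le_max lexx orbT.
Qed.
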